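(* Let $K\ge2$. Consider the $K$-armed Gaussian bandit under weighted information with $\mu=(\mu_1,\dots,\mu_K)\in(\mathbb R^2)^K$ and $\sigma=(\sigma_1^2,\dots,\sigma_K^2)\in(0,\infty)^K$ both unknown to the agent, with a unique optimal arm $k^\star=\arg\max_k\|\mu_k\|$ and gaps $\Delta_k=\|\mu_{k^\star}\|-\|\mu_k\|$. Under the improper uniform prior $f_{\mu_k,\sigma_k^2|\mathcal F_1}\propto 1$ on $\mathbb R^2\times(0,\infty)$ for every arm $k$, the expected cumulative regret incurred by the Weighted Thompson Sampling policy (WTS) satisfies $$\limsup_{T\to\infty}\frac{\mathbb E\{R^{\mathrm{WTS}}_{\mu,\sigma}(T)\}}{\log T}\;\le\;\sum_{k\neq k^\star}\frac{\sigma_k^2}{\Delta_k}.$$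
   Context: Bandit under weighted information. There are $K$ arms with fixed means $\mu_k\in\mathbb R^2$ and variance parameters $\sigma_k^2>0$. $\|\cdot\|$ is the Euclidean norm, $k^\star=\arg\max_k\|\mu_k\|$ (assumed unique), $\Delta_k=\|\mu_{k^\star}\|-\|\mu_k\|$. At each round $t=1,2,\dots$ the agent chooses a power profile $p^{t}=(p^{t}_1,\dots,p^{t}_K)$ in the simplex $\Lambda=\{\xi\in[0,1]^K:\sum_k\xi_k=1\}$, depending only on the past, and then observes $X^t=(X^t_1,\dots,X^t_K)$ where, given the past and $p^{t}$, the $X^t_k$ are independent with $X^t_k\sim\mathcal N\big(\mu_k,\tfrac{\sigma_k^2}{2p^{t}_k}I_2\big)$. $\mathcal F_t$ is the $\sigma$-algebra generated by $(p^{1},X^1,\dots,p^{t-1},X^{t-1})$. The expected cumulative regret of a policy $\pi$ is $\mathbb E\{R^{\pi}_{\mu,\sigma}(T)\}=\sum_{t=1}^T\sum_{k=1}^K\|\mu_k\|\,(p^{t,\star}_k-\mathbb E\{p^{t,\pi}_k\})$, where $p^{t,\star}_{k^\star}=1$ and $p^{t,\star}_k=0$ for $k\ne k^\star$. Statistics: $\bar x_k(t)=\frac{\sum_{\ell=1}^tp^\ell_kX^\ell_k}{\sum_{\ell=1}^tp^\ell_k}$ and $S_k(t)=\sum_{\ell=1}^tp^\ell_k\|X^\ell_k-\bar x_k(t)\|^2$. Under the improper uniform prior, the posterior density of $\mu_k$ given $\mathcal F_t$, for $t\ge4$, is $$f_{\mu_k|\mathcal F_t}(\tilde\mu)=\frac{(t-3)\sum_{\ell=1}^{t-1}p^\ell_k}{\pi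 S_k(t-1)}\Big(1+\frac{\sum_{\ell=1}^{t-1}p^\ell_k\|\tilde\mu-\bar x_k(t-1)\|^2}{S_k(t-1)}\Big)^{-t+2},\quad\tilde\mu\in\mathbb R^2.$$ WTS: for $t=1,2,3$, $p^t=(1/K,\dots,1/K)$. For $t\ge4$, $p^t=\rho^t$ where $\rho^t_k=\mathbb P\{\|\tilde\mu_k(t)\|=\max_i\|\tilde\mu_i(t)\|\,|\,\mathcal F_t\}$ and, given $\mathcal F_t$, $\tilde\mu_1(t),\dots,\tilde\mu_K(t)$ are independent with $\tilde\mu_k(t)\sim f_{\mu_k|\mathcal F_t}$. *)

(* Defs.v *)
From HB Require Import structures.
From mathcomp Require Export all_boot all_order all_algebra.
From mathcomp Require Export all_classical all_reals all_analysis.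
Export Order.TTheory GRing.Theory Num.Theory.
Export numFieldNormedType.Exports.

Set Implicit Arguments.
Unset Strict Implicit.
Unset Printing Implicit Defensive.

Local Open Scope classical_set_scope.
Local Open Scope ring_scope.

Section plane.
Context {R : realType}.

(* The norm that the library puts on [R * R] is the sup norm. *)
Definition enorm (x : R * R) : R := Num.sqrt (x.1 ^+ 2 + x.2 ^+ 2).

Definition lebesgue2 : set (R * R) -> \bar R :=
  (@lebesgue_measure R \x @lebesgue_measure R)%E.

(* [normal_prob] takes the standard deviation; [v] is the variance. *)
Definition normal2 (m : R * R) (v : R) : set (R * R) -> \bar R :=
  (normal_prob m.1 (Num.sqrt v) \x normal_prob m.2 (Num.sqrt v))%E.

Definition law_of_density (f : R * R -> R) : set (R * R) -> \bar R :=
  fun B => (\int[lebesgue2]_(x in B) (f x)%:E)%E.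

End plane.

Section statistics.
Context {R : realType}.
Variables (q : nat -> R) (x : nat -> R * R).

(* Realised powers [q l] and observations [x l] of one arm in the rounds
   l = 1, 2, ...; the values at l = 0 are never used. *)
Definition total_power (t : nat) : R := \sum_(1 <= l < t.+1) q l.

Definition wmean (t : nat) : R * R :=
  ((\sum_(1 <= l < t.+1) q l * (x l).1) / total_power t,
   (\sum_(1 <= l < t.+1) q l * (x l).2) / total_power t).

Definition wscatter (t : nat) : R :=
  \sum_(1 <= l < t.+1) q l * enorm (x l - wmean t) ^+ 2.

(* Posterior density of the mean at the start of round t >= 4, for the prior
   density 1 on R^2 x (0, +oo) of the pair (mean, sigma^2): the product over
   l < t of the densities at [x l] of N(m, sigma^2 / (2 q l) I_2), integrated
   over sigma^2 and normalised in m. *)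
Definition posterior_pdf (t : nat) (m : R * R) : R :=
  (t%:R - 3) * total_power t.-1 / (pi * wscatter t.-1) *
  (1 + total_power t.-1 * enorm (m - wmean t.-1) ^+ 2 / wscatter t.-1)
    ^- (t - 2).

End statistics.

(* [r k] is the probability that the k-th of independent vectors Y_1, ..., Y_K
   with densities f_1, ..., f_K has the largest norm.  The product rule over
   all families [B] states independence and the marginal laws together. *)
Definition argmax_probability {R : realType} {K : nat}
    (f : 'I_K -> R * R -> R) (r : 'I_K -> R) : Prop :=
  exists (d : measure_display) (W : measurableType d) (Q : probability W R)
         (Y : 'I_K -> {RV Q >-> (R * R)%type}),
    (forall B : 'I_K -> set (R * R), (forall k, measurable (B k)) ->
       Q (\bigcap_k (Y k @^-1` B k)) = (\prod_k law_of_density (f k) (B k))%E)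
    /\ forall k,
       (r k)%:E = Q [set w | forall i, enorm (Y i w) <= enorm (Y k w)].

Section bandit.
Context {R : realType} {K : nat} {d : measure_display}
  {Omega : measurableType d} (P : probability Omega R).
Variables (p : nat -> 'I_K -> Omega -> R)
  (X : nat -> 'I_K -> {RV P >-> (R * R)%type}).

(* The sigma-algebra F_t generated by p^1, X^1, ..., p^(t-1), X^(t-1). *)
Definition history (t : nat) : set (set Omega) :=
  <<s [set A | exists (l : nat) (k : 'I_K), (1 <= l < t)%N /\
         (g_sigma_algebra_preimage (p l k) A \/
          g_sigma_algebra_preimage (X l k) A)] >>.

(* Rounds are numbered from 1.  As p^t is F_t-measurable, the law of X^t given
   the past and p^t is its law given F_t; it is stated through the defining
   identity of conditional laws on the product sets, which also expresses the
   conditional independence of the arms. *)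
Definition bandit_under_weighted_information
    (mu : 'I_K -> R * R) (sigma2 : 'I_K -> R) : Prop :=
  [/\ forall t w, (1 <= t)%N ->
        (forall k, 0 <= p t k w <= 1) /\ \sum_k p t k w = 1,
      forall t k, (1 <= t)%N ->
        g_sigma_algebra_preimage (p t k) `<=` history t
    & forall t A (B : 'I_K -> set (R * R)), (1 <= t)%N -> history t A ->
        (forall k, measurable (B k)) ->
        (P (A `&` \bigcap_k (X t k @^-1` B k)) =
         \int[P]_(w in A)
           \prod_k normal2 (mu k) (sigma2 k / (2 * p t k w)) (B k))%E].

(* The posterior densities exist only where all the scatters are positive,
   which has probability 1 once three rounds were played; elsewhere the profile
   is constrained only by [bandit_under_weighted_information]. *)
Definition weighted_thompson_sampling : Prop :=
  (forall t k w, (1 <= t <= 3)%N -> p t k w = K%:R^-1) /\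
  forall t w, (4 <= t)%N ->
    (forall k, 0 < wscatter (fun l => p l k w) (fun l => X l k w) t.-1) ->
    argmax_probability
      (fun k => posterior_pdf (fun l => p l k w) (fun l => X l k w) t)
      (fun k => p t k w).

Definition expected_regret (mu : 'I_K -> R * R) (kstar : 'I_K) (T : nat) :
    \bar R :=
  (\sum_(1 <= t < T.+1) \sum_k
     (enorm (mu k))%:E * ((k == kstar)%:R%:E - 'E_P[p t k]))%E.

End bandit.

(* Main.v *)
(** The regret is [\sum_(k != ks) gap k * E (\sum_t p^t_k)], where [ks] is the
    best arm, so it is enough to bound the expected total power of an arm
    [k != ks] by [(1 + xi) (sigma2 k / gap^2) ln T + C] for every [xi > 0].

    Let [N] be the total power of an arm so far, [S] its scatter and [y] a level
    slightly below [|mu_ks|]. If arm [k] has the largest sampled norm, then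
    either this norm exceeds [y], or all the sampled norms stay below [y]. The
    second event has probability at most [p_ks] times the posterior odds that
    [|mu_ks| < y].

    For the first event, the rounds with [N_k < L := (1 + xi) (sigma2 k / gap^2) ln T]
    contribute at most [L + 1] to the total power; in the others the posterior
    tail is [O(1 / T)] as soon as the mean of arm [k] and its scatter are close
    to their limits. For the second event, the odds are at most a finite sum of
    terms [exp (<l, M> - (|l|^2 sigma2 / 4 + c) N)], where [M] is [N] times the
    error of the mean of arm [ks]. For [c = 0] this process is a martingale; for
    [c > 0] it loses in a round of power [p] at least a fraction of order [p] of
    its value, so the expectations of its products with the powers have a
    bounded sum. The same processes dominate the large deviations of the mean of
    arm [k], and exponential moments those of the scatters. *)

From HB Require Import structures.
Require Import Defs.
From mathcomp Require Import measurable_realfun zify ring lra.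
Set Implicit Arguments.
Unset Strict Implicit.
Unset Printing Implicit Defensive.

Local Open Scope classical_set_scope.
Local Open Scope ring_scope.

(** * Measures with a density and conditional laws *)

(** The weights match the noise. Given the past, [p] times a noise vector of variance
    [sigma2 / (2 p)] per coordinate has variance [p sigma2 / 2], so the weighted error [M] behaves
    like a Brownian motion run with the clock [N]; hence the compensator [|l|^2 sigma2 N / 4]. And
    [p |noise|^2] is [sigma2] times a standard exponential variable whatever [p] is, so the scatter
    grows like [sigma2 t] even for an arm of tiny power. The posterior tail [(1 + N rho^2 / S)^(-t)]
    is therefore close to [exp (- N rho^2 / sigma2)], and at [rho = gap] it reaches [1 / T] when
    [N = (sigma2 / gap^2) ln T]. The obstacle is the best arm: no growth of its power is known in
    advance, so its posterior odds cannot be shown to decrease with [t]. They are controlled in the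
    clock [N] only, and the factor [p_ks] in front of the odds is the next increment of this very
    clock. *)

Section density.
Context d (T : measurableType d) (R : realType).
Variables (mu nu : {measure set T -> \bar R}) (h : T -> R).
Hypothesis h0 : forall x, 0 <= h x.
Hypothesis mh : measurable_fun setT h.
Hypothesis nuE : forall A, measurable A -> nu A = (\int[mu]_(x in A) (h x)%:E)%E.
Local Open Scope ereal_scope.
Import HBNNSimple.

Lemma ge0_integral_density (f : T -> \bar R) : (forall x, 0 <= f x) ->
  measurable_fun setT f -> \int[nu]_x f x = \int[mu]_x (f x * (h x)%:E).
Proof.
move=> f0 mf; pose g := nnsfun_approx measurableT mf.
have fg x : (g n x)%:E @[n --> \oo] --> f x by exact: cvg_nnsfun_approx.
have simple (s : {nnsfun T >-> R}) :
    \int[nu]_x (s x)%:E = \int[mu]_x ((s x)%:E * (h x)%:E).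
  under [in LHS]eq_integral do rewrite fimfunE -fsumEFin//.
  rewrite ge0_integral_fsum//; last 2 first.
  - by move=> r; exact/measurable_EFinP/measurableT_comp.
  - by move=> r z _; rewrite EFinM nnfun_muleindic_ge0.
  under [in RHS]eq_integral => x _.
    rewrite fimfunE -fsumEFin// ge0_mule_fsuml; last first.
      by move=> r; rewrite EFinM nnfun_muleindic_ge0.
    over.
  rewrite /= ge0_integral_fsum//; last 2 first.
  - move=> r; apply: emeasurable_funM; last exact/measurable_EFinP.
    exact/measurable_EFinP/measurableT_comp.
  - by move=> r z _; rewrite mule_ge0 ?lee_fin// -lee_fin EFinM nnfun_muleindic_ge0.
  apply: eq_fsbigr => r _.
  rewrite (integralZl_indic _ (fun r => s @^-1` [set r]))//; last first.
    by move=> r0; rewrite preimage_nnfun0.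
  rewrite integral_indic// setIT nuE//.
  under [RHS]eq_integral do rewrite EFinM -muleA.
  have [r0|r0] := leP 0%R r.
    rewrite ge0_integralZl//; last 2 first.
      apply: emeasurable_funM; last exact/measurable_EFinP.
      exact/measurable_EFinP.
    - by move=> x _; rewrite mule_ge0// lee_fin.
    congr (_ * _).
    rewrite [LHS]integral_mkcond epatch_indic; apply: eq_integral => x _ /=.
    by rewrite muleC.
  rewrite preimage_nnfun0// integral_set0 mule0 integral0_eq// => x _.
  by rewrite indic0 mul0e mule0.
transitivity (limn (fun n => \int[nu]_x (g n x)%:E)).
  under eq_integral do rewrite -(cvg_lim _ (fg _))//.
  rewrite monotone_convergence//.
  - by move=> n; exact/measurable_EFinP.
  - by move=> n z _; rewrite lee_fin.
  - by move=> z _ a b ab; rewrite lee_fin; exact/lefP/nd_nnsfun_approx.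
transitivity (limn (fun n => \int[mu]_x ((g n x)%:E * (h x)%:E))).
  by congr (limn _); apply/funext => n; exact: simple.
have fgh x : (g n x)%:E * (h x)%:E @[n --> \oo] --> f x * (h x)%:E.
  by apply: cvgeZr.
under [RHS]eq_integral do rewrite -(cvg_lim _ (fgh _))//.
rewrite monotone_convergence//.
- by move=> n; apply: emeasurable_funM; exact/measurable_EFinP.
- by move=> n z _; rewrite mule_ge0// lee_fin.
- move=> z _ a b ab; apply: lee_wpmul2r; rewrite ?lee_fin//.
  exact/lefP/nd_nnsfun_approx.
Qed.

End density.

Section integral_EFinM.
Context d (T : measurableType d) (R : realType).
Variables (mu : {measure set T -> \bar R}) (f : T -> R).
Hypothesis f0 : forall x, 0 <= f x.
Hypothesis mf : measurable_fun setT f.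

Lemma ge0_integral_EFinMl (c : R) : 0 <= c ->
  (\int[mu]_x (c * f x)%:E = c%:E * \int[mu]_x (f x)%:E)%E.
Proof.
move=> c0; rewrite -ge0_integralZl//; last by move=> x _; rewrite lee_fin.
exact/measurable_EFinP.
Qed.

Lemma ge0_integral_EFinMr (c : R) : 0 <= c ->
  (\int[mu]_x (f x * c)%:E = \int[mu]_x (f x)%:E * c%:E)%E.
Proof.
move=> c0; rewrite muleC -ge0_integral_EFinMl//.
by apply: eq_integral => x _; rewrite mulrC.
Qed.

End integral_EFinM.

(** * Gaussian integrals of exponentials of quadratic functions *)

Section gauss.
Context {R : realType}.
Implicit Types m s a b : R.

(** Completing the square: the tilted density is a constant times another normal density. The
    condition on [a] keeps its variance [s^2 / (1 - 2 a s^2)] positive. *)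
Lemma normal_pdf_expR m s a b x : 0 < s -> 2 * a * s ^+ 2 < 1 ->
  normal_pdf m s x * expR (a * (x - m) ^+ 2 + b * (x - m)) =
  (Num.sqrt (1 - 2 * a * s ^+ 2))^-1 *
  expR (b ^+ 2 * s ^+ 2 / (2 * (1 - 2 * a * s ^+ 2))) *
  normal_pdf (m + b * s ^+ 2 / (1 - 2 * a * s ^+ 2))
             (s / Num.sqrt (1 - 2 * a * s ^+ 2)) x.
Proof.
move=> s0 h; set q := 1 - _; have q0 : 0 < q by rewrite subr_gt0.
have sq0 : 0 < Num.sqrt q by rewrite sqrtr_gt0.
rewrite !normal_pdfE ?gt_eqF ?divr_gt0// /normal_peak /normal_fun.
have -> : (s / Num.sqrt q) ^+ 2 = s ^+ 2 / q.
  by rewrite expr_div_n sqr_sqrtr// ltW.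
have -> : Num.sqrt (s ^+ 2 / q * pi *+ 2) =
    Num.sqrt (s ^+ 2 * pi *+ 2) / Num.sqrt q.
  rewrite -sqrtrV ?ltW// -sqrtrM; last first.
    by rewrite mulrn_wge0// mulr_ge0 ?sqr_ge0 ?pi_ge0.
  by congr Num.sqrt; ring.
rewrite -[LHS]mulrA -expRD [RHS]mulrACA -expRD invf_div.
rewrite [_^-1 * (_ / _)]mulrA mulVf ?gt_eqF// mul1r; congr (_ * expR _).
have -> : a = (1 - q) / (2 * s ^+ 2).
  by rewrite /q; field; rewrite gt_eqF.
by field; rewrite !gt_eqF.
Qed.

Lemma integral_normal_pdf_expR m s a b : 0 < s -> 2 * a * s ^+ 2 < 1 ->
  (\int[lebesgue_measure]_x
     (normal_pdf m s x * expR (a * (x - m) ^+ 2 + b * (x - m)))%:E =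
  ((Num.sqrt (1 - 2 * a * s ^+ 2))^-1 *
  expR (b ^+ 2 * s ^+ 2 / (2 * (1 - 2 * a * s ^+ 2))))%:E)%E.
Proof.
move=> s0 h; under eq_integral do rewrite normal_pdf_expR// EFinM.
rewrite ge0_integralZl//.
- by rewrite integral_normal_pdf mule1.
- by apply/measurable_EFinP; exact: measurable_normal_pdf.
- by move=> x _; rewrite lee_fin normal_pdf_ge0.
Qed.

End gauss.

Section density_measure.
Context d (T : measurableType d) (R : realType).
Variables (mu : {measure set T -> \bar R}) (h : T -> R).
Hypothesis h0 : forall x, 0 <= h x.
Hypothesis mh : measurable_fun setT h.

(** The two hypotheses on [h] are arguments so that the measure structure below can be attached to
    the term itself. *)
Definition density_measure of (forall x, 0 <= h x) & measurable_fun setT h :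
  set T -> \bar R := fun A => (\int[mu]_(x in A) (h x)%:E)%E.

Local Notation nu := (density_measure h0 mh).

Let nu0 : nu set0 = 0%E. Proof. by rewrite /density_measure integral_set0. Qed.

Let nu_ge0 A : (0 <= nu A)%E.
Proof. by rewrite /density_measure integral_ge0// => x _; rewrite lee_fin. Qed.

Let nu_sigma_additive : semi_sigma_additive nu.
Proof.
move=> F mF tF mUF; rewrite /density_measure ge0_integral_bigcup//.
- by apply: is_cvg_ereal_nneg_natsum_cond => n _ _; exact: nu_ge0.
- exact/measurable_funTS/measurable_EFinP.
- by move=> x _; rewrite lee_fin.
Qed.

HB.instance Definition _ :=
  isMeasure.Build _ _ _ nu nu0 nu_ge0 nu_sigma_additive.

End density_measure.

(** The measure of density [h] with respect to the product of [mu] and [la] agrees with [nu] on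
    rectangles. These form a generating family stable under intersection and [nu] is finite, so the
    two measures are equal and Tonelli's theorem applies. *)
Lemma ge0_integral_disintegration d1 d2 (T1 : measurableType d1)
    (T2 : measurableType d2) (R : realType)
    (mu : {sigma_finite_measure set T1 -> \bar R})
    (la : {sigma_finite_measure set T2 -> \bar R})
    (nu : {finite_measure set (T1 * T2)%type -> \bar R}) (h : (T1 * T2)%type -> R)
    (g : (T1 * T2)%type -> \bar R) :
  (forall z, 0 <= h z) -> measurable_fun setT h ->
  (forall A B, measurable A -> measurable B ->
    nu (A `*` B) = (\int[mu]_(x in A) \int[la]_(y in B) (h (x, y))%:E)%E) ->
  (forall z, (0 <= g z)%E) -> measurable_fun setT g ->
  (\int[nu]_z g z =
   \int[mu]_x \int[la]_y (g (x, y) * (h (x, y))%:E))%E.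
Proof.
move=> h0 mh nuE g0 mg.
rewrite -(fubini_tonelli1 (fun z => g z * (h z)%:E)%E); first last.
- by move=> z; rewrite mule_ge0// lee_fin.
- by apply: emeasurable_funM => //; exact/measurable_EFinP.
apply: (ge0_integral_density h0 mh) => //.
pose C : set (set (T1 * T2)%type) := [set A `*` B | A in measurable & B in measurable].
have CI : setI_closed C.
  move=> _ _ [A1 mA1 [A2 mA2 <-]] [B1 mB1 [B2 mB2 <-]].
  rewrite -setXI; exists (A1 `&` B1); first exact: measurableI.
  by exists (A2 `&` B2) => //; exact: measurableI.
apply: (measure_unique C (fun=> setT) _ CI _ _ nu (density_measure _ h0 mh)).
- exact: measurable_prod_measurableType.
- by move=> _; exists setT => //; exists setT => //; rewrite setXTT.
- by apply/seteqP; split => // z _; exists 0%N.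
- move=> _ [A mA [B mB <-]]; apply: (eq_trans (nuE _ _ mA mB)); rewrite /density_measure.
  rewrite [RHS]integral_mkcond fubini_tonelli1; last 2 first.
  + apply/(measurable_restrictT _ _).1; first exact: measurableX.
    exact/measurable_funTS/measurable_EFinP.
  + by move=> z; apply: erestrict_ge0 => y _; rewrite lee_fin.
  rewrite integral_mkcond; apply: eq_integral => x _.
  rewrite /fubini_F patchE; case: ifPn => xA.
    rewrite [LHS]integral_mkcond; apply: eq_integral => y _.
    by rewrite !patchE in_setX xA.
  by rewrite integral0_eq// => y _; rewrite patchE in_setX (negbTE xA).
- by move=> _; rewrite -ge0_fin_numE// fin_num_measure.
Qed.

Lemma product_measure_density d1 d2 (T1 : measurableType d1)
    (T2 : measurableType d2) (R : realType)
    (la1 : {sigma_finite_measure set T1 -> \bar R})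
    (la2 : {sigma_finite_measure set T2 -> \bar R})
    (m1 : {sigma_finite_measure set T1 -> \bar R})
    (m2 : {sigma_finite_measure set T2 -> \bar R})
    (h1 : T1 -> R) (h2 : T2 -> R) (B : set (T1 * T2)%type) :
  (forall x, 0 <= h1 x) -> measurable_fun setT h1 ->
  (forall x, 0 <= h2 x) -> measurable_fun setT h2 ->
  (forall A, measurable A -> m1 A = (\int[la1]_(x in A) (h1 x)%:E)%E) ->
  (forall A, measurable A -> m2 A = (\int[la2]_(x in A) (h2 x)%:E)%E) ->
  measurable B ->
  ((m1 \x m2) B = \int[la1 \x la2]_(z in B) (h1 z.1 * h2 z.2)%:E)%E.
Proof.
move=> h10 mh1 h20 mh2 m1E m2E mB.
have mh : measurable_fun setT (fun z : T1 * T2 => h1 z.1 * h2 z.2).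
  apply: measurable_funM.
    exact: (measurableT_comp mh1).
  exact: (measurableT_comp mh2).
have h0 (z : T1 * T2) : 0 <= h1 z.1 * h2 z.2 by rewrite mulr_ge0.
apply: (@product_measure_unique _ _ _ _ _ m1 m2
  (density_measure (la1 \x la2)%E h0 mh)) => // A C mA mC.
rewrite /density_measure [LHS]integral_mkcond fubini_tonelli1; last 2 first.
- apply/(measurable_restrictT _ _).1; first exact: measurableX.
  exact/measurable_funTS/measurable_EFinP.
- by move=> z; apply: erestrict_ge0 => y _; rewrite lee_fin.
rewrite m1E// m2E// -ge0_integralZr//; last 3 first.
- exact/measurable_funTS/measurable_EFinP.
- by move=> x _; rewrite lee_fin.
- by apply: integral_ge0 => x _; rewrite lee_fin.
rewrite [RHS]integral_mkcond; apply: eq_integral => x _.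
rewrite /fubini_F patchE; case: ifPn => xA; last first.
  by rewrite integral0_eq// => y _; rewrite patchE in_setX (negbTE xA).
rewrite -ge0_integralZl//; last 3 first.
- exact/measurable_funTS/measurable_EFinP.
- by move=> y _; rewrite lee_fin.
- by rewrite lee_fin.
rewrite [RHS]integral_mkcond; apply: eq_integral => y _.
by rewrite !patchE in_setX xA.
Qed.

(** [U] carries the past, [Z] is the new observation and [h (u, _)] its conditional density; this is
    the disintegration of the joint law of [(U, Z)]. *)
Lemma ge0_integral_conditional_law d0 d1 d2 (Omega : measurableType d0)
    (T1 : measurableType d1) (T2 : measurableType d2) (R : realType)
    (P : probability Omega R) (la : {sigma_finite_measure set T2 -> \bar R})
    (U : Omega -> T1) (Z : Omega -> T2) (h : (T1 * T2)%type -> R)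
    (g : (T1 * T2)%type -> \bar R) :
  measurable_fun setT U -> measurable_fun setT Z ->
  (forall z, 0 <= h z) -> measurable_fun setT h ->
  (forall A B, measurable A -> measurable B ->
    P ((U @^-1` A) `&` (Z @^-1` B)) =
    (\int[P]_(w in U @^-1` A) \int[la]_(y in B) (h (U w, y))%:E)%E) ->
  (forall z, (0 <= g z)%E) -> measurable_fun setT g ->
  (\int[P]_w g (U w, Z w) =
   \int[P]_w \int[la]_y (g (U w, y) * (h (U w, y))%:E))%E.
Proof.
move=> mU mZ h0 mh PUZ g0 mg.
have mUZ : measurable_fun setT (fun w => (U w, Z w)) by exact: measurable_fun_pair.
pose U' : {mfun Omega >-> T1} := HB.pack U (isMeasurableFun.Build _ _ _ _ U mU).
pose UZ : {mfun Omega >-> (T1 * T2)%type} :=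
  HB.pack (fun w => (U w, Z w)) (isMeasurableFun.Build _ _ _ _ _ mUZ).
have mgh : measurable_fun setT (fun z => g z * (h z)%:E)%E.
  by apply: emeasurable_funM => //; exact/measurable_EFinP.
have gh0 z : (0 <= g z * (h z)%:E)%E by rewrite mule_ge0// lee_fin.
transitivity (\int[distribution P UZ]_z g z)%E.
  by rewrite /distribution (ge0_integral_pushforward mUZ).
transitivity (\int[distribution P U']_u \int[la]_y (g (u, y) * (h (u, y))%:E))%E; last first.
  rewrite /distribution (ge0_integral_pushforward mU)//.
    exact: (measurable_fun_fubini_tonelli_F (fun z => g z * (h z)%:E)%E).
  by move=> u _; exact: integral_ge0.
apply: (@ge0_integral_disintegration _ _ _ _ _ (distribution P U') la
  (distribution P UZ)) => // A B mA mB.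
rewrite /distribution /pushforward (ge0_integral_pushforward mU)//.
- exact: PUZ.
- apply/measurable_funTS.
  (* Written as a Tonelli section, the inner integral is measurable in [x]. *)
  have -> : (fun x => \int[la]_(y in B) (h (x, y))%:E)%E =
      fubini_F la (fun z => (h z)%:E * (\1_B z.2)%:E)%E.
    apply/funext => x; rewrite /fubini_F [LHS]integral_mkcond epatch_indic.
    by apply: eq_integral => y _.
  apply: measurable_fun_fubini_tonelli_F => //.
    apply: emeasurable_funM; first exact/measurable_EFinP.
    apply/measurable_EFinP.
    apply: (@measurableT_comp _ _ _ _ _ _ (\1_B : T2 -> R) _ snd) => //.
  by move=> z; rewrite mule_ge0// lee_fin.
- by move=> u _; apply: integral_ge0 => y _; rewrite lee_fin.
Qed.

(* The library's own sigma-finite structure on product measures is masked by a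
   later canonical instance for subprobability measures. *)
Section product_sigma_finite.
Context d1 d2 (T1 : measurableType d1) (T2 : measurableType d2) (R : realType).
Variables (m1 : {sigma_finite_measure set T1 -> \bar R})
  (m2 : {sigma_finite_measure set T2 -> \bar R}).

Lemma product_measure_sigma_finite : sigma_finite setT (m1 \x m2)%E.
Proof.
have [F TF Foo] := sigma_finiteT m1; have [G TG Goo] := sigma_finiteT m2.
exists (fun n => if unpickle n is Some ij then F ij.1 `*` G ij.2 else set0).
  apply/esym; rewrite -subTset => -[x y] _.
  have [i _ Fx] : (\bigcup_i F i) x by rewrite -TF.
  have [j _ Gy] : (\bigcup_j G j) y by rewrite -TG.
  by exists (pickle (i, j)) => //=; rewrite pickleK.
move=> n; case: unpickle => [[i j]|]; last by rewrite measure0.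
have [mF Fi] := Foo i; have [mG Gj] := Goo j; split; first exact: measurableX.
by rewrite product_measure1E// lte_mul_pinfty// ge0_fin_numE.
Qed.

Definition product_sigma_finite :
    {sigma_finite_measure set (T1 * T2)%type -> \bar R} :=
  HB.pack (product_measure1 m1 m2)
    (Measure_isSigmaFinite.Build _ _ _ (product_measure1 m1 m2)
       product_measure_sigma_finite).

End product_sigma_finite.

(** * Normal laws on the plane *)

Section normal2.
Context {R : realType}.
Local Notation leb := (@lebesgue_measure R).
Local Notation plane := (measurableTypeR R * measurableTypeR R)%type.
Local Notation leb2 := (product_sigma_finite leb leb).

Definition normal2_pdf (m : (R * R)%type) (v : R) (x : (R * R)%type) : R :=
  normal_pdf m.1 (Num.sqrt v) x.1 * normal_pdf m.2 (Num.sqrt v) x.2.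

Lemma measurable_invr : measurable_fun setT (@GRing.inv R).
Proof.
rewrite (_ : GRing.inv = fun x : R => if x == 0 then 0 else x^-1); last first.
  by apply/funext => x; case: eqP => // ->; rewrite invr0.
apply: measurable_fun_if => //; first exact: measurable_fun_eqr.
rewrite setTI (_ : _ @^-1` _ = [set x : R | x != 0]).
  apply: open_continuous_measurable_fun; first exact: open_neq.
  by move=> x /set_mem /= x0; exact: inv_continuous.
by apply/seteqP; split => x /=; [move=> ->|move=> /negbTE ->].
Qed.

Lemma measurable_sqrtr : measurable_fun setT (@Num.sqrt R).
Proof. by apply: continuous_measurable_fun; exact: sqrt_continuous. Qed.

Lemma measurable_normal_pdf_comp d (T : measurableType d) (f s g : T -> R) :
  measurable_fun setT f -> measurable_fun setT s -> measurable_fun setT g ->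
  measurable_fun setT (fun w => normal_pdf (f w) (s w) (g w)).
Proof.
move=> mf ms mg; rewrite /normal_pdf /normal_peak /normal_fun.
(* At standard deviation 0 the default value of [normal_pdf] is the indicator of the unit
   interval. *)
apply: measurable_fun_ifT; first exact: measurable_fun_eqr.
  apply: (@measurableT_comp _ _ _ _ _ _ (\1_`[0, 1]%classic : R -> R) _ g) => //.
have mV (k : T -> R) : measurable_fun setT k -> measurable_fun setT (fun w => (k w)^-1).
  by move=> mk; apply: (measurableT_comp measurable_invr).
have ms2 : measurable_fun setT (fun w => s w ^+ 2) by exact: measurable_funX.
apply: measurable_funM.
  apply: mV; apply: (measurableT_comp measurable_sqrtr).
  by rewrite (_ : (fun _ => _) = (fun w => s w ^+ 2 * pi + s w ^+ 2 * pi)) //;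
    apply: measurable_funD; apply: measurable_funM.
apply: measurableT_comp => //; apply: measurable_funM.
  apply: measurableT_comp => //; apply: measurable_funX; exact: measurable_funB.
by apply: mV; rewrite (_ : (fun _ => _) = (fun w => s w ^+ 2 + s w ^+ 2)) //;
  apply: measurable_funD.
Qed.

Lemma measurable_normal2_pdf d (T : measurableType d) m (v : T -> R)
    (g : T -> (R * R)%type) : measurable_fun setT v -> measurable_fun setT g ->
  measurable_fun setT (fun w => normal2_pdf m (v w) (g w)).
Proof.
move=> mv mg; have mg1 : measurable_fun setT (fst \o g) by exact: measurableT_comp.
have mg2 : measurable_fun setT (snd \o g) by exact: measurableT_comp.
by apply: measurable_funM; apply: measurable_normal_pdf_comp => //;
  exact: (measurableT_comp measurable_sqrtr).
Qed.

Lemma normal2_pdf_ge0 m v x : 0 <= normal2_pdf m v x.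
Proof. by rewrite mulr_ge0// normal_pdf_ge0. Qed.

Lemma normal2E m v (B : set plane) : measurable B ->
  (normal2 m v B = \int[leb2]_(x in B) (normal2_pdf m v x)%:E)%E.
Proof.
move=> mB; exact: (@product_measure_density _ _ _ _ _ leb leb
  (normal_prob m.1 (Num.sqrt v)) (normal_prob m.2 (Num.sqrt v)) _ _ B
  (normal_pdf_ge0 _ _) (measurable_normal_pdf _ _)
  (normal_pdf_ge0 _ _) (measurable_normal_pdf _ _)
  (fun _ _ => erefl) (fun _ _ => erefl) mB).
Qed.

Lemma normal2_setT (m : (R * R)%type) (v : R) : normal2 m v setT = 1%E.
Proof.
rewrite /normal2 -[setT]setXTT; apply: (eq_trans (@product_measure1E _ _ _ _ _
  (normal_prob m.1 (Num.sqrt v)) (normal_prob m.2 (Num.sqrt v)) _ _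
  (@measurableT _ (measurableTypeR R)) (@measurableT _ (measurableTypeR R)))).
have npT (x : R) : normal_prob x (Num.sqrt v) setT = 1%E by exact: probability_setT.
by apply: (eq_trans (f_equal2 mule (npT _) (npT _))); rewrite mule1.
Qed.

(** The definitions and the type [plane] use two presentations of the same measurable space; pushing
    the measure forward along the identity passes from one to the other. *)
Lemma law_of_densityE (f : (R * R)%type -> R) (B : set (R * R)%type) :
  (forall x, 0 <= f x) -> measurable_fun setT f -> measurable B ->
  (law_of_density f B = \int[leb2]_(x in (B : set plane)) (f x)%:E)%E.
Proof.
move=> f0 mf mB.
have mid : measurable_fun setT (fun x : plane => x : (R * R)%type).
  exact: measurable_id.
apply: (@ge0_integral_pushforward _ _ plane (R * R)%type _ _ mid
  leb2 B (EFin \o f)) => //.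
- exact/measurable_funTS/measurable_EFinP.
- by move=> x _; rewrite lee_fin.
Qed.

(** The coordinates separate, and their two square-root factors multiply to [(1 - 2 a v)^-1], the
    Laplace transform of an exponential law. *)
Lemma integral_normal2_pdf_expR m v (a b1 b2 : R) : 0 < v -> 2 * a * v < 1 ->
  (\int[leb2]_x (expR (a * ((x.1 - m.1) ^+ 2 + (x.2 - m.2) ^+ 2) +
      (b1 * (x.1 - m.1) + b2 * (x.2 - m.2))) * normal2_pdf m v x)%:E =
   ((1 - 2 * a * v)^-1 *
     expR ((b1 ^+ 2 + b2 ^+ 2) * v / (2 * (1 - 2 * a * v))))%:E)%E.
Proof.
move=> v0 av; have s0 : 0 < Num.sqrt v by rewrite sqrtr_gt0.
have s2 : Num.sqrt v ^+ 2 = v by rewrite sqr_sqrtr// ltW.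
pose F (m b x : R) := normal_pdf m (Num.sqrt v) x *
  expR (a * (x - m) ^+ 2 + b * (x - m)).
have F0 m' b x : 0 <= F m' b x by rewrite mulr_ge0 ?expR_ge0 ?normal_pdf_ge0.
have mF m' b : measurable_fun setT (F m' b).
  apply: measurable_funM; first exact: measurable_normal_pdf.
  apply: measurableT_comp => //; apply: measurable_funD; apply: measurable_funM => //.
    by apply: measurable_funX; exact: measurable_funB.
  exact: measurable_funB.
have IF m' b : (\int[leb]_x (F m' b x)%:E =
    ((Num.sqrt (1 - 2 * a * v))^-1 * expR (b ^+ 2 * v / (2 * (1 - 2 * a * v))))%:E)%E.
  by rewrite /F integral_normal_pdf_expR ?s2.
under eq_integral => x _.
  rewrite (_ : _ * _ = F m.1 b1 x.1 * F m.2 b2 x.2); last first.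
    rewrite /F /normal2_pdf mulrACA -expRD mulrC; congr (_ * expR _).
    by ring.
  over.
rewrite (fubini_tonelli1 (fun x : plane => (F m.1 b1 x.1 * F m.2 b2 x.2)%:E)); first last.
- by move=> x; rewrite lee_fin mulr_ge0.
- apply/measurable_EFinP; apply: measurable_funM.
    exact: (measurableT_comp (mF _ _)).
  exact: (measurableT_comp (mF _ _)).
rewrite /fubini_F /=.
under eq_integral => x _.
  rewrite (@ge0_integral_EFinMl _ _ _ leb (F m.2 b2))//; last exact: mF.
  rewrite IF -EFinM.
  over.
rewrite (@ge0_integral_EFinMr _ _ _ leb (F m.1 b1))//; last first.
  exact: mF.
rewrite IF -EFinM; congr EFin.
rewrite mulrACA -expRD -invfM -expr2 sqr_sqrtr; last by rewrite subr_ge0 ltW.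
by congr (_ * expR _); rewrite -mulrDl -mulrDl.
Qed.

End normal2.

(** * One round of the bandit *)

Section bandit.
Context {R : realType} {K : nat} {d : measure_display}
  {Omega : measurableType d} (P : probability Omega R).
Variables (p : nat -> 'I_K -> Omega -> R)
  (X : nat -> 'I_K -> {RV P >-> (R * R)%type})
  (mu : 'I_K -> (R * R)%type) (sigma2 : 'I_K -> R).
Hypothesis sigma2_gt0 : forall k, 0 < sigma2 k.
Hypothesis bandit : bandit_under_weighted_information p X mu sigma2.
Local Notation leb := (@lebesgue_measure R).
Local Notation plane := (measurableTypeR R * measurableTypeR R)%type.
Local Notation leb2 := (product_sigma_finite leb leb).

(** The family generating [history], named so that F_t becomes a measurable type, [past t]. *)
Definition history_generators (t : nat) : set (set Omega) :=
  [set A | exists (l : nat) (k : 'I_K), (1 <= l < t)%N /\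
         (g_sigma_algebra_preimage (p l k) A \/
          g_sigma_algebra_preimage (X l k) A)].

Local Notation past t := (g_sigma_algebraType (history_generators t)).

Lemma power_itv t k w : (1 <= t)%N -> 0 <= p t k w <= 1.
Proof. by move=> t1; have [h _ _] := bandit; have [] := h t w t1. Qed.

Lemma power_ge0 t k w : (1 <= t)%N -> 0 <= p t k w.
Proof. by move=> /(power_itv k w)/andP[]. Qed.

Lemma power_le1 t k w : (1 <= t)%N -> p t k w <= 1.
Proof. by move=> /(power_itv k w)/andP[]. Qed.

Lemma sum_power t w : (1 <= t)%N -> \sum_k p t k w = 1.
Proof. by move=> t1; have [h _ _] := bandit; have [] := h t w t1. Qed.

Lemma measurable_power_past t k : (1 <= t)%N ->
  measurable_fun setT (p t k : past t -> R).
Proof.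
case: bandit => _ h _ t1 _ Y mY; rewrite setTI.
by apply: (h t k t1); exists Y => //; rewrite setTI.
Qed.

Lemma measurable_power_lt t l k : (1 <= l < t)%N ->
  measurable_fun setT (p l k : past t -> R).
Proof.
move=> lt _ Y mY; rewrite setTI; apply: sub_sigma_algebra.
by exists l, k; split => //; left; exists Y => //; rewrite setTI.
Qed.

Lemma measurable_power_le t l k : (1 <= l <= t)%N ->
  measurable_fun setT (p l k : past t -> R).
Proof.
move=> /andP[l1]; rewrite leq_eqVlt => /predU1P[lt|lt].
  by rewrite -lt; exact: measurable_power_past.
by apply: measurable_power_lt; rewrite l1.
Qed.

Lemma measurable_observation t l k : (1 <= l < t)%N ->
  measurable_fun setT (X l k : past t -> (R * R)%type).
Proof.
move=> lt _ Y mY; rewrite setTI; apply: sub_sigma_algebra.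
by exists l, k; split => //; right; exists Y => //; rewrite setTI.
Qed.

(** By strong induction on [t]: the model only makes the power of round [l] measurable for F_l, so
    its measurability on [Omega] comes from the same statement at [l < t]. *)
Lemma measurable_history t A : history p X t A -> measurable A.
Proof.
elim/ltn_ind: t A => t IH A.
suff h : history p X t `<=` @measurable _ Omega by exact: h.
apply: smallest_sub; first exact: sigma_algebra_measurable.
move=> B [l [k [/andP[l1 lt] [pB|[Y mY <-]]]]].
  apply: (IH l lt); case: bandit => _ h _; exact: (h l k l1).
by rewrite setTI; exact: measurable_funPTI.
Qed.

Lemma measurable_past_id t : measurable_fun setT (id : Omega -> past t).
Proof. by move=> _ A hA; rewrite setTI; exact: (@measurable_history t). Qed.

Lemma measurable_past t d' (T : measurableType d') (f : Omega -> T) :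
  measurable_fun setT (f : past t -> T) -> measurable_fun setT f.
Proof.
by move=> mf; exact: (measurableT_comp mf (@measurable_past_id t)).
Qed.

(** The marginal of the joint identity: the sets of the other arms are the whole plane, of mass
    1. *)
Lemma observation_law t k A (B : set plane) : (1 <= t)%N ->
  history p X t A -> measurable B ->
  (P (A `&` X t k @^-1` B) =
   \int[P]_(w in A) normal2 (mu k) (sigma2 k / (2 * p t k w)) B)%E.
Proof.
move=> t1 hA mB; have [_ _ h] := bandit.
have := h t A (fun j => if j == k then B else setT) t1 hA.
have -> : \bigcap_j (X t j @^-1` (if j == k then B else setT)) = X t k @^-1` B.
  apply/seteqP; split => w /=; first by move=> /(_ k I); rewrite eqxx.
  by move=> Bw j _; case: eqP => [->|].
move=> ->; last by move=> j; case: ifP.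
apply: eq_integral => w _; rewrite (bigD1 k)//= eqxx big1 ?mule1// => j jk.
by rewrite (negbTE jk) normal2_setT.
Qed.

(** Here the role of the past is played by the identity, seen as a map from [Omega] to F_t; hence
    [g] may depend on the past in any F_t-measurable way. *)
Lemma integral_observation t k (g : past t * plane -> \bar R) : (1 <= t)%N ->
  (forall z, 0 <= g z)%E -> measurable_fun setT g ->
  (\int[P]_w g (w, X t k w) =
   \int[P]_w \int[leb2]_x
     (g (w, x) * (normal2_pdf (mu k) (sigma2 k / (2 * p t k w)) x)%:E))%E.
Proof.
move=> t1 g0 mg.
pose h (z : past t * plane) :=
  normal2_pdf (mu k) (sigma2 k / (2 * p t k z.1)) z.2.
have mX0 : measurable_fun setT (X t k : Omega -> (R * R)%type) by exact: measurable_funP.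
have mX : measurable_fun setT (X t k : Omega -> plane) := mX0.
have mh : measurable_fun setT h.
  apply: measurable_normal2_pdf => //.
  apply: measurable_funM => //; apply: (measurableT_comp measurable_invr).
  apply: measurable_funM => //.
  exact: (measurableT_comp (measurable_power_past _ t1)).
have h0 z : 0 <= h z by exact: normal2_pdf_ge0.
refine (@ge0_integral_conditional_law _ _ _ Omega (past t) plane R P
  leb2 (id : Omega -> past t) (X t k : Omega -> plane) h g (@measurable_past_id t) mX h0 mh _ g0 mg).
move=> A B hA mB; rewrite [LHS]observation_law//; apply: eq_integral => w _.
by rewrite normal2E.
Qed.

Definition noise1 t k w : R := (X t k w).1 - (mu k).1.
Definition noise2 t k w : R := (X t k w).2 - (mu k).2.

(** The source of all the exponential processes below. [H], [a], [b1] and [b2] are known before the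
    round. The power cancels between the factor [p] of the quadratic term and the variance
    [sigma2 / (2 p)], and survives only linearly in the exponent left by [b1] and [b2]. This
    cancellation is where positive power is used. *)
Lemma integral_step t k (H a b1 b2 : Omega -> R) : (1 <= t)%N ->
  measurable_fun setT (H : past t -> R) -> (forall w, 0 <= H w) ->
  measurable_fun setT (a : past t -> R) -> (forall w, a w * sigma2 k < 1) ->
  measurable_fun setT (b1 : past t -> R) ->
  measurable_fun setT (b2 : past t -> R) ->
  {ae P, forall w, 0 < p t k w} ->
  (\int[P]_w (H w * expR (p t k w *
      (a w * (noise1 t k w ^+ 2 + noise2 t k w ^+ 2) +
       (b1 w * noise1 t k w + b2 w * noise2 t k w))))%:E =
   \int[P]_w (H w * ((1 - a w * sigma2 k)^-1 *
      expR (p t k w * (b1 w ^+ 2 + b2 w ^+ 2) * sigma2 k /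
            (4 * (1 - a w * sigma2 k)))))%:E)%E.
Proof.
move=> t1 mH H0 ma as1 mb1 mb2 p0.
have mp := measurable_power_past k t1.
pose g (z : past t * plane) : R := H z.1 * expR (p t k z.1 *
      (a z.1 * ((z.2.1 - (mu k).1) ^+ 2 + (z.2.2 - (mu k).2) ^+ 2) +
       (b1 z.1 * (z.2.1 - (mu k).1) + b2 z.1 * (z.2.2 - (mu k).2)))).
have g0 z : 0 <= g z by rewrite mulr_ge0 ?expR_ge0.
have m1 (f : past t -> R) : measurable_fun setT f ->
    measurable_fun setT (fun z : past t * plane => f z.1).
  by move=> mf; exact: (measurableT_comp mf).
have m21 : measurable_fun setT (fun z : past t * plane => z.2.1 - (mu k).1).
  apply: measurable_funB => //.
  exact: (measurableT_comp (@measurable_fst _ _ _ _) (@measurable_snd _ _ _ _)).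
have m22 : measurable_fun setT (fun z : past t * plane => z.2.2 - (mu k).2).
  apply: measurable_funB => //.
  exact: (measurableT_comp (@measurable_snd _ _ _ _) (@measurable_snd _ _ _ _)).
have mg : measurable_fun setT g.
  apply: measurable_funM; first exact: m1.
  apply: measurableT_comp => //; apply: measurable_funM; first exact: m1.
  apply: measurable_funD.
    apply: measurable_funM; first exact: m1.
    by apply: measurable_funD; exact: measurable_funX.
  by apply: measurable_funD; apply: measurable_funM => //; exact: m1.
have eg0 z : (0 <= (EFin \o g) z)%E by rewrite lee_fin.
have emg : measurable_fun setT (EFin \o g) by exact/measurable_EFinP.
rewrite [LHS](integral_observation k t1 eg0 emg).
have ms : measurable_fun setT (fun w : past t => sigma2 k / (2 * p t k w)).
  apply: measurable_funM => //; apply: (measurableT_comp measurable_invr).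
  by apply: measurable_funM.
have ma1 : measurable_fun setT (fun w : past t => 1 - a w * sigma2 k).
  by apply: measurable_funB => //; apply: measurable_funM.
apply: ge0_ae_eq_integral => //.
- apply: (@measurable_past t).
  apply: (measurable_fun_fubini_tonelli_F (fun z : past t * plane => (g z)%:E * (normal2_pdf (mu k) (sigma2 k / (2 * p t k z.1)) z.2)%:E))%E.
    apply: emeasurable_funM; first exact/measurable_EFinP.
    apply/measurable_EFinP; apply: measurable_normal2_pdf => //.
    exact: (m1 _ ms).
  by move=> z; rewrite mule_ge0// lee_fin ?normal2_pdf_ge0.
- apply/measurable_EFinP; apply: (@measurable_past t).
  apply: measurable_funM => //; apply: measurable_funM.
    exact: (measurableT_comp measurable_invr).
  apply: measurableT_comp => //; apply: measurable_funM.
    apply: measurable_funM => //; apply: measurable_funM => //.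
    by apply: measurable_funD; exact: measurable_funX.
  apply: (measurableT_comp measurable_invr).
  exact: measurable_funM.
- by move=> w _; apply: integral_ge0 => x _; rewrite mule_ge0// lee_fin ?normal2_pdf_ge0.
- move=> w _; rewrite lee_fin mulr_ge0// mulr_ge0 ?expR_ge0//.
  by rewrite invr_ge0 subr_ge0 ltW.
- move: p0; apply: filterS => w pw _.
  rewrite /g /=.
  have v0 : 0 < sigma2 k / (2 * p t k w) by rewrite divr_gt0// mulr_gt0.
  have avE : 2 * (a w * p t k w) * (sigma2 k / (2 * p t k w)) = a w * sigma2 k.
    by field; rewrite gt_eqF.
  under eq_integral => x _.
    rewrite -EFinM -mulrA.
    rewrite (_ : p t k w * _ = (a w * p t k w) * ((x.1 - (mu k).1) ^+ 2 + (x.2 - (mu k).2) ^+ 2) +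
      ((p t k w * b1 w) * (x.1 - (mu k).1) + (p t k w * b2 w) * (x.2 - (mu k).2))); last by ring.
    over.
  rewrite ge0_integral_EFinMl//; last 2 first.
  - by move=> x; rewrite mulr_ge0 ?expR_ge0 ?normal2_pdf_ge0.
  - apply: measurable_funM; last exact: measurable_normal2_pdf.
    apply: measurableT_comp => //; apply: measurable_funD.
      apply: measurable_funM => //.
      by apply: measurable_funD; apply: measurable_funX; apply: measurable_funB.
    by apply: measurable_funD; apply: measurable_funM => //; apply: measurable_funB.
  rewrite integral_normal2_pdf_expR ?avE// -EFinM; congr (_ * (_ * expR _))%:E.
  by field; rewrite !gt_eqF ?subr_gt0.
Qed.

End bandit.

(** * Student laws on the plane *)

Section cauchy.
Context {R : realType}.
Local Notation leb := (@lebesgue_measure R).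

Lemma integralT_oneDsqrV :
  (\int[leb]_x ((oneDsqr x)^-1)%:E = (pi : R)%:E)%E.
Proof.
rewrite ge0_symfun_integralT//=.
- rewrite (_ : [set x | _] = `[0, +oo[%classic); last first.
    by apply/seteqP; split => x/=; rewrite in_itv/= andbT.
  by rewrite integral0y_oneDsqr -EFinM mulrCA divff// mulr1.
- exact: continuous_oneDsqrV.
- by move=> x; rewrite /= /oneDsqr sqrrN.
Qed.

Lemma integral_cauchy (b c : R) : 0 < b ->
  (\int[leb]_x ((1 + b * (x - c) ^+ 2)^-1)%:E = (pi / Num.sqrt b)%:E)%E.
Proof.
move=> b0; have sb : 0 < Num.sqrt b by rewrite sqrtr_gt0.
pose F (x : R^o) : R^o := (x - c) * Num.sqrt b.
have F'E : F^`()%classic = cst (Num.sqrt b).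
  apply/funext => x; rewrite /F derive1E deriveM// deriveD// derive_cst scaler0.
  by rewrite add0r derive_id derive_cst addr0 scaler1.
have mb : measurable_fun setT (fun x : R => (1 + b * (x - c) ^+ 2)^-1).
  apply: (measurableT_comp measurable_invr); apply: measurable_funD => //.
  by apply: measurable_funM => //; apply: measurable_funX; exact: measurable_funB.
have b1 x : 0 <= (1 + b * (x - c) ^+ 2)^-1.
  by rewrite invr_ge0 addr_ge0// mulr_ge0 ?sqr_ge0// ltW.
have h : (\int[leb]_x ((((fun x : R => (oneDsqr x)^-1) \o F) * F^`()%classic) x)%:E
    = (pi : R)%:E)%E.
  rewrite -increasing_ge0_integration_by_substitutionT//.
  - exact: integralT_oneDsqrV.
  - move=> x y xy; rewrite /F ltr_pM2r ?ltr_leB ?gt_eqF//.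
  - by rewrite F'E => ?; exact: cvg_cst.
  - by rewrite F'E; exact: is_cvg_cst.
  - by rewrite F'E; exact: is_cvg_cst.
  - by apply/gt0_cvgMlNy => //; exact: cvg_addrr_Ny.
  - by apply/gt0_cvgMly => //; exact: cvg_addrr.
  - exact: continuous_oneDsqrV.
have {}h : (\int[leb]_x ((1 + b * (x - c) ^+ 2)^-1 * Num.sqrt b)%:E = (pi : R)%:E)%E.
  rewrite -h; apply: eq_integral => x _.
  by rewrite F'E !fctE /oneDsqr /F exprMn sqr_sqrtr ?ltW// [_ * b]mulrC.
rewrite (@ge0_integral_EFinMr _ _ _ leb _ b1 mb) ?ltW// in h.
rewrite EFinM -h -muleA -EFinM divff ?gt_eqF// mule1//.
Qed.
End cauchy.

(** * The Euclidean norm *)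

Section enorm.
Context {R : realType}.
Implicit Types x y : (R * R)%type.

Lemma enorm_ge0 x : 0 <= enorm x. Proof. exact: sqrtr_ge0. Qed.

Lemma enorm_sqr x : enorm x ^+ 2 = x.1 ^+ 2 + x.2 ^+ 2.
Proof. by rewrite sqr_sqrtr// addr_ge0 ?sqr_ge0. Qed.

Lemma enormN x : enorm (- x) = enorm x.
Proof. by rewrite /enorm !sqrrN. Qed.

Lemma enormB x y : enorm (x - y) = enorm (y - x).
Proof. by rewrite -enormN opprB. Qed.

(** Cauchy-Schwarz, from Lagrange's identity in dimension 2. *)
Lemma enorm_dot x y : x.1 * y.1 + x.2 * y.2 <= enorm x * enorm y.
Proof.
rewrite /enorm -sqrtrM ?addr_ge0 ?sqr_ge0//.
apply: le_trans (ler_norm _) _; rewrite -sqrtr_sqr ler_sqrt; last first.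
  by rewrite mulr_ge0// addr_ge0 ?sqr_ge0.
rewrite -subr_ge0 (_ : _ - _ = (x.1 * y.2 - x.2 * y.1) ^+ 2) ?sqr_ge0//.
by ring.
Qed.

Lemma enormD x y : enorm (x + y) <= enorm x + enorm y.
Proof.
rewrite -(@ler_pXn2r _ 2)// ?nnegrE ?addr_ge0 ?enorm_ge0//.
have := enorm_dot x y; rewrite sqrrD !enorm_sqr /= => h.
rewrite -subr_ge0.
rewrite (_ : _ - _ = 2 * (enorm x * enorm y - (x.1 * y.1 + x.2 * y.2))).
  by rewrite mulr_ge0// subr_ge0.
by rewrite -mulr_natl; ring.
Qed.

Lemma enormBD x y : enorm x <= enorm (x - y) + enorm y.
Proof. by rewrite -{1}(subrK y x) enormD. Qed.

Lemma enorm_le_norm1 x : enorm x <= `|x.1| + `|x.2|.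
Proof.
rewrite -(@ler_pXn2r _ 2)// ?nnegrE ?enorm_ge0 ?addr_ge0//.
rewrite enorm_sqr sqrrD !real_normK ?num_real// -addrA lerD2l lerDr.
by rewrite mulrn_wge0// mulr_ge0.
Qed.

Lemma measurable_enorm d (T : measurableType d) (f : T -> (R * R)%type) :
  measurable_fun setT f -> measurable_fun setT (fun w => enorm (f w)).
Proof.
move=> mf; have mf1 : measurable_fun setT (fst \o f) by exact: measurableT_comp.
have mf2 : measurable_fun setT (snd \o f) by exact: measurableT_comp.
apply: (measurableT_comp measurable_sqrtr).
by apply: measurable_funD; exact: measurable_funX.
Qed.

Lemma measurable_enormB (c : (R * R)%type) :
  measurable_fun setT (fun m : (R * R)%type => enorm (m - c)).
Proof.
apply: measurable_enorm; apply: measurable_fun_pair; apply: measurable_funB => //.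
Qed.

End enorm.

Section student.
Context {R : realType}.
Local Notation leb := (@lebesgue_measure R).
Local Notation plane := (measurableTypeR R * measurableTypeR R)%type.
Local Notation leb2 := (product_sigma_finite leb leb).
Variables (n : nat) (al : R) (c : (R * R)%type).
Hypothesis al0 : 0 < al.

(** A scaled bivariate Student density with [2 (n - 1)] degrees of freedom. The posterior of round
    [t] has [n = t - 2], [al = N / S] and the weighted mean as centre [c]. *)
Definition student_pdf (m : (R * R)%type) : R :=
  (n%:R - 1) * al / pi * (1 + al * enorm (m - c) ^+ 2) ^- n.

Hypothesis n1 : (1 < n)%N.

Lemma student_pdf_ge0 m : 0 <= student_pdf m.
Proof.
rewrite mulr_ge0//.
  by rewrite divr_ge0 ?pi_ge0// mulr_ge0 ?(ltW al0)// subr_ge0 ler1n ltnW.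
by rewrite invr_ge0 exprn_ge0// addr_ge0// mulr_ge0 ?sqr_ge0// ltW.
Qed.

Lemma measurable_student_pdf : measurable_fun setT student_pdf.
Proof.
apply: measurable_funM => //; apply: (measurableT_comp measurable_invr).
apply: measurable_funX; apply: measurable_funD => //; apply: measurable_funM => //.
by apply: measurable_funX; exact: measurable_enormB.
Qed.

Lemma bernoulli_le (x : R) b : 0 <= x -> 1 + b%:R * x <= (1 + x) ^+ b.
Proof.
move=> x0; elim: b => [|b IH]; first by rewrite mul0r addr0 expr0.
rewrite exprS; apply: (@le_trans _ _ ((1 + x) * (1 + b%:R * x))); last first.
  by rewrite ler_wpM2l// addr_ge0.
rewrite -natr1 -subr_ge0 (_ : _ - _ = b%:R * x ^+ 2); last by ring.
by rewrite mulr_ge0// sqr_ge0.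
Qed.

Lemma student_base_gt0 (x : R) : 0 < 1 + al * x ^+ 2.
Proof. by rewrite ltr_wpDr// mulr_ge0 ?sqr_ge0// ltW. Qed.

Lemma student_power_le a (x y : R) : 0 <= x -> x <= y ->
  (1 + al * x ^+ 2) ^+ a <= (1 + al * y ^+ 2) ^+ a.
Proof.
move=> x0 xy; apply: lerXn2r; rewrite ?nnegrE ?(ltW (student_base_gt0 _))//.
rewrite lerD2l ler_wpM2l ?(ltW al0)//; apply: lerXn2r => //.
by rewrite nnegrE (le_trans x0).
Qed.

(* Of the exponent [n = a + 2 b], the part [a] gives the decay in [rho]; the
   part [2 b] leaves a product of two Cauchy densities, because
   [(1 + r^2)^2 >= (1 + r1^2) (1 + r2^2)] if [r^2 = r1^2 + r2^2], followed by
   Bernoulli's inequality. *)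
Lemma law_student_ub a b rho (B : set (R * R)%type) : n = (a + 2 * b)%N ->
  (0 < b)%N -> 0 <= rho -> measurable B ->
  (forall m, B m -> rho <= enorm (m - c)) ->
  (law_of_density student_pdf B <=
   (pi * (n%:R - 1) / b%:R * (1 + al * rho ^+ 2) ^- a)%:E)%E.
Proof.
move=> nE b0 rho0 mB Brho.
rewrite law_of_densityE//; last 2 first.
- exact: student_pdf_ge0.
- exact: measurable_student_pdf.
pose C := (n%:R - 1) * al / pi * (1 + al * rho ^+ 2) ^- a.
pose g (e x : R) : R := (1 + (b%:R * al) * (x - e) ^+ 2)^-1.
have bal0 : 0 < b%:R * al by rewrite mulr_gt0// ltr0n.
have g0 e x : 0 <= g e x.
  by rewrite invr_ge0 addr_ge0// mulr_ge0 ?sqr_ge0// ltW.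
have mg e : measurable_fun setT (g e).
  apply: (measurableT_comp measurable_invr); apply: measurable_funD => //.
  by apply: measurable_funM => //; apply: measurable_funX; exact: measurable_funB.
have n10 : 0 <= n%:R - 1 :> R by rewrite subr_ge0 ler1n ltnW.
have rho1 := student_base_gt0 rho.
have C0 : 0 <= C.
  by rewrite mulr_ge0// ?invr_ge0 ?exprn_ge0 ?ltW// divr_gt0 ?pi_gt0 ?mulr_gt0 ?subr_gt0 ?ltr1n.
have mgg : measurable_fun setT (fun x : plane => g c.1 x.1 * g c.2 x.2).
  apply: measurable_funM; first exact: (measurableT_comp (mg _)).
  exact: (measurableT_comp (mg _)).
apply: (@le_trans _ _ (\int[leb2]_(x in (B : set plane)) (C * (g c.1 x.1 * g c.2 x.2))%:E)%E).
  apply: ge0_le_integral => //.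
  - by move=> x _; rewrite lee_fin student_pdf_ge0.
  - by apply/measurable_funTS/measurable_EFinP; exact: measurable_student_pdf.
  - by apply/measurable_funTS/measurable_EFinP; exact: measurable_funM.
  move=> x Bx; rewrite lee_fin /student_pdf /C -[leRHS]mulrA.
  apply: ler_wpM2l; first by rewrite divr_ge0 ?pi_ge0// mulr_ge0// ltW.
  rewrite /g -invfM -invfM lef_pV2 ?posrE; last 2 first.
  - by rewrite exprn_gt0// ltr_wpDr// mulr_ge0 ?sqr_ge0// ltW.
  - by rewrite mulr_gt0 ?exprn_gt0// mulr_gt0// ltr_wpDr// mulr_ge0 ?sqr_ge0// ltW.
  rewrite nE exprD exprM; apply: ler_pM.
  - by rewrite exprn_ge0// ltW.
  - by rewrite mulr_ge0// addr_ge0// mulr_ge0 ?sqr_ge0// ltW.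
  - by apply: student_power_le => //; exact: Brho.
  have x10 : 0 <= al * (x.1 - c.1) ^+ 2 by rewrite mulr_ge0 ?sqr_ge0// ltW.
  have x20 : 0 <= al * (x.2 - c.2) ^+ 2 by rewrite mulr_ge0 ?sqr_ge0// ltW.
  apply: (@le_trans _ _ (((1 + al * (x.1 - c.1) ^+ 2) * (1 + al * (x.2 - c.2) ^+ 2)) ^+ b)).
    rewrite exprMn -!(mulrA b%:R); apply: ler_pM.
    - by rewrite addr_ge0// mulr_ge0.
    - by rewrite addr_ge0// mulr_ge0.
    - exact: bernoulli_le.
    - exact: bernoulli_le.
  apply: lerXn2r; rewrite ?nnegrE ?sqr_ge0 ?mulr_ge0 ?addr_ge0//.
  rewrite enorm_sqr (mulrDr al) /=; set u := al * _; set v := al * _.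
  rewrite -subr_ge0 (_ : _ - _ = u ^+ 2 + v ^+ 2 + u + v + u * v); last by ring.
  by rewrite !addr_ge0 ?sqr_ge0// mulr_ge0.
apply: (@le_trans _ _ (\int[leb2]_x (C * (g c.1 x.1 * g c.2 x.2))%:E)%E).
  apply: ge0_subset_integral => //.
  - by apply/measurable_EFinP; exact: measurable_funM.
  - by move=> x _; rewrite lee_fin mulr_ge0// mulr_ge0.
rewrite ge0_integral_EFinMl//; last by move=> x; rewrite mulr_ge0.
rewrite (fubini_tonelli1 (fun x : plane => (g c.1 x.1 * g c.2 x.2)%:E)); last 2 first.
- exact/measurable_EFinP.
- by move=> x; rewrite lee_fin mulr_ge0.
rewrite /fubini_F /=.
under eq_integral => x _.
  rewrite (@ge0_integral_EFinMl _ _ _ leb (g c.2))//; last exact: mg.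
  rewrite integral_cauchy// -EFinM.
  over.
rewrite (@ge0_integral_EFinMr _ _ _ leb (g c.1))//; last 2 first.
- exact: mg.
- by rewrite divr_ge0 ?pi_ge0.
rewrite integral_cauchy// -!EFinM lee_fin (mulrACA pi) -invfM -!expr2 sqr_sqrtr ?(ltW bal0)//.
rewrite /C le_eqVlt; apply/orP; left; apply/eqP.
move: pi (@pi_gt0 R) => q q0; field.
by rewrite !gt_eqF ?ltr0n ?(exprn_gt0 _ rho1).
Qed.

(** [B] contains a square of side [h] with lower left corner [u], on which the density is at least
    its value at distance [D] from the centre. *)
Lemma law_student_lb (u : (R * R)%type) h D (B : set (R * R)%type) :
  0 <= h -> measurable B ->
  (forall m : (R * R)%type, u.1 <= m.1 <= u.1 + h -> u.2 <= m.2 <= u.2 + h ->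
     B m /\ enorm (m - c) <= D) ->
  ((h ^+ 2 * ((n%:R - 1) * al / pi * (1 + al * D ^+ 2) ^- n))%:E <=
   law_of_density student_pdf B)%E.
Proof.
move=> h0 mB QB.
rewrite law_of_densityE//; last 2 first.
- exact: student_pdf_ge0.
- exact: measurable_student_pdf.
pose Q : set plane := `[u.1, u.1 + h]%classic `*` `[u.2, u.2 + h]%classic.
have mQ : measurable Q by apply: measurableX; exact: measurable_itv.
have QB' : Q `<=` B.
  by move=> m [] /=; rewrite !in_itv /= => h1 h2; have [] := QB _ h1 h2.
pose C := (n%:R - 1) * al / pi * (1 + al * D ^+ 2) ^- n.
have D1 := student_base_gt0 D.
have C00 : 0 <= (n%:R - 1) * al / pi.
  by rewrite divr_ge0 ?pi_ge0// mulr_ge0 ?(ltW al0)// subr_ge0 ler1n ltnW.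
have C0 : 0 <= C by rewrite mulr_ge0// invr_ge0 exprn_ge0// ltW.
apply: (@le_trans _ _ (\int[leb2]_(x in Q) C%:E)%E).
  rewrite integral_cst//= /Q product_measure1E/=; last 2 first.
  - exact: measurable_itv.
  - exact: measurable_itv.
  rewrite !lebesgue_measure_itv /= !lte_fin !ltrDl.
  have [h00|h00] := ltP 0 h.
    have hE (x : R) : x + h - x = h by ring.
    by rewrite -!EFinB !hE -!EFinM lee_fin -/C mulrC expr2.
  have -> : h = 0 by apply/eqP; rewrite eq_le h00.
  by rewrite expr0n /= mul0r mul0e mule0.
apply: (@le_trans _ _ (\int[leb2]_(x in Q) (student_pdf x)%:E)%E).
  apply: ge0_le_integral => //.
  - by apply/measurable_funTS/measurable_EFinP; exact: measurable_student_pdf.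
  move=> x [] /=; rewrite !in_itv /= => h1 h2; have [_ xD] := QB _ h1 h2.
  rewrite lee_fin /C /student_pdf ler_wpM2l//.
  rewrite lef_pV2 ?posrE ?exprn_gt0// ?student_base_gt0//.
  exact: student_power_le (enorm_ge0 _) xD.
apply: ge0_subset_integral => //.
- by apply/measurable_funTS/measurable_EFinP; exact: measurable_student_pdf.
- by move=> x _; rewrite lee_fin student_pdf_ge0.
Qed.

Lemma law_student_ge0 (B : set (R * R)%type) : measurable B ->
  (0 <= law_of_density student_pdf B)%E.
Proof.
move=> mB; rewrite law_of_densityE//; last 2 first.
- exact: student_pdf_ge0.
- exact: measurable_student_pdf.
by apply: integral_ge0 => x _; rewrite lee_fin student_pdf_ge0.
Qed.

(** The tail bound at [rho = 0] with the largest possible [b], the half of [n]: a crude bound on the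
    total mass that gives finiteness and costs only constant factors later. *)
Lemma law_student_le B : measurable B ->
  (law_of_density student_pdf B <= (2 * pi)%:E)%E.
Proof.
move=> mB.
have h0 : (0 < n./2)%N by rewrite half_gt0.
have nE : n = (n %% 2 + 2 * n./2)%N by rewrite mul2n modn2 odd_double_half.
apply: le_trans (law_student_ub nE h0 (lexx 0) mB _) _.
  by move=> m _; exact: enorm_ge0.
rewrite lee_fin expr0n /= mulr0 addr0 expr1n invr1 mulr1 ler_pdivrMr ?ltr0n//.
rewrite (mulrC 2) -mulrA ler_pM2l ?pi_gt0// lerBlDr -natrM natr1 ler_nat.
by rewrite {1}nE modn2 -[leqRHS]add1n leq_add2r leq_b1.
Qed.

Lemma fine_law_student B : measurable B ->
  law_of_density student_pdf B = (fine (law_of_density student_pdf B))%:E.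
Proof.
move=> mB; rewrite fineK// ge0_fin_numE ?law_student_ge0//.
by rewrite (le_lt_trans (law_student_le mB))// ltry.
Qed.

End student.

(** * The largest of independent norms *)

Section argmax.
Context {R : realType} {K : nat}.
Variables (n : nat) (al : 'I_K -> R) (c : 'I_K -> (R * R)%type).
Hypothesis n1 : (1 < n)%N.
Hypothesis al0 : forall k, 0 < al k.
Local Notation f k := (student_pdf n (al k) (c k)).
Local Notation law k B := (fine (law_of_density (f k) B)).

Definition inside (y : R) : set (R * R)%type := [set m | enorm m < y].
Definition outside (y : R) : set (R * R)%type := [set m | y <= enorm m].

Lemma measurable_inside y : measurable (inside y).
Proof.
have : measurable_fun setT (fun m : (R * R)%type => enorm m < y).
  by apply: measurable_fun_ltr => //; exact: measurable_enorm.
by move=> /(_ measurableT [set true]); rewrite setTI; exact.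
Qed.

Lemma measurable_outside y : measurable (outside y).
Proof.
have : measurable_fun setT (fun m : (R * R)%type => y <= enorm m).
  by apply: measurable_fun_ler => //; exact: measurable_enorm.
by move=> /(_ measurableT [set true]); rewrite setTI; exact.
Qed.

Lemma fine_law_ge0 k (B : set (R * R)%type) : measurable B -> 0 <= law k B.
Proof. by move=> mB; rewrite fine_ge0// law_student_ge0. Qed.

Lemma fine_law_ge k u h D (B : set (R * R)%type) :
  0 <= h -> measurable B ->
  (forall m : (R * R)%type, u.1 <= m.1 <= u.1 + h -> u.2 <= m.2 <= u.2 + h ->
     B m /\ enorm (m - c k) <= D) ->
  h ^+ 2 * ((n%:R - 1) * al k / pi * (1 + al k * D ^+ 2) ^- n) <= law k B.
Proof.
move=> h0 mB uB; rewrite -lee_fin -fine_law_student//.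
exact: law_student_lb uB.
Qed.

Lemma fine_law_gt0 k u h D (B : set (R * R)%type) :
  0 < h -> measurable B ->
  (forall m : (R * R)%type, u.1 <= m.1 <= u.1 + h -> u.2 <= m.2 <= u.2 + h ->
     B m /\ enorm (m - c k) <= D) -> 0 < law k B.
Proof.
move=> h0 mB uB; apply: lt_le_trans (fine_law_ge (ltW h0) mB uB).
rewrite mulr_gt0 ?exprn_gt0// mulr_gt0//.
  by rewrite divr_gt0 ?pi_gt0// mulr_gt0// subr_gt0 ltr1n.
by rewrite invr_gt0 exprn_gt0// student_base_gt0.
Qed.

(** The unit square with lower left corner [(max y 0, 0)] avoids the open disc of radius [y]. *)
Lemma outside_law_gt0 k y : 0 < law k (outside y).
Proof.
pose z := Num.max y 0.
apply: (@fine_law_gt0 k (z, 0) 1 (z + 2 + enorm (c k))) => //.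
  exact: measurable_outside.
move=> m /= m1 m2; split.
  apply: (@le_trans _ _ `|m.1|).
    rewrite (le_trans _ (ler_norm _))//.
    by case/andP: m1 => + _; apply: le_trans; rewrite /z le_max lexx.
  by rewrite -sqrtr_sqr /enorm ler_wsqrtr// lerDl sqr_ge0.
rewrite (le_trans (enormD _ _))// enormN lerD2r.
rewrite (le_trans (enorm_le_norm1 _))//.
have z0 : 0 <= z by rewrite /z le_max lexx orbT.
case/andP: m1 => m11 m12; case/andP: m2 => m21 m22.
by rewrite (ger0_norm (le_trans z0 m11)) (ger0_norm m21); lra.
Qed.

Lemma inside_law_gt0 k y : 0 < y -> 0 < law k (inside y).
Proof.
move=> y0; apply: (@fine_law_gt0 k (0, 0) (y / 3) (y + enorm (c k))).
- by rewrite divr_gt0.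
- exact: measurable_inside.
move=> m /= /andP[m11 m12] /andP[m21 m22].
have my : enorm m < y.
  rewrite (le_lt_trans (enorm_le_norm1 _))// !ger0_norm//; lra.
by split=> //; rewrite (le_trans (enormD _ _))// enormN lerD2r ltW.
Qed.

Lemma measurable_argmax d (W : measurableType d)
    (Y : 'I_K -> {mfun W >-> (R * R)%type}) k :
  measurable [set w | forall i, enorm (Y i w) <= enorm (Y k w)].
Proof.
rewrite (_ : [set w | _] = \bigcap_i [set w | enorm (Y i w) <= enorm (Y k w)]); last first.
  by apply/seteqP; split => w /= h i; [move=> _|]; apply: h.
apply: fin_bigcap_measurable => // i _.
have : measurable_fun setT (fun w => enorm (Y i w) <= enorm (Y k w)).
  by apply: measurable_fun_ler; apply: measurable_enorm.
by move=> /(_ measurableT [set true]); rewrite setTI; exact.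
Qed.

Variable r : 'I_K -> R.
Hypothesis argmax_r : argmax_probability (fun k => f k) r.

Lemma argmax_probability_ge k (B : 'I_K -> set (R * R)%type) :
  (forall k, measurable (B k)) ->
  (forall x : 'I_K -> (R * R)%type, (forall i, B i (x i)) ->
     forall i, enorm (x i) <= enorm (x k)) ->
  \prod_i law i (B i) <= r k.
Proof.
move=> mB BE; have [d [W [Q [Y [QY Qr]]]]] := argmax_r.
rewrite -lee_fin Qr.
have -> : (\prod_i law i (B i))%:E = Q (\bigcap_i (Y i @^-1` B i)).
  rewrite QY// -prodEFin; apply: eq_bigr => i _.
  by rewrite -fine_law_student.
have mYB : measurable (\bigcap_i (Y i @^-1` B i)).
  by apply: fin_bigcap_measurable => // i _; exact: measurable_funPTI.
have mA := measurable_argmax Y k.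
apply: le_measure; rewrite ?inE// => w Yw i.
by apply: (BE (fun i => Y i w)) => j; exact: Yw.
Qed.

(** Arm [k] wins if its sample lies outside the unit disc and all the others inside. This is what
    keeps every power positive, as [integral_step] requires. *)
Lemma argmax_probability_gt0 k : 0 < r k.
Proof.
pose B i := if i == k then outside 1 else inside 1.
have mB i : measurable (B i).
  by rewrite /B; case: ifP => _; [exact: measurable_outside|exact: measurable_inside].
apply: lt_le_trans (argmax_probability_ge mB _).
  apply: prodr_gt0 => i _; rewrite /B; case: ifP => _.
    exact: outside_law_gt0.
  exact: inside_law_gt0.
move=> x Bx i; have := Bx i; have := Bx k; rewrite /B eqxx /= => xk.
case: eqP => [->//|_ xi]; exact: le_trans (ltW xi) xk.
Qed.

(* If all the norms stay below [y], then making only that of [ks] exceed [y]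
   costs the inverse odds and makes [ks] win. The factor [(2 * pi) ^+ K] is a
   crude bound for the product of the total masses, which are in fact 1. *)
Lemma argmax_probability_le k ks y :
  r k <= (2 * pi) ^+ K * law k (outside y) +
    r ks * (law ks (inside y) / law ks (outside y)).
Proof.
have [d [W [Q [Y [QY Qr]]]]] := argmax_r.
have QB (B : 'I_K -> set (R * R)%type) : (forall i, measurable (B i)) ->
    Q (\bigcap_i (Y i @^-1` B i)) = (\prod_i law i (B i))%:E.
  move=> mB; rewrite QY// -prodEFin; apply: eq_bigr => i _.
  by rewrite -fine_law_student.
have mYB (B : 'I_K -> set (R * R)%type) : (forall i, measurable (B i)) ->
    measurable (\bigcap_i (Y i @^-1` B i)).
  by move=> mB; apply: fin_bigcap_measurable => // i _; exact: measurable_funPTI.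
pose B1 i := if i == k then outside y else setT.
have mB1 i : measurable (B1 i).
  by rewrite /B1; case: ifP => _ //; exact: measurable_outside.
pose B2 (_ : 'I_K) := inside y.
have mB2 i : measurable (B2 i) by exact: measurable_inside.
pose B3 i := if i == ks then outside y else inside y.
have mB3 i : measurable (B3 i).
  by rewrite /B3; case: ifP => _; [exact: measurable_outside|exact: measurable_inside].
have h1 : r k <= \prod_i law i (B1 i) + \prod_i law i (B2 i).
  rewrite -lee_fin Qr EFinD -!QB//.
  apply: le_trans (measureU2 _ _ _); [|exact: mYB|exact: mYB].
  apply: le_measure; rewrite ?inE.
  - exact: measurable_argmax.
  - by apply: measurableU; exact: mYB.
  move=> w Yw; have [yY|Yy] := leP y (enorm (Y k w)).
    by left=> i _; rewrite /B1 /=; case: eqP => [->|].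
  by right=> i _; rewrite /B2 /inside /=; exact: le_lt_trans (Yw i) Yy.
have pi2 : 1 <= 2 * pi :> R by have := @pi_ge2 R; lra.
have h2 : \prod_i law i (B1 i) <= (2 * pi) ^+ K * law k (outside y).
  rewrite (bigD1 k)//= {1}/B1 eqxx mulrC ler_wpM2r//.
    by apply: fine_law_ge0; exact: measurable_outside.
  apply: (@le_trans _ _ (\prod_(i < K | i != k) (2 * pi))).
    apply: ler_prod => i _; rewrite fine_law_ge0//= -lee_fin -fine_law_student//.
    exact: law_student_le.
  rewrite prodr_const ler_weXn2l//.
  by rewrite -[leqRHS]card_ord max_card.
have h3 : law ks (outside y) * \prod_(i < K | i != ks) law i (inside y) <= r ks.
  have B3ks : B3 ks = outside y by rewrite /B3 eqxx.
  apply: le_trans (@argmax_probability_ge ks B3 mB3 _).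
    rewrite [leRHS](bigD1 ks)//= B3ks le_eqVlt; apply/orP; left; apply/eqP; congr (_ * _).
    by apply: eq_bigr => i /negbTE ik; rewrite /B3 ik.
  move=> x Bx i; have := Bx i; have := Bx ks; rewrite /B3 eqxx /= => xk.
  case: eqP => [->//|_ xi]; exact: le_trans (ltW xi) xk.
apply: le_trans h1 _; apply: lerD => //.
rewrite (bigD1 ks)//= /B2 mulrA ler_pdivlMr ?outside_law_gt0//.
rewrite mulrAC [_ * law ks (inside y)]mulrC -mulrA ler_wpM2l//.
by apply: fine_law_ge0; exact: measurable_inside.
Qed.

End argmax.

(** * Positivity of the scatters and of the powers *)

Section wstatistics.
Context {R : realType}.
Variables (q : nat -> R) (x : nat -> (R * R)%type).
Hypothesis q0 : forall l, (1 <= l)%N -> 0 <= q l.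

Lemma total_powerS t : total_power q t.+1 = total_power q t + q t.+1.
Proof. by rewrite /total_power big_nat_recr. Qed.

Lemma total_power0 : total_power q 0 = 0.
Proof. by rewrite /total_power big_geq. Qed.

Lemma le_total_power s t : (s <= t)%N -> total_power q s <= total_power q t.
Proof.
elim: t => [|t IH]; first by rewrite leqn0 => /eqP ->.
rewrite leq_eqVlt => /predU1P[->//|/IH st].
by rewrite total_powerS (le_trans st)// lerDl q0.
Qed.

(** Two different first coordinates cannot both equal that of the mean, so one of the first two
    rounds has a positive term. *)
Lemma wscatter_gt0 t : (2 <= t)%N -> 0 < q 1%N -> 0 < q 2%N ->
  (x 1%N).1 != (x 2%N).1 -> 0 < wscatter q x t.
Proof.
move=> t2 q1 q2 x12; have sq l : (1 <= l)%N ->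
    0 <= q l * enorm (x l - wmean q x t) ^+ 2.
  by move=> l1; rewrite mulr_ge0 ?sqr_ge0 ?q0.
have [l [l1 lt xl]] : exists l, [/\ 0 < q l, (1 <= l < 3)%N & (x l).1 != (wmean q x t).1].
  have [e|] := eqVneq (x 1%N).1 (wmean q x t).1; last by exists 1%N.
  by exists 2%N; split => //; rewrite -e eq_sym.
rewrite /wscatter big_nat_cond lt_neqAle eq_sym sumr_ge0 ?andbT; last first.
  by move=> i; rewrite andbT => /andP[i1 _]; exact: sq.
rewrite psumr_neq0; last by move=> i; rewrite andbT => /andP[i1 _]; exact: sq.
apply/hasP; exists l.
  by rewrite mem_index_iota; case/andP: lt => -> /= l3; rewrite (leq_trans l3).
rewrite andbT; case/andP: (lt) => -> /= l3; rewrite (leq_trans l3)//=.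
rewrite mulr_gt0// enorm_sqr ltr_pwDl ?sqr_ge0//=.
by rewrite exprn_even_gt0//= subr_eq0.
Qed.

End wstatistics.

Lemma posterior_pdfE (R : realType) (q : nat -> R) x t : (4 <= t)%N ->
  posterior_pdf q x t = student_pdf (t - 2)
    (total_power q t.-1 / wscatter q x t.-1) (wmean q x t.-1).
Proof.
move=> t4; apply/funext => m; rewrite /posterior_pdf /student_pdf.
rewrite (_ : (t - 2)%:R - 1 = t%:R - 3 :> R); last first.
  by rewrite natrB; [lra|exact: leq_trans t4].
congr (_ * (1 + _) ^- _); first by rewrite invfM !mulrA mulrAC.
by rewrite mulrAC.
Qed.

Section process.
Context {R : realType} {K : nat} {d : measure_display}
  {Omega : measurableType d} (P : probability Omega R).
Variables (p : nat -> 'I_K -> Omega -> R)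
  (X : nat -> 'I_K -> {RV P >-> (R * R)%type})
  (mu : 'I_K -> (R * R)%type) (sigma2 : 'I_K -> R).
Hypothesis K2 : (2 <= K)%N.
Hypothesis sigma2_gt0 : forall k, 0 < sigma2 k.
Hypothesis bandit : bandit_under_weighted_information p X mu sigma2.
Hypothesis wts : weighted_thompson_sampling p X.
Local Notation plane := (measurableTypeR R * measurableTypeR R)%type.
Local Notation past t := (g_sigma_algebraType (history_generators p X t)).

(** Valid for every [v]: [normal_prob] is dominated by Lebesgue measure even at standard deviation
    0, so positivity of the powers can be derived from this without circularity. *)
Lemma normal2_vertical (m : (R * R)%type) v (z : R) :
  normal2 m v ([set z] `*` setT) = 0%E.
Proof.
rewrite /normal2; apply: (eq_trans (@product_measure1E _ _ _ _ _
  (normal_prob m.1 (Num.sqrt v)) (normal_prob m.2 (Num.sqrt v)) _ _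
  (@measurable_set1 _ z) (@measurableT _ (measurableTypeR R)))).
have z0 : normal_prob m.1 (Num.sqrt v) [set z] = 0%E.
  apply: ((null_content_dominatesP _ _).1 (normal_prob_dominates m.1 (Num.sqrt v))).
    exact: measurable_set1.
  exact: lebesgue_measure_set1.
by apply: (eq_trans (f_equal2 mule z0 erefl)); rewrite mul0e.
Qed.

(** Given round 1, the observation of round 2 would have to fall on a fixed vertical line. *)
Lemma observations_ae_neq k : {ae P, forall w, (X 1 k w).1 != (X 2 k w).1}.
Proof.
pose g (z : past 2 * plane) : R := (z.2.1 == (X 1 k z.1).1)%:R.
have mX1 : measurable_fun setT (fun z : past 2 * plane => (X 1 k z.1).1).
  have mX : measurable_fun setT (X 1 k : past 2 -> (R * R)%type).
    exact: measurable_observation.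
  exact: (measurableT_comp (measurableT_comp (@measurable_fst _ _ _ _) mX) (@measurable_fst _ _ _ _)).
have mg : measurable_fun setT g.
  have mb : measurable_fun setT (fun z : past 2 * plane => z.2.1 == (X 1 k z.1).1).
    apply: measurable_fun_eqr => //.
    exact: (measurableT_comp (@measurable_fst _ _ _ _) (@measurable_snd _ _ _ _)).
  rewrite (_ : g = fun z => if z.2.1 == (X 1 k z.1).1 then 1 else 0).
    exact: measurable_fun_ifT.
  by apply/funext => z; rewrite /g; case: ifP.
have eg0 z : (0 <= (EFin \o g) z)%E by rewrite lee_fin /g; case: eqP.
have emg : measurable_fun setT (EFin \o g) by exact/measurable_EFinP.
have := integral_observation bandit k (isT : (1 <= 2)%N) eg0 emg.
rewrite [RHS]integral0_eq; last first.
  move=> w _; rewrite -[RHS](normal2_vertical (mu k) (sigma2 k / (2 * p 2 k w)) (X 1 k w).1).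
  have mB : measurable ([set (X 1 k w).1] `*` setT : set plane).
    by apply: measurableX => //; exact: measurable_set1.
  rewrite normal2E// [RHS]integral_mkcond; apply: eq_integral => x _.
  rewrite patchE /g /=; case: eqP => [e|ne].
    by rewrite mul1e mem_set.
  by rewrite mul0e memNset// => -[].
move=> h; pose E : set Omega := [set w | (X 2 k w).1 == (X 1 k w).1].
have mE : measurable E.
  have : measurable_fun setT (fun w => (X 2 k w).1 == (X 1 k w).1).
    by apply: measurable_fun_eqr; apply: (measurableT_comp (@measurable_fst _ _ _ _)).
  by move=> /(_ measurableT [set true]); rewrite setTI; exact.
exists E; split => //.
  rewrite -[E]setIT -integral_indic// -[RHS]h.
  apply: eq_integral => w _; rewrite /g /= indicE; congr (_%:R%:E).
  by have [e|e] := boolP (_ == _); [rewrite mem_set|rewrite memNset//; exact/negP].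
by move=> w /= /negP; rewrite negbK eq_sym.
Qed.

Definition power_sum t k w := total_power (fun l => p l k w) t.
Definition mean t k w := wmean (fun l => p l k w) (fun l => X l k w) t.
Definition scatter t k w := wscatter (fun l => p l k w) (fun l => X l k w) t.

Lemma power_first t k w : (1 <= t <= 3)%N -> p t k w = K%:R^-1.
Proof. by case: wts => + _; apply. Qed.

Lemma invK_gt0 : 0 < K%:R^-1 :> R.
Proof. by rewrite invr_gt0 ltr0n (leq_trans _ K2). Qed.

(** The uniform first round provides a deterministic lower bound for [N], which later enters the
    prefactor of the posterior odds. *)
Lemma power_sum_ge t k w : (1 <= t)%N -> K%:R^-1 <= power_sum t k w.
Proof.
move=> t1; apply: (@le_trans _ _ (power_sum 1 k w)).
  by rewrite /power_sum total_powerS total_power0 add0r power_first.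
by apply: le_total_power => // l l1; exact: (power_ge0 bandit).
Qed.

Lemma power_sum_gt0 t k w : (1 <= t)%N -> 0 < power_sum t k w.
Proof. by move=> t1; apply: lt_le_trans (power_sum_ge _ _ t1); exact: invK_gt0. Qed.

Lemma scatter_gt0_ae : {ae P, forall w, forall t k, (2 <= t)%N -> 0 < scatter t k w}.
Proof.
have : {ae P, forall w, forall k, (X 1 k w).1 != (X 2 k w).1}.
  by apply: filter_forall => k; exact: observations_ae_neq.
apply: filterS => w Xw t k t2; apply: wscatter_gt0 => //.
- by move=> l l1; exact: (power_ge0 bandit).
- by rewrite power_first// invK_gt0.
- by rewrite power_first// invK_gt0.
Qed.

Lemma argmax_power t w : (4 <= t)%N -> (forall k, 0 < scatter t.-1 k w) ->
  argmax_probability (fun k => student_pdf (t - 2)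
    (power_sum t.-1 k w / scatter t.-1 k w) (mean t.-1 k w))
    (fun k => p t k w).
Proof.
move=> t4 s0; case: wts => _ /(_ t w t4 s0).
congr argmax_probability; apply/funext => k.
by rewrite posterior_pdfE.
Qed.

Lemma power_gt0_ae : {ae P, forall w, forall t k, (1 <= t)%N -> 0 < p t k w}.
Proof.
apply: filterS scatter_gt0_ae => w s0 t k t1.
have [t3|t4] := leqP t 3; first by rewrite power_first ?t1// invK_gt0.
have s0' j : 0 < scatter t.-1 j w by apply: s0; lia.
apply: argmax_probability_gt0 (argmax_power t4 s0') k.
  by lia.
move=> j; rewrite divr_gt0// power_sum_gt0//.
by lia.
Qed.

End process.

(** * Exponential supermartingales *)

Section weighted_sums.
Context {R : realType}.
Variables (q : nat -> R) (x : nat -> (R * R)%type) (m : (R * R)%type).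
Definition deviation_sum1 t := \sum_(1 <= l < t.+1) q l * ((x l).1 - m.1).
Definition deviation_sum2 t := \sum_(1 <= l < t.+1) q l * ((x l).2 - m.2).
Definition energy t :=
  \sum_(1 <= l < t.+1) q l * (((x l).1 - m.1) ^+ 2 + ((x l).2 - m.2) ^+ 2).

Lemma wmean1E t : 0 < total_power q t ->
  (wmean q x t).1 - m.1 = deviation_sum1 t / total_power q t.
Proof.
move=> N0; rewrite /wmean /deviation_sum1 /=.
apply: (mulIf (lt0r_neq0 N0)); rewrite mulfVK ?gt_eqF// mulrBl mulfVK ?gt_eqF//.
rewrite /total_power mulr_sumr -sumrB; apply: eq_bigr => l _.
by rewrite mulrBr [m.1 * _]mulrC.
Qed.

Lemma wmean2E t : 0 < total_power q t ->
  (wmean q x t).2 - m.2 = deviation_sum2 t / total_power q t.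
Proof.
move=> N0; rewrite /wmean /deviation_sum2 /=.
apply: (mulIf (lt0r_neq0 N0)); rewrite mulfVK ?gt_eqF// mulrBl mulfVK ?gt_eqF//.
rewrite /total_power mulr_sumr -sumrB; apply: eq_bigr => l _.
by rewrite mulrBr [m.2 * _]mulrC.
Qed.

(** The parallel axis identity, relative to an arbitrary point [m], which will be the true mean. *)
Lemma wscatterE t : 0 < total_power q t ->
  wscatter q x t = energy t -
    (deviation_sum1 t ^+ 2 + deviation_sum2 t ^+ 2) / total_power q t.
Proof.
move=> N0; set N := total_power q t; pose a := deviation_sum1 t / N.
pose b := deviation_sum2 t / N.
transitivity (energy t - 2 * a * deviation_sum1 t - 2 * b * deviation_sum2 t
    + (a ^+ 2 + b ^+ 2) * N).
  rewrite /energy /deviation_sum1 /deviation_sum2 /N /total_power !mulr_sumr -!sumrB -big_split /=.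
  apply: eq_bigr => l _; rewrite enorm_sqr /=.
  have := wmean1E N0; have := wmean2E N0; rewrite -/N -/a -/b => hb ha.
  have -> : (x l).1 - (wmean q x t).1 = ((x l).1 - m.1) - a by rewrite -ha; ring.
  have -> : (x l).2 - (wmean q x t).2 = ((x l).2 - m.2) - b by rewrite -hb; ring.
  by ring.
by rewrite /a /b; field; rewrite gt_eqF.
Qed.

Lemma energyS t : energy t.+1 = energy t +
  q t.+1 * (((x t.+1).1 - m.1) ^+ 2 + ((x t.+1).2 - m.2) ^+ 2).
Proof. by rewrite /energy big_nat_recr. Qed.

Lemma deviation_sum1S t : deviation_sum1 t.+1 =
  deviation_sum1 t + q t.+1 * ((x t.+1).1 - m.1).
Proof. by rewrite /deviation_sum1 big_nat_recr. Qed.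

Lemma deviation_sum2S t : deviation_sum2 t.+1 =
  deviation_sum2 t + q t.+1 * ((x t.+1).2 - m.2).
Proof. by rewrite /deviation_sum2 big_nat_recr. Qed.

Lemma energy0 : energy 0 = 0. Proof. by rewrite /energy big_geq. Qed.
Lemma deviation_sum10 : deviation_sum1 0 = 0.
Proof. by rewrite /deviation_sum1 big_geq. Qed.
Lemma deviation_sum20 : deviation_sum2 0 = 0.
Proof. by rewrite /deviation_sum2 big_geq. Qed.

Lemma wscatter_le_energy t : 0 < total_power q t -> wscatter q x t <= energy t.
Proof.
move=> N0; rewrite wscatterE// lerBlDr lerDl divr_ge0 ?(ltW N0)//.
by rewrite addr_ge0 ?sqr_ge0.
Qed.

(** Welford's one-round update, with the new observation measured from the previous weighted
    mean. *)
Lemma wscatterS t : 0 < total_power q t -> 0 <= q t.+1 ->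
  let N := total_power q t in let r := N / (N + q t.+1) in
  wscatter q x t.+1 = wscatter q x t + r * q t.+1 *
    (((x t.+1).1 - m.1 - deviation_sum1 t / N) ^+ 2 +
     ((x t.+1).2 - m.2 - deviation_sum2 t / N) ^+ 2).
Proof.
move=> N0 q0 N r; have N0' : 0 < total_power q t.+1.
  by rewrite total_powerS ltr_pwDl.
rewrite wscatterE// wscatterE// energyS deviation_sum1S deviation_sum2S total_powerS /r -/N.
set e1 := _ - m.1; set e2 := _ - m.2.
field; rewrite !gt_eqF// -/N; rewrite total_powerS in N0'; exact: N0'.
Qed.

End weighted_sums.

Section supermartingales.
Context {R : realType} {K : nat} {d : measure_display}
  {Omega : measurableType d} (P : probability Omega R).
Variables (p : nat -> 'I_K -> Omega -> R)
  (X : nat -> 'I_K -> {RV P >-> (R * R)%type})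
  (mu : 'I_K -> (R * R)%type) (sigma2 : 'I_K -> R).
Hypothesis K2 : (2 <= K)%N.
Hypothesis sigma2_gt0 : forall k, 0 < sigma2 k.
Hypothesis bandit : bandit_under_weighted_information p X mu sigma2.
Hypothesis wts : weighted_thompson_sampling p X.
Local Notation past t := (g_sigma_algebraType (history_generators p X t)).
Local Notation N := (power_sum p).
Local Notation pw k w := (fun l => p l k w).
Local Notation ob k w := (fun l => X l k w).

Definition mean_error1 t k w := deviation_sum1 (pw k w) (ob k w) (mu k) t.
Definition mean_error2 t k w := deviation_sum2 (pw k w) (ob k w) (mu k) t.
Definition noise_energy t k w := energy (pw k w) (ob k w) (mu k) t.

Lemma measurable_sum_past T t (f : nat -> Omega -> R) :
  (forall l, (1 <= l <= t)%N -> measurable_fun setT (f l : past T -> R)) ->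
  measurable_fun setT (fun w : past T => \sum_(1 <= l < t.+1) f l w).
Proof.
elim: t => [|t IH] mf.
  rewrite (_ : (fun _ => _) = fun=> 0) //.
  by apply/funext => w; rewrite big_geq.
rewrite (_ : (fun _ => _) = fun w => \sum_(1 <= l < t.+1) f l w + f t.+1 w); last first.
  by apply/funext => w; rewrite big_nat_recr.
apply: measurable_funD; last by apply: mf; lia.
by apply: IH => l lt; apply: mf; lia.
Qed.

Lemma measurable_power_sum T t k : (t <= T)%N ->
  measurable_fun setT (N t k : past T -> R).
Proof.
move=> tT; apply: measurable_sum_past => l lt.
by apply: (measurable_power_le bandit); lia.
Qed.

Lemma measurable_noise1 T t k : (1 <= t < T)%N ->
  measurable_fun setT (noise1 X mu t k : past T -> R).
Proof.
move=> tT; apply: measurable_funB => //.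
have mX : measurable_fun setT (X t k : past T -> (R * R)%type).
  exact: measurable_observation.
exact: (measurableT_comp (@measurable_fst _ _ _ _) mX).
Qed.

Lemma measurable_noise2 T t k : (1 <= t < T)%N ->
  measurable_fun setT (noise2 X mu t k : past T -> R).
Proof.
move=> tT; apply: measurable_funB => //.
have mX : measurable_fun setT (X t k : past T -> (R * R)%type).
  exact: measurable_observation.
exact: (measurableT_comp (@measurable_snd _ _ _ _) mX).
Qed.

Lemma measurable_mean_error1 T t k : (t < T)%N -> measurable_fun setT (mean_error1 t k : past T -> R).
Proof.
move=> tT; apply: measurable_sum_past => l lt; apply: measurable_funM.
  by apply: (measurable_power_le bandit); lia.
by apply: measurable_noise1; lia.
Qed.

Lemma measurable_mean_error2 T t k : (t < T)%N -> measurable_fun setT (mean_error2 t k : past T -> R).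
Proof.
move=> tT; apply: measurable_sum_past => l lt; apply: measurable_funM.
  by apply: (measurable_power_le bandit); lia.
by apply: measurable_noise2; lia.
Qed.

Lemma measurable_noise_energy T t k : (t < T)%N -> measurable_fun setT (noise_energy t k : past T -> R).
Proof.
move=> tT; apply: measurable_sum_past => l lt; apply: measurable_funM.
  by apply: (measurable_power_le bandit); lia.
apply: measurable_funD; apply: measurable_funX.
  by apply: measurable_noise1; lia.
by apply: measurable_noise2; lia.
Qed.

Lemma measurable_scatter T t k : (1 <= t < T)%N ->
  measurable_fun setT (scatter p X t k : past T -> R).
Proof.
move=> tT; rewrite (_ : scatter p X t k = fun w =>
    noise_energy t k w - (mean_error1 t k w ^+ 2 + mean_error2 t k w ^+ 2) / N t k w); last first.
  apply/funext => w; apply: wscatterE; apply: (power_sum_gt0 K2 bandit wts).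
  by case/andP: tT.
apply: measurable_funB; first by apply: measurable_noise_energy; lia.
apply: measurable_funM.
  by apply: measurable_funD; apply: measurable_funX;
    [apply: measurable_mean_error1|apply: measurable_mean_error2]; lia.
apply: (measurableT_comp measurable_invr); apply: measurable_power_sum; lia.
Qed.

Definition tilt (c l1 l2 : R) t k w : R :=
  expR (l1 * mean_error1 t k w + l2 * mean_error2 t k w
        - ((l1 ^+ 2 + l2 ^+ 2) * sigma2 k / 4 + c) * N t k w).

Lemma measurable_tilt c l1 l2 T t k : (t < T)%N ->
  measurable_fun setT (tilt c l1 l2 t k : past T -> R).
Proof.
move=> tT; apply: measurableT_comp => //; apply: measurable_funB.
  by apply: measurable_funD; apply: measurable_funM => //;
    [apply: measurable_mean_error1|apply: measurable_mean_error2].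
by apply: measurable_funM => //; apply: measurable_power_sum; lia.
Qed.

(** [integral_step] with [a = 0] yields [exp (|l|^2 sigma2 p / 4)], which the compensator cancels
    exactly; only the discount [exp (- c p)] remains. *)
Lemma integral_tilt_step c l1 l2 t k :
  (\int[P]_w (tilt c l1 l2 t.+1 k w)%:E =
   \int[P]_w (tilt c l1 l2 t k w * expR (- c * p t.+1 k w))%:E)%E.
Proof.
have pos : {ae P, forall w, 0 < p t.+1 k w}.
  by have := power_gt0_ae K2 bandit wts; apply: filterS => w; apply.
pose H w := tilt c l1 l2 t k w *
  expR (- ((l1 ^+ 2 + l2 ^+ 2) * sigma2 k / 4 + c) * p t.+1 k w).
have mp : measurable_fun setT (p t.+1 k : past t.+1 -> R).
  exact: (measurable_power_past bandit k (isT : (1 <= t.+1)%N)).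
have mH : measurable_fun setT (H : past t.+1 -> R).
  apply: measurable_funM; first exact: measurable_tilt.
  by apply: measurableT_comp => //; apply: measurable_funM.
have H0 w : 0 <= H w by rewrite mulr_ge0 ?expR_ge0.
have a1 (w : Omega) : (fun=> 0 : R) w * sigma2 k < 1 by rewrite mul0r.
have step := integral_step sigma2_gt0 bandit (isT : (1 <= t.+1)%N) mH H0
  (measurable_cst (0 : R)) a1 (measurable_cst l1) (measurable_cst l2) pos.
transitivity (\int[P]_w (H w * expR (p t.+1 k w *
    (0 * (noise1 X mu t.+1 k w ^+ 2 + noise2 X mu t.+1 k w ^+ 2) +
    (l1 * noise1 X mu t.+1 k w + l2 * noise2 X mu t.+1 k w))))%:E)%E.
  apply: eq_integral => w _; congr EFin.
  rewrite /H /tilt -!expRD; congr expR.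
  rewrite /mean_error1 /mean_error2 deviation_sum1S deviation_sum2S /power_sum total_powerS.
  by rewrite /noise1 /noise2; ring.
rewrite step; apply: eq_integral => w _; congr EFin.
rewrite /H /= mul0r subr0 invr1 mul1r -mulrA -expRD; congr (_ * expR _).
by field.
Qed.

Lemma tilt0 c l1 l2 k w : tilt c l1 l2 0 k w = 1.
Proof.
rewrite /tilt /mean_error1 /mean_error2 deviation_sum10 deviation_sum20 /power_sum total_power0.
by rewrite !mulr0 addr0 subr0 expR0.
Qed.

(* With [q = (l1^2 + l2^2) sigma2 / 4] the process
   [exp (l1 mean_error1 + l2 mean_error2 - q N)] is a martingale, and multiplying it by
   [exp (- c N)] makes it lose at least the fraction [p c / (1 + c)] of its value
   in a round of power [p]; the losses add up to at most the initial value. *)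
Lemma sum_tilt_le (c l1 l2 : R) T k : 0 < c ->
  (\sum_(t < T) \int[P]_w (p t.+1 k w * tilt c l1 l2 t k w)%:E
   <= ((1 + c) / c)%:E)%E.
Proof.
move=> c0; have c1 : 0 < 1 + c by lra.
have mtilt t : measurable_fun setT (tilt c l1 l2 t k).
  apply: (@measurable_past _ _ _ _ _ _ _ _ _ bandit t.+1).
  exact: measurable_tilt.
have mp t : measurable_fun setT (p t.+1 k).
  apply: (@measurable_past _ _ _ _ _ _ _ _ _ bandit t.+1).
  exact: (measurable_power_past bandit k (isT : (1 <= t.+1)%N)).
have tilt_ge0 t w : 0 <= tilt c l1 l2 t k w by exact: expR_ge0.
have p0 t w : 0 <= p t.+1 k w by exact: (power_ge0 bandit).
pose kap := c / (1 + c); have kap0 : 0 <= kap by rewrite divr_ge0// ltW.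
suff h : (kap%:E * (\sum_(t < T) \int[P]_w (p t.+1 k w * tilt c l1 l2 t k w)%:E) +
    \int[P]_w (tilt c l1 l2 T k w)%:E <= 1)%E.
  have i0 : (0 <= \int[P]_w (tilt c l1 l2 T k w)%:E)%E.
    by apply: integral_ge0 => w _; rewrite lee_fin.
  have := le_trans (leeDl _ i0) h.
  by rewrite /kap -invf_div lee_pdivrMl ?divr_gt0// mule1.
elim: T => [|T IH].
  rewrite big_ord0 mule0 add0e; under eq_integral do rewrite tilt0.
  by rewrite integral_cst//= probability_setT mule1.
apply: le_trans IH; rewrite big_ord_recr/= ge0_muleDr; last 2 first.
- apply: sume_ge0 => t _; apply: integral_ge0 => w _.
  by rewrite lee_fin mulr_ge0.
- by apply: integral_ge0 => w _; rewrite lee_fin mulr_ge0.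
rewrite -addeA leeD2l// integral_tilt_step -ge0_integral_EFinMl//; last 2 first.
- by move=> w; rewrite mulr_ge0.
- exact: measurable_funM.
rewrite -ge0_integralD//; last 4 first.
- by move=> w _; rewrite lee_fin mulr_ge0// mulr_ge0.
- by apply/measurable_EFinP; do !apply: measurable_funM.
- by move=> w _; rewrite lee_fin mulr_ge0 ?expR_ge0.
- apply/measurable_EFinP; apply: measurable_funM => //.
  by apply: measurableT_comp => //; apply: measurable_funM.
apply: ge0_le_integral => //.
- by move=> w _; rewrite -EFinD lee_fin addr_ge0// mulr_ge0 ?expR_ge0// mulr_ge0.
- apply/measurable_EFinP; apply: measurable_funD.
    by do !apply: measurable_funM.
  apply: measurable_funM => //.
  by apply: measurableT_comp => //; apply: measurable_funM.
- exact/measurable_EFinP.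
move=> w _; rewrite -EFinD lee_fin; set q := p _ _ _.
have q0 : 0 <= q by exact: p0.
have q1 : q <= 1 by exact: (power_le1 bandit).
(* As [q <= 1], [1 / (1 + c q)] leaves room for the loss [q c / (1 + c)]; this fixes [kap]. *)
have e1 : expR (- c * q) <= (1 + c * q)^-1.
  rewrite mulNr expRN lef_pV2 ?posrE ?expR_gt0 ?expR_ge1Dx//.
  by rewrite ltr_wpDr// mulr_ge0// ltW.
have e2 : kap * q + (1 + c * q)^-1 <= 1.
  rewrite /kap.
  have cq : 0 <= c * q by rewrite mulr_ge0// ltW.
  have cq1 : c * q <= c by rewrite ler_piMr// ltW.
  rewrite -subr_ge0 (_ : _ - _ = c * q * (c - c * q) / ((1 + c) * (1 + c * q))).
    by rewrite divr_ge0// !mulr_ge0//; lra.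
  by field; apply/andP; split; apply: lt0r_neq0; lra.
rewrite mulrA [tilt c l1 l2 T k w * _]mulrC -mulrDl ler_piMl//.
by apply: le_trans e2; rewrite lerD2l.
Qed.

(** Each round multiplies the integral by the Laplace transform of [sigma2] times a standard
    exponential variable, however the power was chosen. *)
Lemma integral_energy (th : R) t k : th * sigma2 k < 1 ->
  (\int[P]_w (expR (th * noise_energy t k w))%:E = ((1 - th * sigma2 k) ^- t)%:E)%E.
Proof.
move=> th1; elim: t => [|t IH].
  under eq_integral do rewrite /noise_energy energy0 mulr0 expR0.
  by rewrite integral_cst//= probability_setT mule1 expr0 invr1.
have pos : {ae P, forall w, 0 < p t.+1 k w}.
  by have := power_gt0_ae K2 bandit wts; apply: filterS => w; apply.
have mW : measurable_fun setT (noise_energy t k : past t.+1 -> R) by exact: measurable_noise_energy.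
have mH : measurable_fun setT (fun w : past t.+1 => expR (th * noise_energy t k w)).
  by apply: measurableT_comp => //; apply: measurable_funM.
have H0 (w : Omega) : 0 <= expR (th * noise_energy t k w) by exact: expR_ge0.
have a1 (w : Omega) : (fun=> th : R) w * sigma2 k < 1 by [].
have step := integral_step sigma2_gt0 bandit (isT : (1 <= t.+1)%N) mH H0
  (measurable_cst th) a1 (measurable_cst (0 : R)) (measurable_cst (0 : R)) pos.
transitivity (\int[P]_w (expR (th * noise_energy t k w) * expR (p t.+1 k w *
    (th * (noise1 X mu t.+1 k w ^+ 2 + noise2 X mu t.+1 k w ^+ 2) +
    (0 * noise1 X mu t.+1 k w + 0 * noise2 X mu t.+1 k w))))%:E)%E.
  apply: eq_integral => w _; congr EFin; rewrite -expRD; congr expR.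
  by rewrite /noise_energy energyS /noise1 /noise2; ring.
rewrite step; transitivity (\int[P]_w (expR (th * noise_energy t k w) * (1 - th * sigma2 k)^-1)%:E)%E.
  apply: eq_integral => w _; congr EFin; congr (_ * _).
  by rewrite /= expr0n /= addr0 mulr0 !mul0r expR0 mulr1.
rewrite ge0_integral_EFinMr//; last 2 first.
- exact: measurable_past bandit _ _ _ _ mH.
- by rewrite invr_ge0 subr_ge0 ltW.
by rewrite IH -EFinM -invfM -exprSr.
Qed.

Lemma measurable_scatter_term (th : R) t k : (1 <= t)%N ->
  measurable_fun setT (fun w => expR (- th * scatter p X t k w) / N t k w).
Proof.
move=> t1; apply: (@measurable_past _ _ _ _ _ _ _ _ _ bandit t.+1).
apply: measurable_funM.
  apply: measurableT_comp => //; apply: measurable_funM => //.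
  by apply: measurable_scatter; lia.
apply: (measurableT_comp measurable_invr).
by apply: measurable_power_sum; lia.
Qed.

(* Only the fraction [r = N_(t-1) / N_t] of the new noise energy enters the
   scatter. Dividing by [N_t] makes up for it, since
   [r / (1 + th sigma2 r) <= 1 / (1 + th sigma2)]. *)
Lemma integral_scatter (th : R) t k : 0 < th ->
  (\int[P]_w (expR (- th * scatter p X t.+1 k w) / N t.+1 k w)%:E <=
   (K%:R / (1 + th * sigma2 k) ^+ t)%:E)%E.
Proof.
move=> th0; have s20 := sigma2_gt0 k.
have N0 s w : (1 <= s)%N -> 0 < N s k w by exact: (power_sum_gt0 K2 bandit wts).
have phi0 : 0 < th * sigma2 k by exact: mulr_gt0.
elim: t => [|t IH].
  (* In round 1 the total power is [1 / K], whence the constant [K], and the exponential is at most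
     1. *)
  rewrite expr0 divr1; apply: (@le_trans _ _ (\int[P]_w (K%:R : R)%:E)%E); last first.
    by rewrite integral_cst//= probability_setT mule1.
  apply: ge0_le_integral => //.
  - by move=> w _; rewrite lee_fin divr_ge0 ?expR_ge0// ltW// N0.
  - by apply/measurable_EFinP; exact: measurable_scatter_term.
  move=> w _; rewrite lee_fin ler_pdivrMr ?N0//.
  have -> : N 1 k w = K%:R^-1.
    by rewrite /power_sum total_powerS total_power0 add0r (power_first wts).
  rewrite divff ?pnatr_eq0; last by lia.
  rewrite expR_le1 mulNr oppr_le0 mulr_ge0 ?(ltW th0)//.
  rewrite /scatter /wscatter big_nat_cond; apply: sumr_ge0 => l.
  rewrite andbT => /andP[l1 _].
  by rewrite mulr_ge0 ?sqr_ge0// (power_ge0 bandit).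
have pos : {ae P, forall w, 0 < p t.+2 k w}.
  by have := power_gt0_ae K2 bandit wts; apply: filterS => w; apply.
pose r w := N t.+1 k w / N t.+2 k w.
pose b1 w := mean_error1 t.+1 k w / N t.+1 k w.
pose b2 w := mean_error2 t.+1 k w / N t.+1 k w.
(* The new energy is centred at the old weighted mean, at offset [b] from the true one. Expanding
   the square, the part in [|b|^2] is known beforehand and goes into [H]; the cross terms give the
   slopes [c1] and [c2]. *)
pose H w := expR (- th * scatter p X t.+1 k w) / N t.+2 k w *
  expR (- th * r w * p t.+2 k w * (b1 w ^+ 2 + b2 w ^+ 2)).
have mNV s : (s <= t.+2)%N -> measurable_fun setT (fun w : past t.+2 => (N s k w)^-1).
  by move=> st; apply: (measurableT_comp measurable_invr); exact: measurable_power_sum.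
have mr : measurable_fun setT (r : past t.+2 -> R).
  apply: measurable_funM; last exact: mNV.
  by apply: measurable_power_sum; lia.
have mb1 : measurable_fun setT (b1 : past t.+2 -> R).
  by apply: measurable_funM; [apply: measurable_mean_error1|apply: mNV]; lia.
have mb2 : measurable_fun setT (b2 : past t.+2 -> R).
  by apply: measurable_funM; [apply: measurable_mean_error2|apply: mNV]; lia.
have mp : measurable_fun setT (p t.+2 k : past t.+2 -> R).
  exact: (measurable_power_past bandit k (isT : (1 <= t.+2)%N)).
have mS : measurable_fun setT (scatter p X t.+1 k : past t.+2 -> R).
  by apply: measurable_scatter; lia.
have mH : measurable_fun setT (H : past t.+2 -> R).
  apply: measurable_funM.
    apply: measurable_funM; last exact: mNV.
    by apply: measurableT_comp => //; exact: measurable_funM.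
  apply: measurableT_comp => //; apply: measurable_funM.
    by do !apply: measurable_funM => //.
  by apply: measurable_funD; exact: measurable_funX.
have H0 w : 0 <= H w.
  by rewrite mulr_ge0 ?expR_ge0// divr_ge0 ?expR_ge0// ltW// N0.
have r0 w : 0 < r w by rewrite divr_gt0// N0.
pose a w := - th * r w.
have ma : measurable_fun setT (a : past t.+2 -> R) by exact: measurable_funM.
have a1 w : a w * sigma2 k < 1.
  rewrite /a mulNr mulNr (@lt_trans _ _ 0)// oppr_lt0.
  by rewrite mulrAC mulr_gt0.
pose c1 w := 2 * th * r w * b1 w.
pose c2 w := 2 * th * r w * b2 w.
have mc1 : measurable_fun setT (c1 : past t.+2 -> R).
  by do !apply: measurable_funM => //.
have mc2 : measurable_fun setT (c2 : past t.+2 -> R).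
  by do !apply: measurable_funM => //.
have step := integral_step sigma2_gt0 bandit (isT : (1 <= t.+2)%N) mH H0 ma a1 mc1 mc2 pos.
rewrite (_ : \int[P]_w _ = \int[P]_w (H w * expR (p t.+2 k w *
    (a w * (noise1 X mu t.+2 k w ^+ 2 + noise2 X mu t.+2 k w ^+ 2) +
    (c1 w * noise1 X mu t.+2 k w + c2 w * noise2 X mu t.+2 k w))))%:E)%E; last first.
  apply: eq_integral => w _; congr EFin.
  rewrite /H -[RHS]mulrA -expRD [RHS]mulrAC -expRD; congr (expR _ / _).
  rewrite /scatter (@wscatterS _ _ _ (mu k)); last 2 first.
  - exact: N0.
  - exact: (power_ge0 bandit).
  rewrite -/(power_sum p t.+1 k w) -total_powerS -/(power_sum p t.+2 k w) -/(r w).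
  rewrite -/(mean_error1 t.+1 k w) -/(mean_error2 t.+1 k w) -/(b1 w) -/(b2 w) /a /c1 /c2.
  rewrite -/(noise1 X mu t.+2 k w) -/(noise2 X mu t.+2 k w).
  by ring.
rewrite step; apply: (@le_trans _ _ (\int[P]_w
    (expR (- th * scatter p X t.+1 k w) / N t.+1 k w * (1 + th * sigma2 k)^-1)%:E)%E).
  apply: ge0_le_integral => //.
  - move=> w _; rewrite lee_fin mulr_ge0// mulr_ge0 ?expR_ge0//.
    by rewrite invr_ge0 subr_ge0 ltW.
  - apply/measurable_EFinP; apply: (@measurable_past _ _ _ _ _ _ _ _ _ bandit t.+2).
    have m1a : measurable_fun setT (fun w : past t.+2 => 1 - a w * sigma2 k).
      by apply: measurable_funB => //; exact: measurable_funM.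
    apply: measurable_funM => //; apply: measurable_funM.
      exact: (measurableT_comp measurable_invr m1a).
    apply: measurableT_comp => //; apply: measurable_funM.
      apply: measurable_funM => //; apply: measurable_funM => //.
      by apply: measurable_funD; exact: measurable_funX.
    by apply: (measurableT_comp measurable_invr); exact: measurable_funM.
  - apply/measurable_EFinP; apply: measurable_funM => //.
    exact: measurable_scatter_term.
  move=> w _; rewrite lee_fin.
  have NE : N t.+2 k w = N t.+1 k w + p t.+2 k w by rewrite /power_sum total_powerS.
  have p0 : 0 <= p t.+2 k w by exact: (power_ge0 bandit).
  have n0 : 0 < N t.+1 k w by exact: N0.
  have n0' : 0 < N t.+2 k w by exact: N0.
  set b := b1 w ^+ 2 + b2 w ^+ 2; have b0 : 0 <= b by rewrite addr_ge0 ?sqr_ge0.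
  have phir : 0 < th * sigma2 k * r w by rewrite mulr_gt0.
  have q1 : 0 < 1 + th * sigma2 k * r w by lra.
  have -> : 1 - a w * sigma2 k = 1 + th * sigma2 k * r w by rewrite /a; ring.
  have -> : c1 w ^+ 2 + c2 w ^+ 2 = 4 * th ^+ 2 * r w ^+ 2 * b.
    by rewrite /c1 /c2 /b; ring.
  (* The offset can only help: integrating the cross terms returns the fraction
     [th sigma2 r / (1 + th sigma2 r) < 1] of what the term in [|b|^2] removes. *)
  have gain : - th * r w * p t.+2 k w * b + p t.+2 k w * (4 * th ^+ 2 * r w ^+ 2 * b) *
      sigma2 k / (4 * (1 + th * sigma2 k * r w)) <= 0.
    rewrite (_ : _ + _ = - (th * r w * p t.+2 k w * b / (1 + th * sigma2 k * r w))).
      by rewrite oppr_le0 divr_ge0 ?(ltW q1)// mulr_ge0// mulr_ge0// mulr_ge0// ltW.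
    by field; rewrite gt_eqF.
  apply: (@le_trans _ _ (expR (- th * scatter p X t.+1 k w) *
      ((N t.+2 k w)^-1 * (1 + th * sigma2 k * r w)^-1))).
    rewrite -expR_le1 expRD in gain; rewrite /H -/b.
    rewrite [leLHS](_ : _ = expR (- th * scatter p X t.+1 k w) *
      ((N t.+2 k w)^-1 * (1 + th * sigma2 k * r w)^-1) *
      (expR (- th * r w * p t.+2 k w * b) * expR (p t.+2 k w *
        (4 * th ^+ 2 * r w ^+ 2 * b) * sigma2 k / (4 * (1 + th * sigma2 k * r w))))).
      rewrite ler_piMr// mulr_ge0 ?expR_ge0// mulr_ge0// invr_ge0 ltW//.
    by rewrite -!mulrA; congr (_ * (_ * _)); rewrite mulrCA.
  rewrite -[leRHS]mulrA ler_wpM2l ?expR_ge0// -!invfM lef_pV2 ?posrE ?mulr_gt0//; last by lra.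
  have -> : N t.+2 k w * (1 + th * sigma2 k * r w) = N t.+2 k w + th * sigma2 k * N t.+1 k w.
    by rewrite /r; field; rewrite gt_eqF.
  by rewrite NE; lra.
rewrite ge0_integral_EFinMr//; last 3 first.
- by move=> w; rewrite divr_ge0 ?expR_ge0// ltW// N0.
- exact: measurable_scatter_term.
- by rewrite invr_ge0; lra.
apply: le_trans (lee_wpmul2r _ IH) _; first by rewrite lee_fin invr_ge0; lra.
by rewrite -EFinM -mulrA -invfM -exprSr.
Qed.

End supermartingales.

(** * Posterior tails of a suboptimal arm *)

Section exponential_bounds.
Context {R : realType}.
Implicit Types z : R.

(** Because [1 / (1 + z) = 1 - z / (1 + z)]. *)
Lemma inv_pow_le_expR z a : 0 <= z ->
  (1 + z) ^- a <= expR (- (a%:R * (z / (1 + z)))).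
Proof.
move=> z0; have z1 : 0 < 1 + z by lra.
rewrite -mulrN expRM_natl -exprVn lerXn2r ?nnegrE ?expR_ge0 ?invr_ge0 ?(ltW z1)//.
apply: le_trans (expR_ge1Dx _); rewrite (_ : _ - _ = (1 + z)^-1)//.
by field; rewrite gt_eqF.
Qed.

Lemma expR_le_inv_pow z a : 0 <= z -> expR (- (a%:R * z)) <= (1 + z) ^- a.
Proof.
move=> z0; rewrite expRN lef_pV2 ?posrE ?expR_gt0 ?exprn_gt0//; last by lra.
by rewrite expRM_natl lerXn2r ?nnegrE ?expR_ge0 ?expR_ge1Dx//; lra.
Qed.

End exponential_bounds.

Section student_bounds.
Context {R : realType}.
Variables (n : nat) (al : R) (c : (R * R)%type).
Hypothesis n1 : (1 < n)%N.
Hypothesis al0 : 0 < al.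
Local Notation law B := (fine (law_of_density (student_pdf n al c) B)).

(** With [b = n %/ (2 j)] in [law_student_ub], a fraction at most [1 / j] of the exponent is given
    up for integrability, and the prefactor is at most [4 pi j], uniformly in [n]. *)
Lemma student_tail j rho (B : set (R * R)%type) :
  (0 < j)%N -> (2 * j <= n)%N -> 0 <= rho -> measurable B ->
  (forall m, B m -> rho <= enorm (m - c)) ->
  law B <= 4 * pi * j%:R *
    expR (- ((1 - j%:R^-1) * n%:R * (al * rho ^+ 2 / (1 + al * rho ^+ 2)))).
Proof.
move=> j0 jn rho0 mB Brho; pose b := (n %/ (2 * j))%N; pose a := (n - 2 * b)%N.
have jR : 0 < j%:R :> R by rewrite ltr0n.
have b0 : (0 < b)%N by rewrite divn_gt0//; lia.
have bn : (b * (2 * j) <= n)%N by exact: leq_divM.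
have nE : n = (a + 2 * b)%N by rewrite /a; nia.
have nb : (n <= 4 * j * b)%N by have := ltn_ceil n (_ : (0 < 2 * j)%N); rewrite -/b; nia.
set z := al * rho ^+ 2; have z0 : 0 <= z by rewrite mulr_ge0 ?sqr_ge0// ltW.
rewrite -lee_fin -fine_law_student//.
apply: le_trans (law_student_ub al0 n1 nE b0 rho0 mB Brho) _; rewrite lee_fin -/z.
have an : (1 - j%:R^-1) * n%:R <= a%:R :> R.
  rewrite mulrBl mul1r lerBlDr {1}nE natrD lerD2l.
  rewrite mulrC ler_pdivlMr// -natrM ler_nat; lia.
have zz : 0 <= z / (1 + z) by rewrite divr_ge0//; lra.
apply: ler_pM.
- by rewrite divr_ge0// mulr_ge0 ?pi_ge0// subr_ge0 ler1n ltnW.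
- by rewrite invr_ge0 exprn_ge0//; lra.
- rewrite ler_pdivrMr ?ltr0n// mulrAC [4 * pi]mulrC -!mulrA ler_pM2l ?pi_gt0//.
  rewrite lerBlDr -!natrM natr1 ler_nat; nia.
- apply: le_trans (inv_pow_le_expR _ z0) _.
  by rewrite ler_expR lerN2 ler_wpM2r.
Qed.

(* Unit vector along [c]; any direction will do when [c = 0]. *)
Let dir : (R * R)%type :=
  if enorm c == 0 then (1, 0) else (c.1 / enorm c, c.2 / enorm c).

Let dir_sqr : dir.1 ^+ 2 + dir.2 ^+ 2 = 1.
Proof.
rewrite /dir; case: eqVneq => [_|c0] /=; first by rewrite expr1n expr0n addr0.
by rewrite !expr_div_n -mulrDl -enorm_sqr divff// sqrf_eq0.
Qed.

Let cE : c = (enorm c * dir.1, enorm c * dir.2).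
Proof.
rewrite /dir; case: eqVneq => [c0|c0] /=.
  have h := enorm_sqr c; rewrite c0 expr0n /= in h.
  rewrite c0 !mul0r; move/esym/eqP : h; rewrite paddr_eq0 ?sqr_ge0//.
  by rewrite !sqrf_eq0 => /andP[/eqP h1 /eqP h2]; case: (c) h1 h2 => ? ? /= -> ->.
by rewrite ![enorm c * _]mulrC !divfK//; case: (c).
Qed.

Lemma enorm_scale (b : R) (v : (R * R)%type) : 0 <= b ->
  enorm (b * v.1, b * v.2) = b * enorm v.
Proof.
move=> b0; rewrite /enorm /= !exprMn -mulrDr sqrtrM ?sqr_ge0//.
by rewrite sqrtr_sqr ger0_norm.
Qed.

(** A square of side [e] is placed on the ray through [c], around the point of norm
    [|c| + D0 + 2 e]. Its points are within [e] of that point, so their norms exceed [y] and their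
    distances to [c] are at most [D0 + 3 e]. *)
Lemma student_outside_ge y e : 0 < e ->
  e ^+ 2 * ((n%:R - 1) * al / pi) *
    expR (- (n%:R * (al * (Num.max (y - enorm c) 0 + 3 * e) ^+ 2))) <=
  law (outside y).
Proof.
move=> e0; set D0 := Num.max _ _; set D := D0 + 3 * e.
have D00 : 0 <= D0 by rewrite le_max lexx orbT.
have D0y : y - enorm c <= D0 by rewrite le_max lexx.
pose ctr : (R * R)%type := ((enorm c + (D0 + 2 * e)) * dir.1, (enorm c + (D0 + 2 * e)) * dir.2).
have dir1 : enorm dir = 1 by rewrite /enorm dir_sqr sqrtr1.
have ctrN : enorm ctr = enorm c + (D0 + 2 * e).
  by rewrite /ctr enorm_scale ?dir1 ?mulr1// addr_ge0 ?enorm_ge0//; lra.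
have ctrc : enorm (ctr - c) = D0 + 2 * e.
  rewrite (_ : ctr - c = ((D0 + 2 * e) * dir.1, (D0 + 2 * e) * dir.2)).
    by rewrite enorm_scale ?dir1 ?mulr1//; lra.
  by rewrite {1}cE /ctr; congr (_, _) => /=; ring.
clearbody ctr.
have base : 0 <= (n%:R - 1) * al / pi.
  by rewrite divr_ge0 ?pi_ge0// mulr_ge0 ?(ltW al0)// subr_ge0 ler1n ltnW.
apply: (@le_trans _ _ (e ^+ 2 * ((n%:R - 1) * al / pi * (1 + al * D ^+ 2) ^- n))).
  rewrite -mulrA ler_wpM2l ?sqr_ge0// ler_wpM2l//.
  by apply: expR_le_inv_pow; rewrite mulr_ge0 ?sqr_ge0// ltW.
rewrite -lee_fin -fine_law_student//; last exact: measurable_outside.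
apply: (law_student_lb al0 n1 (u := (ctr.1 - e / 2, ctr.2 - e / 2))); first exact: ltW.
  exact: measurable_outside.
move=> m /= /andP[m11 m12] /andP[m21 m22].
have mctr : enorm (m - ctr) <= e.
  apply: le_trans (enorm_le_norm1 _) _ => /=.
  have h1 : `|m.1 - ctr.1| <= e / 2 by rewrite ler_norml; apply/andP; split; lra.
  have h2 : `|m.2 - ctr.2| <= e / 2 by rewrite ler_norml; apply/andP; split; lra.
  by lra.
split; last first.
  rewrite (_ : m - c = (m - ctr) + (ctr - c)); last by rewrite addrA subrK.
  by apply: le_trans (enormD _ _) _; rewrite ctrc /D; lra.
rewrite /outside /=; have := enormBD ctr m.
by rewrite enormB ctrN; lra.
Qed.

End student_bounds.

Section arm_tail.
Context {R : realType}.

(** The losses in [arm_tail] with [u = 1 / j]: one factor [1 + u] from the scatter and one from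
    [z / (1 + z)]; two factors [1 - u] from the squared distance, one from the exponent kept in
    [student_tail], one from [t - 1] in place of [t]. The condition is
    [1 + 3 u <= (1 + xi) (1 - 4 u)] rearranged. *)
Lemma slack_poly (u xi : R) : 0 <= u -> 0 <= xi -> u * (7 + 4 * xi) <= xi ->
  (1 + u) ^+ 2 <= (1 + xi) * (1 - u) ^+ 4.
Proof.
move=> u0 xi0 uxi; have u1 : 4 * u <= 1 by nra.
have h1 : 1 - 4 * u <= (1 - u) ^+ 4.
  rewrite -subr_ge0 (_ : _ - _ = u ^+ 2 * (6 - 4 * u + u ^+ 2)); last by ring.
  by rewrite mulr_ge0 ?sqr_ge0// addr_ge0 ?sqr_ge0//; lra.
apply: (@le_trans _ _ (1 + 3 * u)).
  rewrite -subr_ge0 (_ : _ - _ = u * (1 - u)); last by ring.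
  by rewrite mulr_ge0//; lra.
apply: (@le_trans _ _ ((1 + xi) * (1 - 4 * u))); first by nra.
by rewrite ler_wpM2l//; lra.
Qed.

Lemma le_ratio1D (a b : R) : 0 <= a -> a <= b -> a / (1 + a) <= b / (1 + b).
Proof.
move=> a0 ab; rewrite ler_pdivrMr; last by lra.
by rewrite mulrAC ler_pdivlMr; lra.
Qed.

(* The student tail has the exponent [n z / (1 + z)] with [z >= beta / t]. It
   exceeds [x] if [beta <= t / j], and is linear in [t] otherwise. *)
Lemma arm_tail (j t : nat) (xi s gap x N S : R) (m0 c : (R * R)%type) :
  (2 <= j)%N -> (2 * j < t)%N -> 0 <= xi -> j%:R^-1 * (7 + 4 * xi) <= xi ->
  0 < s -> 0 < gap -> 0 <= x ->
  (1 + xi) * (s / gap ^+ 2) * x <= N -> 0 < N ->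
  0 < S -> S <= (1 + j%:R^-1) * s * t%:R ->
  enorm (c - m0) <= gap * j%:R^-1 / 2 ->
  fine (law_of_density (student_pdf t.-1 (N / S) c)
    (outside (enorm m0 + gap - gap * j%:R^-1 / 2))) <=
  4 * pi * j%:R * (expR (- x) +
    expR (- ((1 - j%:R^-1) / (j%:R + 1) * t.-1%:R))).
Proof.
move=> j2 jt.
have [j0 t0 n1 jt' jn] : [/\ (0 < j)%N, (0 < t)%N, (1 < t.-1)%N, (j <= t)%N & (2 * j <= t.-1)%N].
  by split; lia.
move=> xi0 uxi s0 gap0 x0 LN N0 S0 Sle cm.
set u := j%:R^-1 in uxi Sle cm *.
have jR : 0 < j%:R :> R by rewrite ltr0n.
have u0 : 0 < u by rewrite invr_gt0.
have ju : j%:R * u = 1 by rewrite divff// gt_eqF.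
have u1 : u <= 2^-1 by rewrite lef_pV2 ?posrE// ler_nat.
have tR : 0 < t%:R :> R by rewrite ltr0n.
have tE : t.-1%:R = t%:R - 1 :> R by rewrite -subn1 natrB.
have jtR : j%:R <= t%:R :> R by rewrite ler_nat.
have xi1 : 0 <= 1 + xi by rewrite addr_ge0.
have u2 : 0 <= 1 - u by clear -u1; lra.
set rho := gap * (1 - u).
have rho0 : 0 <= rho by rewrite mulr_ge0// ltW.
have al0 : 0 < N / S by rewrite divr_gt0.
apply: le_trans (student_tail n1 al0 (j := j) (rho := rho) _ _ rho0 _ _) _ => //.
- exact: measurable_outside.
- move=> m /= ym; have := enormBD m c; have := enormBD c m0.
  by rewrite /outside /= in ym; rewrite /rho; lra.
rewrite ler_wpM2l//; first by rewrite mulr_ge0 ?ler0n// mulr_ge0// pi_ge0.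
set z := N / S * rho ^+ 2.
pose beta := (1 + xi) * (1 - u) ^+ 2 * x / (1 + u).
have u11 : 0 < 1 + u by lra.
have beta0 : 0 <= beta by rewrite divr_ge0 ?(ltW u11)// mulr_ge0// mulr_ge0// sqr_ge0.
have zbeta : beta / t%:R <= z.
  have NS : (1 + xi) * (s / gap ^+ 2) * x / ((1 + u) * s * t%:R) <= N / S.
    rewrite ler_pdivlMr// mulrAC ler_pdivrMr; last by rewrite !mulr_gt0.
    rewrite -/u in Sle; apply: ler_pM => //.
    - exact: mulr_ge0 (mulr_ge0 xi1 (divr_ge0 (ltW s0) (sqr_ge0 _))) x0.
    - exact: ltW.
  rewrite (_ : beta / t%:R = (1 + xi) * (s / gap ^+ 2) * x / ((1 + u) * s * t%:R) * rho ^+ 2).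
    by rewrite ler_wpM2r// sqr_ge0.
  by rewrite /beta /rho; field; rewrite !gt_eqF.
have zz : beta / (t%:R + beta) <= z / (1 + z).
  rewrite (_ : beta / (t%:R + beta) = (beta / t%:R) / (1 + beta / t%:R)).
    by apply: le_ratio1D => //; rewrite divr_ge0// ltW.
  by field; rewrite !gt_eqF//; lra.
have tb : 0 < t%:R + beta by lra.
have n0 : 0 <= (1 - u) * t.-1%:R :> R by rewrite mulr_ge0 ?ler0n.
have [jb|jb] := leP (j%:R * beta) t%:R.
  apply: (@le_trans _ _ (expR (- x))); last by rewrite lerDl expR_ge0.
  rewrite ler_expR lerN2; apply: le_trans (ler_wpM2l n0 zz).
  have h : beta / (t%:R * (1 + u)) <= beta / (t%:R + beta).
    rewrite ler_wpM2l// lef_pV2 ?posrE ?mulr_gt0//.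
    have : u * (j%:R * beta) <= u * t%:R by rewrite ler_wpM2l// ltW.
    by rewrite mulrA [u * _]mulrC ju mul1r; lra.
  apply: le_trans (ler_wpM2l n0 h).
  have h2 : (1 - u) * t%:R <= t.-1%:R.
    rewrite tE; have : u * j%:R <= u * t%:R by rewrite ler_wpM2l// ltW.
    by rewrite mulrC ju; lra.
  apply: (@le_trans _ _ ((1 - u) * ((1 - u) * t%:R) * (beta / (t%:R * (1 + u))))); last first.
    rewrite ler_wpM2r ?ler_wpM2l//.
    by rewrite divr_ge0// mulr_ge0// ltW.
  rewrite (_ : _ * (beta / _) = x * ((1 + xi) * (1 - u) ^+ 4 / (1 + u) ^+ 2)); last first.
    by rewrite /beta; field; rewrite !gt_eqF.
  rewrite ler_peMr// ler_pdivlMr ?exprn_gt0// mul1r.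
  exact: slack_poly (ltW u0) xi0 uxi.
apply: (@le_trans _ _ (expR (- ((1 - u) / (j%:R + 1) * t.-1%:R)))); last first.
  by rewrite lerDr expR_ge0.
rewrite ler_expR lerN2; apply: le_trans (ler_wpM2l n0 zz).
rewrite mulrAC ler_wpM2l//.
rewrite -[leLHS]mul1r ler_pdivrMr; last by lra.
by rewrite mulrAC ler_pdivlMr//; nra.
Qed.

End arm_tail.

(** * Posterior odds of the best arm *)

Section odds.
Context {R : realType}.
Variables (s v delta : R) (m0 : (R * R)%type).
Hypotheses (s0 : 0 < s) (v0 : 0 < v) (delta0 : 0 < delta).
(** Variables with equations, so that [lra] and [field] see atoms. [eta] is the tolerated relative
    error of the scatter, with [eta ell = delta / 8]; [kap N] bounds [t N / S]; [e] is the side of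
    the square used to bound the outer mass from below; [g] is the grid step of the tilts; [cA] and
    [cB] are the discounts of the far and near cases; [C1] is the common prefactor. *)
Variables ell y eta kap cA e g cB C1 : R.
Hypotheses (ellE : ell = enorm m0) (delta_ell : delta <= ell).
Hypotheses (yE : y = ell - delta) (etaE : eta = delta / (8 * ell)).
Hypotheses (kapE : kap = ((1 - eta) * s)^-1)
  (cAE : cA = delta ^+ 2 / (64 * s * (1 + kap * delta ^+ 2 / 4)))
  (eE : e = Num.min (delta / 12) (cA / (kap * delta)))
  (gE : g = delta / (3 * s)) (cBE : cB = delta ^+ 2 / (32 * s))
  (C1E : C1 = 8 * pi / (e ^+ 2 * (v / (4 * s * pi)))).

Let ell0 : 0 < ell. Proof. exact: lt_le_trans delta_ell. Qed.

Let eta0 : 0 < eta. Proof. by rewrite etaE divr_gt0// mulr_gt0. Qed.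

Let eta_ell : eta * ell = delta / 8.
Proof. by rewrite etaE; field; rewrite gt_eqF. Qed.

Let eta1 : eta <= 1 / 8.
Proof. by have h := delta_ell; rewrite etaE ler_pdivrMr ?mulr_gt0//; lra. Qed.

Let kap0 : 0 < kap. Proof. by have h := eta1; rewrite kapE invr_gt0 mulr_gt0//; lra. Qed.

Let cA0 : 0 < cA.
Proof.
rewrite cAE divr_gt0 ?exprn_gt0// mulr_gt0// ?mulr_gt0//.
by rewrite ltr_wpDr// divr_ge0// mulr_ge0 ?sqr_ge0// ltW.
Qed.

Let cB0 : 0 < cB. Proof. by rewrite cBE divr_gt0 ?exprn_gt0// mulr_gt0. Qed.

Let e0 : 0 < e.
Proof. by rewrite eE lt_min !divr_gt0// mulr_gt0. Qed.

Let e_delta : e <= delta / 12. Proof. by rewrite eE ge_min lexx. Qed.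

(** The square reaches up to [3 e] from [c]; [e] is small enough for this to cost only half of the
    decay [2 cA] of the inner mass. *)
Let e_kap : 9 * kap * e ^+ 2 <= cA.
Proof.
have h : e <= cA / (kap * delta) by rewrite eE ge_min lexx orbT.
have d0 := delta0; have {}h : e * (kap * delta) <= cA by rewrite -ler_pdivlMr// mulr_gt0.
apply: le_trans h; rewrite (_ : 9 * kap * e ^+ 2 = e * kap * (9 * e)); last by ring.
by rewrite [leRHS]mulrA ler_pM2l ?mulr_gt0//; have := e_delta; lra.
Qed.

Let C10 : 0 < C1.
Proof.
rewrite C1E divr_gt0//; first by rewrite mulr_gt0 ?pi_gt0.
by rewrite mulr_gt0 ?exprn_gt0// divr_gt0// mulr_gt0 ?pi_gt0// mulr_gt0.
Qed.

Section fixed_round.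
Variables (t : nat) (N S : R) (c : (R * R)%type).
Hypotheses (t5 : (5 <= t)%N) (vN : v <= N) (Nt : N <= t%:R).
Hypotheses (S_ge : (1 - eta) * s * t%:R <= S) (S_le : S <= (1 + eta) * s * t%:R).
Local Notation law B := (fine (law_of_density (student_pdf t.-1 (N / S) c) B)).

Let tR : 0 < t%:R :> R. Proof. by rewrite ltr0n; exact: leq_trans t5. Qed.
Let t5R : 5 <= t%:R :> R. Proof. by rewrite ler_nat. Qed.
Let tE : t.-1%:R = t%:R - 1 :> R. Proof. by rewrite -subn1 natrB//; exact: leq_trans t5. Qed.
Let N0 : 0 < N. Proof. exact: lt_le_trans vN. Qed.
Let S0 : 0 < S.
Proof. by have h := eta1; apply: lt_le_trans S_ge; rewrite !mulr_gt0//; lra. Qed.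
Let al0 : 0 < N / S. Proof. exact: divr_gt0. Qed.
Let n1 : (1 < t.-1)%N. Proof. by rewrite ltn_predRL; exact: leq_trans t5. Qed.

(** Turns an exponent depending on [t] into a multiple of the clock [N]. *)
Let t_al : t%:R * (N / S) <= kap * N.
Proof.
rewrite mulrCA [kap * N]mulrC ler_pM2l// ler_pdivrMr// kapE mulrC ler_pdivlMr.
  by rewrite mulrC.
by have h := eta1; rewrite mulr_gt0//; lra.
Qed.

Let al_kap : N / S <= kap.
Proof.
rewrite -(ler_pM2l tR); apply: le_trans t_al _.
by rewrite mulrC ler_pM2r.
Qed.

Let t_al_ge : N / (2 * s) <= t%:R * (N / S).
Proof.
rewrite mulrCA ler_pM2l// ler_pdivlMr// mulrC ler_pdivrMr ?mulr_gt0//.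
have : (1 + eta) * s * t%:R <= 2 * s * t%:R.
  by rewrite ler_wpM2r ?(ltW tR)// ler_wpM2r ?(ltW s0)//; have := eta1; lra.
by have := S_le; lra.
Qed.

(** The prefactor [(n - 1) al] is [(t - 2) N / S], at least half of [t N / S], hence at least
    [v / (4 s)]. *)
Lemma student_outside_lb :
  e ^+ 2 * (v / (4 * s * pi)) *
    expR (- (kap * N * (Num.max (y - enorm c) 0 + 3 * e) ^+ 2)) <= law (outside y).
Proof.
apply: le_trans (student_outside_ge c n1 al0 y e0).
apply: ler_pM; [|exact: expR_ge0| |].
- by rewrite mulr_ge0 ?sqr_ge0// divr_ge0 ?(ltW v0)// mulr_ge0 ?pi_ge0// mulr_ge0// ltW.
- rewrite ler_wpM2l ?sqr_ge0// invfM mulrA ler_wpM2r ?invr_ge0 ?pi_ge0//.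
  apply: (@le_trans _ _ (N / (2 * s) / 2)).
    rewrite -[leRHS]mulrA -invfM (_ : 2 * s * 2 = 4 * s); last by ring.
    by rewrite ler_wpM2r// invr_ge0 mulr_ge0// ltW.
  apply: (@le_trans _ _ (t%:R * (N / S) / 2)); first by rewrite ler_pM2r.
  by rewrite mulrAC ler_wpM2r ?(ltW al0)// tE; have := t5R; lra.
rewrite ler_expR lerN2 mulrA ler_wpM2r ?sqr_ge0//.
by apply: le_trans t_al; rewrite ler_wpM2r ?(ltW al0)// tE; lra.
Qed.

(** The estimated norm is safely above the level, so the inner mass is a tail at distance
    [delta / 2]. As [N / S <= kap], the denominator [1 + z] of its exponent is at most
    [1 + kap delta^2 / 4], which is the origin of [cA]. *)
Lemma odds_far : y + delta / 2 <= enorm c ->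
  law (inside y) / law (outside y) <= C1 * expR (- (cA * N)).
Proof.
move=> yc; have lo := student_outside_lb.
have out0 := outside_law_gt0 (fun=> c) n1 (fun=> al0) (ord0 : 'I_1) y.
have d0 := delta0; have maxE : Num.max (y - enorm c) 0 = 0 by apply: max_r; lra.
rewrite maxE add0r in lo.
have li : law (inside y) <= 8 * pi * expR (- (2 * cA * N)).
  apply: le_trans (student_tail n1 al0 (j := 2) (rho := delta / 2) _ _ _ _ _) _ => //.
  - by rewrite ltn_predRL.
  - by rewrite divr_ge0// ltW.
  - exact: measurable_inside.
  - move=> m; rewrite /inside /= => my; have := enormBD c m; rewrite enormB; lra.
  rewrite (_ : 4 * pi * 2 = 8 * pi); last by lra.
  rewrite ler_wpM2l ?mulr_ge0 ?pi_ge0// ler_expR lerN2.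
  set z := N / S * _; have z0 : 0 <= z by rewrite mulr_ge0 ?sqr_ge0// ltW.
  have q0 : 0 < 1 + kap * delta ^+ 2 / 4.
    by rewrite ltr_wpDr// divr_ge0// mulr_ge0 ?sqr_ge0// ltW.
  have zq : z / (1 + kap * delta ^+ 2 / 4) <= z / (1 + z).
    rewrite ler_wpM2l// lef_pV2 ?posrE//; last by rewrite ltr_wpDr.
    rewrite lerD2l /z expr_div_n -[leRHS]mulrA (_ : 2 ^+ 2 = 4 :> R); last by ring.
    by rewrite ler_wpM2r// divr_ge0 ?sqr_ge0.
  apply: (@le_trans _ _ ((1 - 2^-1) * t.-1%:R * (z / (1 + kap * delta ^+ 2 / 4)))); last first.
    by rewrite ler_wpM2l// mulr_ge0 ?ler0n//; lra.
  rewrite cAE [leRHS]mulrA ler_pdivlMr//.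
  rewrite (_ : 2 * _ * _ * _ = N / (2 * s) * (delta ^+ 2 / 16)); last first.
    move: q0; move: (1 + kap * delta ^+ 2 / 4) => q q0.
    by field; rewrite !gt_eqF.
  apply: (@le_trans _ _ (t%:R * (N / S) * (delta ^+ 2 / 16))).
    by rewrite ler_wpM2r// divr_ge0 ?sqr_ge0.
  rewrite (_ : (1 - 2^-1) * _ * z = t.-1%:R * 2 * (N / S * (delta ^+ 2 / 16))); last first.
    by rewrite /z; field; rewrite gt_eqF.
  rewrite -[leLHS]mulrA; apply: ler_wpM2r.
    by rewrite mulr_ge0 ?(ltW al0)// divr_ge0 ?sqr_ge0.
  by rewrite tE; have := t5R; lra.
rewrite ler_pdivrMr//.
apply: le_trans li _; apply: le_trans (ler_wpM2l _ lo); last first.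
  by rewrite mulr_ge0 ?expR_ge0// ltW.
have b0 : 0 < e ^+ 2 * (v / (4 * s * pi)).
  by rewrite mulr_gt0 ?exprn_gt0// divr_gt0// mulr_gt0 ?pi_gt0// mulr_gt0.
rewrite C1E [leRHS]mulrACA divfK ?gt_eqF// ler_wpM2l//; first by rewrite mulr_ge0 ?pi_ge0.
rewrite -expRD ler_expR; have := e_kap => h.
have : 9 * kap * e ^+ 2 * N <= cA * N by rewrite ler_wpM2r// ltW.
rewrite (_ : kap * N * (3 * e) ^+ 2 = 9 * kap * e ^+ 2 * N); last by ring.
by lra.
Qed.

Let U1 := m0.1 / ell.
Let U2 := m0.2 / ell.

Lemma unit_sqr : U1 ^+ 2 + U2 ^+ 2 = 1.
Proof.
rewrite /U1 /U2 !expr_div_n -mulrDl -enorm_sqr -ellE divff// sqrf_eq0.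
by rewrite gt_eqF.
Qed.

(* The bound [exp (N (lam tau - lam^2 s / 4))] is maximal at [lam = 2 tau / s];
   rounding this value down to a multiple of [g] makes finitely many tilts
   suffice for all positions of [c]. *)
Lemma odds_near : enorm c < y + delta / 2 ->
  law (inside y) / law (outside y) <=
  C1 * \sum_(i < (Num.truncn (6 * ell / delta)).+1)
    expR (- (i%:R * g) * U1 * (N * (c.1 - m0.1))
          + (- (i%:R * g) * U2) * (N * (c.2 - m0.2))
          - (((- (i%:R * g) * U1) ^+ 2 + (- (i%:R * g) * U2) ^+ 2) * s / 4 + cB) * N).
Proof.
move=> yc; have lo := student_outside_lb.
have out0 := outside_law_gt0 (fun=> c) n1 (fun=> al0) (ord0 : 'I_1) y.
have b0 : 0 < e ^+ 2 * (v / (4 * s * pi)).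
  by rewrite mulr_gt0 ?exprn_gt0// divr_gt0// mulr_gt0 ?pi_gt0// mulr_gt0.
pose tau := ell - enorm c.
have tau_ge : delta / 2 <= tau by move: yc; rewrite yE /tau; lra.
have tau0 : 0 < tau by apply: lt_le_trans tau_ge; rewrite divr_gt0.
have tau_ell : tau <= ell by rewrite /tau gerBl enorm_ge0.
have g0 : 0 < g by rewrite gE divr_gt0// mulr_gt0.
pose i0 := Num.truncn (2 * tau / (s * g)).
have q0 : 0 <= 2 * tau / (s * g) by rewrite divr_ge0 ?mulr_ge0 ?(ltW tau0)// ltW// mulr_gt0.
have /andP[i0l i0u] : i0%:R <= 2 * tau / (s * g) < i0.+1%:R by exact: truncn_itv.
(* Since [tau <= ell], the index in the grid is bounded independently of [c]. *)
have i0I : (i0 < (Num.truncn (6 * ell / delta)).+1)%N.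
  rewrite ltnS; apply: le_truncn.
  rewrite gE (_ : 2 * tau / _ = 6 * tau / delta); last by field; rewrite !gt_eqF.
  by rewrite ler_pM2r ?invr_gt0// ler_pM2l.
rewrite ler_pdivrMr//.
have li : law (inside y) <= 2 * pi.
  rewrite -lee_fin -fine_law_student//; last exact: measurable_inside.
  by apply: law_student_le => //; exact: measurable_inside.
apply: le_trans li _.
rewrite (bigD1 (Ordinal i0I))//=; set rest := \sum_(i < _ | _) _.
have rest0 : 0 <= rest by apply: sumr_ge0 => i _; exact: expR_ge0.
have sg : 2 * tau / (s * g) = 2 * tau / s / g by field; rewrite !gt_eqF.
pose lam := i0%:R * g.
have lam0 : 0 <= lam by rewrite mulr_ge0 ?ler0n// ltW.
have lamu : lam <= 2 * tau / s.
  by rewrite /lam -ler_pdivlMr// -sg.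
have laml : 2 * tau / s - g <= lam.
  rewrite lerBlDr /lam -[X in _ <= _ + X]mul1r -mulrDl natr1 -ler_pdivrMr//.
  by rewrite -sg ltW.
set E := expR _.
(* Along the unit vector [U] of [m0], the error of the mean is at most [|c| - ell = - tau], by
   Cauchy-Schwarz. *)
have Ege : expR (N * (lam * tau - lam ^+ 2 * s / 4 - cB)) <= E.
  rewrite /E ler_expR -/lam.
  have -> : (- lam * U1) ^+ 2 + (- lam * U2) ^+ 2 = lam ^+ 2.
    by rewrite -[RHS]mulr1 -unit_sqr; ring.
  have cU : c.1 * U1 + c.2 * U2 <= enorm c.
    have := enorm_dot c (U1, U2); rewrite [enorm (_, _)]/enorm /= unit_sqr sqrtr1.
    by rewrite mulr1.
  have mU : m0.1 * U1 + m0.2 * U2 = ell.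
    rewrite /U1 /U2 !mulrA -mulrDl -!expr2 -enorm_sqr -ellE expr2 mulfK//.
    by rewrite gt_eqF.
  have cmU : (c.1 - m0.1) * U1 + (c.2 - m0.2) * U2 <= - tau.
    by move: cU mU; rewrite /tau; lra.
  have : N * lam * ((c.1 - m0.1) * U1 + (c.2 - m0.2) * U2) <= N * lam * - tau.
    by rewrite ler_wpM2l// mulr_ge0// ltW.
  by lra.
(* The gain of [delta / 4] in the distance pays for three losses: the error [eta] in [kap], the
   rounding of [lam] (at most [delta^2 / 36] since [g s = delta / 3]) and the discount
   ([cB s = delta^2 / 32]). The last two fit into [delta tau / 8 >= delta^2 / 16]. *)
have key : kap * (tau - delta / 4) ^+ 2 <= lam * tau - lam ^+ 2 * s / 4 - cB.
  apply: (@le_trans _ _ ((tau ^+ 2 - delta * tau / 8) / s)).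
    have eta1' := eta1; have eta0' := eta0; have eta_ell' := eta_ell.
    have d0 := delta0.
    rewrite kapE invfM mulrAC ler_pM2r ?invr_gt0//.
    rewrite mulrC ler_pdivrMr; last by lra.
    have h1 : (tau - delta / 4) ^+ 2 <= tau * (tau - delta / 4).
      rewrite -subr_ge0 (_ : _ - _ = delta / 4 * (tau - delta / 4)); last by ring.
      by rewrite mulr_ge0//; lra.
    apply: le_trans h1 _.
    rewrite (_ : tau ^+ 2 - delta * tau / 8 = tau * (tau - delta / 8)); last by ring.
    rewrite -mulrA ler_wpM2l ?(ltW tau0)//.
    have : eta * (tau - delta / 8) <= eta * ell by rewrite ler_wpM2l ?(ltW eta0)//; lra.
    by lra.
  rewrite ler_pdivrMr//.
  have h2 : (2 * tau - lam * s) ^+ 2 <= (g * s) ^+ 2.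
    have a1 : lam * s <= 2 * tau by rewrite -ler_pdivlMr.
    have a2 : 2 * tau - g * s <= lam * s.
      by rewrite lerBlDr -mulrDl -ler_pdivrMr// -lerBlDr.
    by apply: lerXn2r; rewrite ?nnegrE; [lra| rewrite mulr_ge0// ltW|lra].
  have gs : g * s = delta / 3 by rewrite gE; field; rewrite gt_eqF.
  have cBs : cB * s = delta ^+ 2 / 32 by rewrite cBE; field; rewrite gt_eqF.
  rewrite gs in h2.
  have h3 : delta * (delta / 2) <= delta * tau by rewrite ler_pM2l.
  rewrite !mulrBl cBs.
  rewrite (_ : lam * tau * s - lam ^+ 2 * s / 4 * s = tau ^+ 2 - (2 * tau - lam * s) ^+ 2 / 4); last by field.
  by have d2 := sqr_ge0 delta; lra.
have [D1 D1le] : 0 <= Num.max (y - enorm c) 0 + 3 * e /\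
    Num.max (y - enorm c) 0 + 3 * e <= tau - delta / 4.
  have ed := e_delta; have e0' := e0; have d0 := delta0; split.
    by rewrite addr_ge0 ?le_max ?lexx ?orbT// mulr_ge0// ltW.
  rewrite -lerBrDr ge_max; apply/andP; split; last by lra.
  by move: tau_ge; rewrite yE /tau; lra.
have lo2 : e ^+ 2 * (v / (4 * s * pi)) * expR (- (N * (lam * tau - lam ^+ 2 * s / 4 - cB))) <=
    law (outside y).
  apply: le_trans lo; rewrite ler_wpM2l ?(ltW b0)// ler_expR lerN2.
  rewrite mulrAC mulrC ler_wpM2l ?(ltW N0)//; apply: le_trans key.
  rewrite ler_wpM2l ?(ltW kap0)//; apply: lerXn2r => //.
  by rewrite nnegrE (le_trans D1).
apply: (@le_trans _ _ (C1 * E * law (outside y))); last first.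
  rewrite ler_wpM2r ?(ltW out0)// ler_wpM2l ?(ltW C10)// lerDl//.
apply: (@le_trans _ _ (C1 * E * (e ^+ 2 * (v / (4 * s * pi)) *
    expR (- (N * (lam * tau - lam ^+ 2 * s / 4 - cB)))))); last first.
  by rewrite ler_wpM2l// mulr_ge0 ?expR_ge0// ltW.
rewrite C1E [leRHS]mulrACA divfK ?gt_eqF//.
have : 1 <= E * expR (- (N * (lam * tau - lam ^+ 2 * s / 4 - cB))).
  by rewrite expRN ler_pdivlMr ?expR_gt0// mul1r.
move=> h; apply: (@le_trans _ _ (8 * pi * 1)); last by rewrite ler_wpM2l// mulr_ge0 ?pi_ge0.
by rewrite mulr1 ler_wpM2r ?pi_ge0//; lra.
Qed.

Lemma odds_le : law (inside y) / law (outside y) <=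
  C1 * (expR (- (cA * N)) + \sum_(i < (Num.truncn (6 * ell / delta)).+1)
    expR (- (i%:R * g) * U1 * (N * (c.1 - m0.1))
          + (- (i%:R * g) * U2) * (N * (c.2 - m0.2))
          - (((- (i%:R * g) * U1) ^+ 2 + (- (i%:R * g) * U2) ^+ 2) * s / 4 + cB) * N)).
Proof.
rewrite mulrDr; have [yc|yc] := leP (y + delta / 2) (enorm c).
  apply: le_trans (odds_far yc) _; rewrite lerDl mulr_ge0 ?(ltW C10)//.
  by apply: sumr_ge0 => i _; exact: expR_ge0.
by apply: le_trans (odds_near yc) _; rewrite lerDr mulr_ge0 ?expR_ge0 ?(ltW C10).
Qed.

End fixed_round.

Lemma odds_constants_gt0 : [/\ 0 < cA, 0 < cB & 0 < C1].
Proof. by split. Qed.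

End odds.

(** * Expected sums over the rounds *)

Section bounded_sum.
Context {R : realType} d {Omega : measurableType d} (P : probability Omega R).
Variable T : nat.
Implicit Types (f g : nat -> Omega -> R) (C D : R).

(* In the instances below [f t] concerns the round [t.+1] and depends on the
   statistics of the rounds [1, ..., t]. *)
Definition bounded_sum C f :=
  [/\ forall t, measurable_fun setT (f t), forall t w, 0 <= f t w &
      (\sum_(t < T) \int[P]_w (f t w)%:E <= C%:E)%E].

Lemma bounded_sumD C D f g : bounded_sum C f -> bounded_sum D g ->
  bounded_sum (C + D) (fun t w => f t w + g t w).
Proof.
move=> [mf f0 fC] [mg g0 gD]; split => [t|t w|].
- exact: measurable_funD.
- exact: addr_ge0.
- under eq_bigr => t _.
    under eq_integral do rewrite EFinD.
    rewrite ge0_integralD//; [|by move=> w _; rewrite lee_fin|exact/measurable_EFinP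
      |by move=> w _; rewrite lee_fin|exact/measurable_EFinP].
    over.
  by rewrite big_split /= EFinD leeD.
Qed.

Lemma bounded_sumZ a C f : 0 <= a -> bounded_sum C f ->
  bounded_sum (a * C) (fun t w => a * f t w).
Proof.
move=> a0 [mf f0 fC]; split => [t|t w|].
- exact: measurable_funM.
- exact: mulr_ge0.
- under eq_bigr do rewrite ge0_integral_EFinMl//.
  rewrite -ge0_sume_distrr; last first.
    by move=> t _; apply: integral_ge0 => w _; rewrite lee_fin.
  by rewrite EFinM lee_wpmul2l// lee_fin.
Qed.

Lemma bounded_sum_sum n (C : 'I_n -> R) (f : 'I_n -> nat -> Omega -> R) :
  (forall i, bounded_sum (C i) (f i)) ->
  bounded_sum (\sum_i C i) (fun t w => \sum_i f i t w).
Proof.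
elim: n C f => [|n IH] C f h.
  rewrite big_ord0; split => [t|t w|].
  - rewrite (_ : (fun _ => _) = cst 0)//.
    by apply/funext => w; rewrite big_ord0.
  - by rewrite big_ord0.
  - rewrite big1// => t _; rewrite integral0_eq// => w _.
    by rewrite big_ord0.
have := bounded_sumD (IH _ _ (fun i => h (widen_ord (leqnSn n) i))) (h ord_max).
rewrite big_ord_recr /= => hn.
rewrite (_ : (fun t w => \sum_i f i t w) = (fun t w =>
  \sum_i f (widen_ord (leqnSn n) i) t w + f ord_max t w))//.
by apply/funext => t; apply/funext => w; rewrite big_ord_recr.
Qed.

Lemma bounded_sum_ae_le C f g : (forall t, measurable_fun setT (f t)) ->
  (forall t w, 0 <= f t w) -> {ae P, forall w, forall t, f t w <= g t w} ->
  bounded_sum C g -> bounded_sum C f.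
Proof.
move=> mf f0 fg [mg g0 gC]; split => //; apply: le_trans gC.
apply: lee_sum => t _; apply: ae_ge0_le_integral => //.
- by move=> w _; rewrite lee_fin.
- exact/measurable_EFinP.
- by move=> w _; rewrite lee_fin.
- exact/measurable_EFinP.
- by apply: filterS fg => w + _; rewrite lee_fin; apply.
Qed.

Lemma bounded_sum_cst (c : nat -> R) C : (forall t, 0 <= c t) ->
  \sum_(t < T) c t <= C -> bounded_sum C (fun t _ => c t).
Proof.
move=> c0 cC; split=> [t|t w|]; [by []|exact: c0|].
under eq_bigr do rewrite integral_cst//= probability_setT mule1.
by rewrite sumEFin lee_fin.
Qed.

Lemma bounded_sum_le_cst f (c : nat -> R) C : (forall t, measurable_fun setT (f t)) ->
  (forall t w, 0 <= f t w) -> (forall t, (\int[P]_w (f t w)%:E <= (c t)%:E)%E) ->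
  \sum_(t < T) c t <= C -> bounded_sum C f.
Proof.
move=> mf f0 fc cC; split => //.
apply: (@le_trans _ _ (\sum_(t < T) (c t)%:E)%E); first exact: lee_sum.
by rewrite sumEFin lee_fin.
Qed.

End bounded_sum.

Lemma sum_expR_le (R : realType) (a : R) T : 0 < a ->
  \sum_(t < T) expR (- (a * t%:R)) <= (1 - expR (- a))^-1.
Proof.
move=> a0; have e1 : expR (- a) < 1 by rewrite expR_lt1 oppr_lt0.
have e0 : 0 < 1 - expR (- a) by rewrite subr_gt0.
rewrite -[leRHS]mul1r ler_pdivlMr// mulr_suml.
suff: \sum_(t < T) expR (- (a * t%:R)) * (1 - expR (- a)) = 1 - expR (- (a * T%:R)).
  by move=> ->; rewrite gerBl expR_ge0.
elim: T => [|T IH]; first by rewrite big_ord0 mulr0 oppr0 expR0 subrr.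
rewrite big_ord_recr /= IH mulrBr mulr1 -expRD -natr1.
rewrite (_ : - (a * T%:R) + - a = - (a * (T%:R + 1))); last by ring.
by ring.
Qed.

Section regret.
Context {R : realType} {K : nat} {d : measure_display}
  {Omega : measurableType d} (P : probability Omega R).
Variables (p : nat -> 'I_K -> Omega -> R)
  (X : nat -> 'I_K -> {RV P >-> (R * R)%type})
  (mu : 'I_K -> (R * R)%type) (sigma2 : 'I_K -> R).
Hypothesis K2 : (2 <= K)%N.
Hypothesis sigma2_gt0 : forall k, 0 < sigma2 k.
Hypothesis bandit : bandit_under_weighted_information p X mu sigma2.
Hypothesis wts : weighted_thompson_sampling p X.
Local Notation N := (power_sum p).
Local Notation S := (scatter p X).
Local Notation tilt := (tilt p X mu sigma2).
Local Notation W := (noise_energy p X mu).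

Lemma measurable_power t k : measurable_fun setT (p t.+1 k).
Proof.
apply: (@measurable_past _ _ _ _ _ _ _ _ _ bandit t.+1).
exact: (measurable_power_past bandit k (isT : (1 <= t.+1)%N)).
Qed.

Lemma bounded_sum_tilt T (c l1 l2 : R) k : 0 < c ->
  bounded_sum P T ((1 + c) / c) (fun t w => p t.+1 k w * tilt c l1 l2 t k w).
Proof.
move=> c0; split => [t|t w|].
- apply: measurable_funM; first exact: measurable_power.
  apply: (@measurable_past _ _ _ _ _ _ _ _ _ bandit t.+1).
  exact: (measurable_tilt K2 bandit).
- by rewrite mulr_ge0 ?expR_ge0// (power_ge0 bandit).
- exact: (sum_tilt_le K2 sigma2_gt0 bandit wts).
Qed.

(** The partial sums stay below the minimum of [N] and [L + 1]: nothing is added once [N] has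
    reached [L], and the round that crosses [L] adds at most 1. *)
Lemma sum_power_below T k w (L : R) : 0 <= L ->
  \sum_(t < T) p t.+1 k w * (N t k w < L)%R%:R <= L + 1.
Proof.
move=> L0.
suff: \sum_(t < T) p t.+1 k w * (N t k w < L)%R%:R <= Num.min (N T k w) (L + 1).
  by move/le_trans; apply; rewrite ge_min lexx orbT.
have p0 t : 0 <= p t.+1 k w by exact: (power_ge0 bandit).
have p1 t : p t.+1 k w <= 1 by exact: (power_le1 bandit).
elim: T => [|T IH].
  by rewrite big_ord0 /power_sum total_power0 le_min lexx addr_ge0.
have NS : N T.+1 k w = N T k w + p T.+1 k w by rewrite /power_sum total_powerS.
rewrite big_ord_recr/= NS; have := p0 T; have := p1 T.
move: IH; rewrite le_min => /andP[h1 h2] q1 q0.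
rewrite le_min; have [NL|NL] := ltP (N T k w) L; rewrite ?mulr1 ?mulr0 ?addr0.
  by rewrite lerD2r h1/=; lra.
by rewrite h2 andbT; lra.
Qed.

Lemma bounded_sum_below T k (L : R) : 0 <= L ->
  bounded_sum P T (L + 1) (fun t w => p t.+1 k w * (N t k w < L)%R%:R).
Proof.
move=> L0.
have mf t : measurable_fun setT (fun w => p t.+1 k w * (N t k w < L)%R%:R).
  apply: measurable_funM; first exact: measurable_power.
  rewrite (_ : (fun w => (N t k w < L)%R%:R) = (fun w => if N t k w < L then 1 else 0)); last first.
    by apply/funext => w; case: ifP.
  apply: measurable_fun_ifT => //; apply: measurable_fun_ltr => //.
  apply: (@measurable_past _ _ _ _ _ _ _ _ _ bandit t.+1).
  exact: (measurable_power_sum K2 bandit).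
have f0 t w : 0 <= p t.+1 k w * (N t k w < L)%R%:R.
  by rewrite mulr_ge0// (power_ge0 bandit).
split => //.
rewrite -ge0_integral_sum//; last 2 first.
- by move=> t; exact/measurable_EFinP.
- by move=> t w _; rewrite lee_fin.
apply: (@le_trans _ _ (\int[P]_w (L + 1)%:E)%E); last first.
  by rewrite integral_cst//= probability_setT mule1.
apply: ge0_le_integral => //.
- by move=> w _; apply: sume_ge0 => t _; rewrite lee_fin.
- by apply: emeasurable_sum => t; exact/measurable_EFinP.
- by move=> w _; rewrite sumEFin lee_fin sum_power_below.
Qed.

(** Chernoff's bound with half of the optimal parameter. The rate is
    [ga = phi (1 + eta) - phi / (1 - phi)], using [1 / (1 - phi) <= exp (phi / (1 - phi))]. *)
Lemma bounded_sum_energy k (eta : R) : 0 < eta -> exists C, forall T,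
  bounded_sum P T C (fun t w => expR (eta / (2 * (1 + eta)) / sigma2 k *
    (W t k w - (1 + eta) * sigma2 k * t%:R))).
Proof.
move=> eta0; have s0 := sigma2_gt0 k; pose phi := eta / (2 * (1 + eta)).
pose ga := eta ^+ 2 / (2 * (2 + eta)).
have phi0 : 0 < phi by rewrite divr_gt0// mulr_gt0//; lra.
have phi1 : phi < 1 by rewrite ltr_pdivrMr ?mul1r ?mulr_gt0//; lra.
have ga0 : 0 < ga by rewrite divr_gt0 ?exprn_gt0// mulr_gt0//; lra.
exists (1 - expR (- ga))^-1 => T.
pose th := phi / sigma2 k; have ths : th * sigma2 k = phi by rewrite divfK// gt_eqF.
have mW t : measurable_fun setT (W t k).
  apply: (@measurable_past _ _ _ _ _ _ _ _ _ bandit t.+1).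
  exact: (measurable_noise_energy K2 bandit).
apply: (@bounded_sum_le_cst _ _ _ _ _ _ (fun t => expR (- (ga * t%:R)))).
- move=> t; apply: measurableT_comp => //; apply: measurable_funM => //.
  exact: measurable_funB.
- by move=> t w; exact: expR_ge0.
- move=> t; rewrite -/phi -/th.
  under eq_integral do rewrite mulrBr expRB.
  have mE : measurable_fun setT (fun w => expR (th * W t k w)).
    by apply: measurableT_comp => //; exact: measurable_funM.
  rewrite (ge0_integral_EFinMr _ _ mE) ?invr_ge0 ?expR_ge0//.
  rewrite (integral_energy K2 sigma2_gt0 bandit wts) ths//.
  rewrite -EFinM lee_fin -expRN.
  have h : (1 - phi) ^- t <= expR (t%:R * (phi / (1 - phi))).
    rewrite expRM_natl -exprVn; apply: lerXn2r; rewrite ?nnegrE ?expR_ge0 ?invr_ge0 ?subr_ge0 ?(ltW phi1)//.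
    apply: le_trans (expR_ge1Dx _).
    by rewrite (_ : 1 + phi / (1 - phi) = (1 - phi)^-1)//; field; rewrite subr_eq0 gt_eqF.
  apply: le_trans (ler_wpM2r (expR_ge0 _) h) _.
  rewrite -expRD ler_expR le_eqVlt; apply/orP; left; apply/eqP.
  rewrite [th * _]mulrA [th * _]mulrCA ths /phi /ga.
  by field; rewrite !gt_eqF//; lra.
exact: sum_expR_le.
Qed.

(** An exponential majorant of the indicator of a low scatter. It is set to 0 before any
    observation, where the weight [1 / N] of [integral_scatter] makes no sense. *)
Definition low_scatter eta k t w : R := if t is t'.+1 then
  expR (- (eta / sigma2 k) * (S t k w - (1 - eta) * sigma2 k * t%:R)) else 0.

Lemma power_sum_le t k w : N t k w <= t%:R.
Proof.
elim: t => [|t IH]; first by rewrite /power_sum total_power0.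
rewrite /power_sum total_powerS -natr1 lerD//.
exact: (power_le1 bandit).
Qed.

(** Chernoff's bound at [th = eta / sigma2], of rate [eta / (1 + eta) - eta (1 - eta) = ga].
    Removing the weight [1 / N] by [N <= t] costs a factor [t], absorbed by half of the rate. *)
Lemma bounded_sum_scatter k (eta : R) : 0 < eta -> exists C, forall T,
  bounded_sum P T C (low_scatter eta k).
Proof.
move=> eta0; have s0 := sigma2_gt0 k.
pose ga := eta ^+ 3 / (1 + eta).
have ga0 : 0 < ga by rewrite divr_gt0 ?exprn_gt0//; lra.
exists (K%:R * (1 + eta) * (2 / ga) * (1 - expR (- (ga / 2)))^-1) => T.
pose th := eta / sigma2 k; have ths : th * sigma2 k = eta by rewrite divfK// gt_eqF.
have th0 : 0 < th by rewrite divr_gt0.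
have mS t : measurable_fun setT (S t.+1 k).
  apply: (@measurable_past _ _ _ _ _ _ _ _ _ bandit t.+2).
  by apply: (measurable_scatter K2 bandit wts) => //=.
have c0 : 0 <= K%:R * (1 + eta) * (2 / ga).
  apply: mulr_ge0; last by rewrite divr_ge0// ltW.
  by rewrite mulr_ge0 ?ler0n//; lra.
apply: (@bounded_sum_le_cst _ _ _ _ _ _ (fun t => K%:R * (1 + eta) * (2 / ga) * expR (- (ga / 2 * t%:R)))).
- move=> [|t]; first exact: measurable_cst.
  apply: (measurableT_comp (@measurable_expR R)); apply: measurable_funM => //.
  exact: measurable_funB.
- by move=> [|t] w //=; exact: expR_ge0.
- move=> [|t]; first by rewrite /= integral0// lee_fin mulr_ge0// expR_ge0.
  rewrite /low_scatter -/th.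
  have N0 w : 0 < N t.+1 k w by exact: (power_sum_gt0 K2 bandit wts).
  apply: (@le_trans _ _ (\int[P]_w (expR (- th * S t.+1 k w) / N t.+1 k w *
      (t.+1%:R * expR (eta * (1 - eta) * t.+1%:R)))%:E)%E).
    apply: ge0_le_integral => //.
    - apply/measurable_EFinP; apply: measurableT_comp => //; apply: measurable_funM => //.
      exact: measurable_funB.
    - apply/measurable_EFinP; apply: measurable_funM => //.
      exact: (measurable_scatter_term K2 bandit wts).
    move=> w _; rewrite lee_fin.
    rewrite (_ : - th * (_ - _) = - th * S t.+1 k w + eta * (1 - eta) * t.+1%:R); last first.
      by rewrite -ths; ring.
    rewrite expRD mulrA ler_wpM2r ?expR_ge0// -mulrA ler_peMr ?expR_ge0//.
    by rewrite mulrC ler_pdivlMr ?mul1r// power_sum_le.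
  have f0 w : 0 <= expR (- th * S t.+1 k w) / N t.+1 k w.
    by rewrite divr_ge0 ?expR_ge0// ltW.
  rewrite (ge0_integral_EFinMr _ f0); last 2 first.
  - exact: (measurable_scatter_term K2 bandit wts).
  - by rewrite mulr_ge0 ?expR_ge0.
  have i1 := integral_scatter K2 sigma2_gt0 bandit wts t k th0; rewrite ths in i1.
  apply: le_trans (lee_wpmul2r _ i1) _; first by rewrite lee_fin mulr_ge0 ?expR_ge0.
  rewrite -EFinM lee_fin.
  have h1 : (1 + eta) ^- t <= (1 + eta) * expR (- (t.+1%:R * (eta / (1 + eta)))).
    rewrite -ler_pdivrMl; last by lra.
    by rewrite -invfM -exprS; apply: inv_pow_le_expR; exact: ltW.
  have h2 : t.+1%:R <= 2 / ga * expR (ga / 2 * t.+1%:R).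
    rewrite [leLHS](_ : _ = 2 / ga * (ga / 2 * t.+1%:R)); last by field; rewrite gt_eqF.
    apply: ler_wpM2l; first by rewrite divr_ge0// ltW.
    by apply: le_trans (expR_ge1Dx _); rewrite lerDr.
  apply: (@le_trans _ _ (K%:R * ((1 + eta) * expR (- (t.+1%:R * (eta / (1 + eta))))) *
      (2 / ga * expR (ga / 2 * t.+1%:R) * expR (eta * (1 - eta) * t.+1%:R)))).
    apply: ler_pM.
    - by rewrite divr_ge0 ?ler0n// exprn_ge0//; lra.
    - by rewrite mulr_ge0 ?expR_ge0.
    - by rewrite ler_wpM2l ?ler0n.
    - by rewrite ler_wpM2r ?expR_ge0.
  rewrite (_ : K%:R * (_ * expR _) * (2 / ga * expR _ * expR _) =
    K%:R * (1 + eta) * (2 / ga) * (expR (- (t.+1%:R * (eta / (1 + eta)))) *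
    expR (ga / 2 * t.+1%:R) * expR (eta * (1 - eta) * t.+1%:R))); last by ring.
  rewrite ler_wpM2l// -!expRD ler_expR le_eqVlt; apply/orP; left; apply/eqP.
  by rewrite /ga; field; rewrite !gt_eqF//; lra.
rewrite -mulr_sumr ler_wpM2l//.
by apply: sum_expR_le; rewrite divr_gt0.
Qed.

End regret.

Lemma bounded_sum_initial (R : realType) d (Omega : measurableType d)
  (P : probability Omega R) T t0 :
  bounded_sum P T t0%:R (fun t _ => (t < t0)%N%:R).
Proof.
apply: bounded_sum_cst => [t|]; first by [].
rewrite -natr_sum ler_nat; apply: (@leq_trans (minn T t0)); last exact: geq_minr.
elim: T => [|T IH]; first by rewrite big_ord0.
rewrite big_ord_recr /=; move: IH; set s := \sum_(_ < _) _.
by case: (ltnP T t0) => h /=; lia.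
Qed.

(** [T] is the horizon, so its [T] terms [1 / T] add up to 1; the factor [exp ga] makes up for the
    shift from [t] to [t - 1]. *)
Lemma bounded_sum_tail (R : realType) d (Omega : measurableType d)
  (P : probability Omega R) T (ga : R) : (1 <= T)%N -> 0 < ga ->
  bounded_sum P T (1 + expR ga * (1 - expR (- ga))^-1)
    (fun t _ => expR (- ln T%:R) + expR (- (ga * t.-1%:R))).
Proof.
move=> T1 ga0; apply: bounded_sum_cst => [t|].
  by rewrite addr_ge0 ?expR_ge0.
rewrite big_split /=; apply: lerD.
  rewrite sumr_const card_ord expRN lnK ?posrE ?ltr0n//.
  by rewrite -[leLHS]mulr_natr mulVf// pnatr_eq0 -lt0n.
apply: (@le_trans _ _ (\sum_(t < T) expR ga * expR (- (ga * t%:R)))); last first.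
  by rewrite -mulr_sumr ler_wpM2l ?expR_ge0// sum_expR_le.
apply: ler_sum => t _; rewrite -expRD ler_expR.
have : (t : nat)%:R <= t.-1%:R + 1 :> R by rewrite natr1 ler_nat leqSpred.
by move=> /(ler_wpM2l (ltW ga0)); lra.
Qed.

(** * Deviations of the weighted mean *)

Section arm.
Context {R : realType} {K : nat} {d : measure_display}
  {Omega : measurableType d} (P : probability Omega R).
Variables (p : nat -> 'I_K -> Omega -> R)
  (X : nat -> 'I_K -> {RV P >-> (R * R)%type})
  (mu : 'I_K -> (R * R)%type) (sigma2 : 'I_K -> R).
Hypothesis K2 : (2 <= K)%N.
Hypothesis sigma2_gt0 : forall k, 0 < sigma2 k.
Hypothesis bandit : bandit_under_weighted_information p X mu sigma2.
Hypothesis wts : weighted_thompson_sampling p X.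
Local Notation N := (power_sum p).
Local Notation tilt := (tilt p X mu sigma2).

(** One tilt per coordinate and sign. With slope [2 b / sigma2] the compensator and the discount are
    both [b^2 / sigma2], so the exponent is [(2 b / sigma2) (m - b N)] and the tilt is at least 1 as
    soon as the signed error [m] is at least [b N]. A norm above [2 b] forces this for one
    coordinate. *)
Definition deviation_tilts k (b : R) t w :=
  (tilt (b ^+ 2 / sigma2 k) (2 * b / sigma2 k) 0 t k w +
   tilt (b ^+ 2 / sigma2 k) (- (2 * b / sigma2 k)) 0 t k w) +
  (tilt (b ^+ 2 / sigma2 k) 0 (2 * b / sigma2 k) t k w +
   tilt (b ^+ 2 / sigma2 k) 0 (- (2 * b / sigma2 k)) t k w).

Lemma deviation_tilts_ge1 k b t w : (1 <= t)%N -> 0 < b ->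
  2 * b < enorm (mean p X t k w - mu k) -> 1 <= deviation_tilts k b t w.
Proof.
move=> t1 b0 dev; have s0 := sigma2_gt0 k.
have N0 : 0 < N t k w by exact: (power_sum_gt0 K2 bandit wts).
have e1 : (mean p X t k w).1 - (mu k).1 = mean_error1 p X mu t k w / N t k w by exact: wmean1E.
have e2 : (mean p X t k w).2 - (mu k).2 = mean_error2 p X mu t k w / N t k w by exact: wmean2E.
have big (m : R) : N t k w * b <= m ->
    0 <= 2 * b / sigma2 k * m - ((2 * b / sigma2 k) ^+ 2 * sigma2 k / 4 + b ^+ 2 / sigma2 k) * N t k w.
  move=> Nm; rewrite (_ : _ - _ = 2 * b / sigma2 k * (m - N t k w * b)); last first.
    by field; rewrite gt_eqF.
  by rewrite mulr_ge0 ?subr_ge0// divr_ge0// ?mulr_ge0 ?(ltW b0)// ltW.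
have pos c l1 l2 : 0 <= tilt c l1 l2 t k w by exact: expR_ge0.
have h : b < `|mean_error1 p X mu t k w / N t k w| \/ b < `|mean_error2 p X mu t k w / N t k w|.
  have := lt_le_trans dev (enorm_le_norm1 _); rewrite /= e1 e2.
  by have [|] := ltP b `|mean_error1 p X mu t k w / N t k w|; [left|right; lra].
have split (m : R) : b < `|m / N t k w| -> N t k w * b <= m \/ N t k w * b <= - m.
  rewrite normrM normfV (gtr0_norm N0) ltr_pdivlMr// mulrC.
  by case: (ltrgt0P m) => [_|_|->]; [left; exact: ltW|right; exact: ltW|right; rewrite oppr0; exact: ltW].
have p1 := pos (b ^+ 2 / sigma2 k) (2 * b / sigma2 k) 0.
have p2 := pos (b ^+ 2 / sigma2 k) (- (2 * b / sigma2 k)) 0.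
have p3 := pos (b ^+ 2 / sigma2 k) 0 (2 * b / sigma2 k).
have p4 := pos (b ^+ 2 / sigma2 k) 0 (- (2 * b / sigma2 k)).
rewrite /deviation_tilts.
case: h => /split[] /big h.
- have q : 1 <= tilt (b ^+ 2 / sigma2 k) (2 * b / sigma2 k) 0 t k w.
    rewrite -[leLHS]expR0 ler_expR; apply: le_trans h _.
    by rewrite ?sqrrN (expr2 0) ?mul0r ?mulNr ?mulrN ?addr0 ?add0r.
  by rewrite -addrA (le_trans q)// lerDl !addr_ge0.
- have q : 1 <= tilt (b ^+ 2 / sigma2 k) (- (2 * b / sigma2 k)) 0 t k w.
    rewrite -[leLHS]expR0 ler_expR; apply: le_trans h _.
    by rewrite ?sqrrN (expr2 0) ?mul0r ?mulNr ?mulrN ?addr0 ?add0r.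
  by rewrite [X in X + _]addrC -addrA (le_trans q)// lerDl !addr_ge0.
- have q : 1 <= tilt (b ^+ 2 / sigma2 k) 0 (2 * b / sigma2 k) t k w.
    rewrite -[leLHS]expR0 ler_expR; apply: le_trans h _.
    by rewrite ?sqrrN (expr2 0) ?mul0r ?mulNr ?mulrN ?addr0 ?add0r.
  by rewrite addrC -addrA (le_trans q)// lerDl !addr_ge0.
- have q : 1 <= tilt (b ^+ 2 / sigma2 k) 0 (- (2 * b / sigma2 k)) t k w.
    rewrite -[leLHS]expR0 ler_expR; apply: le_trans h _.
    by rewrite ?sqrrN (expr2 0) ?mul0r ?mulNr ?mulrN ?addr0 ?add0r.
  by rewrite addrC [X in X + _]addrC -addrA (le_trans q)// lerDl !addr_ge0.
Qed.

Lemma bounded_sum_deviation k (b : R) : 0 < b -> exists C, forall T,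
  bounded_sum P T C (fun t w => p t.+1 k w * deviation_tilts k b t w).
Proof.
move=> b0; have s0 := sigma2_gt0 k.
have c0 : 0 < b ^+ 2 / sigma2 k by rewrite divr_gt0 ?exprn_gt0.
pose C := (1 + b ^+ 2 / sigma2 k) / (b ^+ 2 / sigma2 k).
exists ((C + C) + (C + C)) => T'.
have h l1 l2 := bounded_sum_tilt K2 sigma2_gt0 bandit wts T' l1 l2 k c0.
have := bounded_sumD (bounded_sumD (h (2 * b / sigma2 k) 0) (h (- (2 * b / sigma2 k)) 0))
  (bounded_sumD (h 0 (2 * b / sigma2 k)) (h 0 (- (2 * b / sigma2 k)))).
rewrite (_ : (fun t w => p t.+1 k w * deviation_tilts k b t w) =
  (fun t w => (p t.+1 k w * tilt (b ^+ 2 / sigma2 k) (2 * b / sigma2 k) 0 t k w +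
   p t.+1 k w * tilt (b ^+ 2 / sigma2 k) (- (2 * b / sigma2 k)) 0 t k w) +
  (p t.+1 k w * tilt (b ^+ 2 / sigma2 k) 0 (2 * b / sigma2 k) t k w +
   p t.+1 k w * tilt (b ^+ 2 / sigma2 k) 0 (- (2 * b / sigma2 k)) t k w)))//.
by apply/funext => t; apply/funext => w; rewrite /deviation_tilts !mulrDr.
Qed.

End arm.

(** Hides the explicit constants; what matters is that they are chosen before the round and the
    statistics. *)
Lemma odds_bound (R : realType) (s v delta : R) (m0 : (R * R)%type) :
  0 < s -> 0 < v -> 0 < delta -> delta <= enorm m0 ->
  exists (cA cB C1 : R) (n : nat) (l1 l2 : 'I_n -> R), [/\ 0 < cA, 0 < cB, 0 < C1 &
  forall (t : nat) (N S : R) (c : (R * R)%type),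
  (5 <= t)%N -> v <= N -> N <= t%:R ->
  (1 - delta / (8 * enorm m0)) * s * t%:R <= S ->
  S <= (1 + delta / (8 * enorm m0)) * s * t%:R ->
  fine (law_of_density (student_pdf t.-1 (N / S) c) (inside (enorm m0 - delta))) /
  fine (law_of_density (student_pdf t.-1 (N / S) c) (outside (enorm m0 - delta))) <=
  C1 * (expR (- (cA * N)) + \sum_(i < n)
    expR (l1 i * (N * (c.1 - m0.1)) + l2 i * (N * (c.2 - m0.2))
          - ((l1 i ^+ 2 + l2 i ^+ 2) * s / 4 + cB) * N))].
Proof.
move=> s0 v0 delta0 delta_ell.
pose ell := enorm m0; pose eta := delta / (8 * ell).
pose kap := ((1 - eta) * s)^-1.
pose cA := delta ^+ 2 / (64 * s * (1 + kap * delta ^+ 2 / 4)).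
pose e := Num.min (delta / 12) (cA / (kap * delta)).
pose g := delta / (3 * s); pose cB := delta ^+ 2 / (32 * s).
pose C1 := 8 * pi / (e ^+ 2 * (v / (4 * s * pi))).
pose U := (m0.1 / ell, m0.2 / ell).
exists cA, cB, C1, (Num.truncn (6 * ell / delta)).+1,
  (fun i => - (i%:R * g) * U.1), (fun i => - (i%:R * g) * U.2).
have [cA0 cB0 C10] : [/\ 0 < cA, 0 < cB & 0 < C1].
  exact: (@odds_constants_gt0 _ s v delta s0 v0 delta0 ell eta kap cA e cB C1).
split=> // t N S c t5 vN Nt S1 S2.
exact: (@odds_le _ s v delta m0 s0 v0 delta0 ell (ell - delta) eta kap cA e g cB C1).
Qed.

(** Each case of [power_le_terms] is settled by one term, except the last, which needs the posterior
    tail and the odds together. *)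
Lemma le_some_term (R : realFieldType) (q a1 a2 a3 a4 a5 a6 a7 a8 : R) :
  0 <= a1 -> 0 <= a2 -> 0 <= a3 -> 0 <= a4 -> 0 <= a5 -> 0 <= a6 -> 0 <= a7 -> 0 <= a8 ->
  [|| q <= a1, q <= a2, q <= a3, q <= a4, q <= a5, q <= a6 | q <= a7 + a8] ->
  q <= a1 + a2 + a3 + a4 + a5 + a6 + a7 + a8.
Proof.
move=> h1 h2 h3 h4 h5 h6 h7 h8.
do 6 (case/orP; first by move=> ?; lra).
by move=> ?; lra.
Qed.

(** * Expected total power of a suboptimal arm *)

Section arm.
Context {R : realType} {K : nat} {d : measure_display}
  {Omega : measurableType d} (P : probability Omega R).
Variables (p : nat -> 'I_K -> Omega -> R)
  (X : nat -> 'I_K -> {RV P >-> (R * R)%type})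
  (mu : 'I_K -> (R * R)%type) (sigma2 : 'I_K -> R).
Hypothesis K2 : (2 <= K)%N.
Hypothesis sigma2_gt0 : forall k, 0 < sigma2 k.
Hypothesis bandit : bandit_under_weighted_information p X mu sigma2.
Hypothesis wts : weighted_thompson_sampling p X.
Local Notation N := (power_sum p).
Local Notation S := (scatter p X).
Local Notation tilt := (tilt p X mu sigma2).
Local Notation W := (noise_energy p X mu).

(** An exponential majorant of the indicator of [W >= (1 + eta) sigma2 t]. *)
Definition high_energy eta t k w : R := expR (eta / (2 * (1 + eta)) / sigma2 k *
    (W t k w - (1 + eta) * sigma2 k * t%:R)).

Lemma scatter_le t k w (eta : R) : 0 < eta -> (1 <= t)%N -> high_energy eta t k w < 1 ->
  S t k w <= (1 + eta) * sigma2 k * t%:R.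
Proof.
move=> eta0 t1; have s0 := sigma2_gt0 k.
rewrite /high_energy expR_lt1 pmulr_rlt0; last first.
  by rewrite !divr_gt0// mulr_gt0//; lra.
rewrite subr_lt0 => /ltW; apply: le_trans.
exact: (wscatter_le_energy _ _ (power_sum_gt0 K2 bandit wts k w t1)).
Qed.

Lemma low_scatter_ge t k w (eta : R) : 0 < eta -> (1 <= t)%N ->
  low_scatter p X sigma2 eta k t w < 1 -> (1 - eta) * sigma2 k * t%:R <= S t k w.
Proof.
move=> eta0; have s0 := sigma2_gt0 k; case: t => // t _.
rewrite /low_scatter expR_lt1 mulNr oppr_lt0 pmulr_rgt0 ?divr_gt0//.
by rewrite subr_gt0 => /ltW.
Qed.

Section pointwise.
Variables (k ks : 'I_K) (j T : nat) (xi : R).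
Local Notation gap := (enorm (mu ks) - enorm (mu k)).
Local Notation u := (j%:R^-1 : R).
Hypotheses (j2 : (2 <= j)%N) (xi0 : 0 <= xi) (uxi : u * (7 + 4 * xi) <= xi).
Hypotheses (gap0 : 0 < gap) (T1 : (1 <= T)%N).
Local Notation L := ((1 + xi) * (sigma2 k / gap ^+ 2) * ln T%:R).
Local Notation delta := (gap * u / 2).
Local Notation eta := (delta / (8 * enorm (mu ks))).
Variables (cA cB C1 : R) (n : nat) (l1 l2 : 'I_n -> R).
Hypothesis C10 : 0 < C1.
Hypothesis odds : forall (t : nat) (N S : R) (c : (R * R)%type),
  (5 <= t)%N -> K%:R^-1 <= N -> N <= t%:R ->
  (1 - eta) * sigma2 ks * t%:R <= S -> S <= (1 + eta) * sigma2 ks * t%:R ->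
  fine (law_of_density (student_pdf t.-1 (N / S) c) (inside (enorm (mu ks) - delta))) /
  fine (law_of_density (student_pdf t.-1 (N / S) c) (outside (enorm (mu ks) - delta))) <=
  C1 * (expR (- (cA * N)) + \sum_(i < n)
    expR (l1 i * (N * (c.1 - (mu ks).1)) + l2 i * (N * (c.2 - (mu ks).2))
          - ((l1 i ^+ 2 + l2 i ^+ 2) * sigma2 ks / 4 + cB) * N)).

(** The bound of [odds_bound] times the power of [ks]; [tilt cA 0 0] is [exp (- cA N)]. *)
Definition odds_tilts t w := C1 * (p t.+1 ks w * tilt cA 0 0 t ks w +
  \sum_(i < n) p t.+1 ks w * tilt cB (l1 i) (l2 i) t ks w).

(** The terms cover, in order: early rounds, small total power, a bad mean of [k], a large scatter
    of [k], a large and a small scatter of [ks], the posterior tail of [k], the odds of [ks]. The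
    margin [delta = gap u / 2] is spent twice, on the level and on the mean of [k], which leaves the
    distance [gap (1 - u)]. *)
Lemma power_le_terms t w : (forall t k, (2 <= t)%N -> 0 < S t k w) ->
  p t.+1 k w <= (t < j.*2 + 5)%N%:R + p t.+1 k w * (N t k w < L)%R%:R +
    p t.+1 k w * deviation_tilts p X mu sigma2 k (delta / 2) t w +
    high_energy u t k w + high_energy eta t ks w + low_scatter p X sigma2 eta ks t w +
    (2 * pi) ^+ K * (4 * pi * j%:R) *
      (expR (- ln T%:R) + expR (- ((1 - u) / (j%:R + 1) * t.-1%:R))) +
    odds_tilts t w.
Proof.
move=> S0.
have p0 i : 0 <= p t.+1 i w by exact: (power_ge0 bandit).
have p1 : p t.+1 k w <= 1 by exact: (power_le1 bandit).
have jR : 2 <= j%:R :> R by rewrite ler_nat.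
have u0 : 0 < u by rewrite invr_gt0; lra.
have u1 : u <= 2^-1 by rewrite lef_pV2 ?posrE//; lra.
have ell0 : 0 < enorm (mu ks).
  by have := enorm_ge0 (mu k); have := gap0; lra.
have delta0 : 0 < delta by rewrite divr_gt0 ?mulr_gt0.
have eta0 : 0 < eta by rewrite divr_gt0 ?mulr_gt0.
set f1 := (t < _)%N%:R; set f2 := (_ < L)%R%:R; set f3 := deviation_tilts _ _ _ _ _ _ _ _.
set f4 := high_energy _ _ k _; set f5 := high_energy _ _ ks _; set f6 := low_scatter _ _ _ _ _ _ _.
set f7 := (2 * pi) ^+ K * _ * _; set f8 := odds_tilts _ _.
have f10 : 0 <= f1 by exact: ler0n.
have f20 : 0 <= f2 by exact: ler0n.
have f30 : 0 <= f3 by rewrite !addr_ge0 ?expR_ge0.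
have f40 : 0 <= f4 by exact: expR_ge0.
have f50 : 0 <= f5 by exact: expR_ge0.
have f60 : 0 <= f6 by rewrite /f6; case: (t) => [|t'] //=; exact: expR_ge0.
have f70 : 0 <= f7.
  by rewrite /f7 mulr_ge0 ?addr_ge0 ?expR_ge0// mulr_ge0 ?exprn_ge0 ?mulr_ge0 ?pi_ge0//; lra.
have f80 : 0 <= f8.
  rewrite /f8 mulr_ge0 ?(ltW C10)// addr_ge0 ?mulr_ge0 ?expR_ge0//.
  by apply: sumr_ge0 => i _; rewrite mulr_ge0 ?expR_ge0.
have pf2 : 0 <= p t.+1 k w * f2 by exact: mulr_ge0.
have pf3 : 0 <= p t.+1 k w * f3 by exact: mulr_ge0.
apply: le_some_term => //.
(* The threshold gives both [2 j < t] for [arm_tail] and [5 <= t] for the odds. *)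
have [tj|tj] := ltnP t (j.*2 + 5); first by rewrite /f1 tj p1.
have [t5 jt t4 t1 t2] : [/\ (5 <= t)%N, (2 * j < t)%N, (4 <= t.+1)%N, (1 <= t)%N & (2 <= t)%N].
  by clear -tj j2; split; lia.
have n1 : (1 < t.-1)%N by clear -t5; lia.
have [NL|NL] := ltP (N t k w) L; first by rewrite /f2 NL mulr1 lexx orbT.
have [dev|dev] := ltP (2 * (delta / 2)) (enorm (mean p X t k w - mu k)).
  have : 1 <= f3 by apply: (deviation_tilts_ge1 K2 sigma2_gt0 bandit wts) => //; rewrite divr_gt0.
  by move=> /(ler_wpM2l (p0 k)); rewrite mulr1 => ->; rewrite !orbT.
have [h4|h4] := leP 1 f4; first by rewrite (le_trans p1 h4) !orbT.
have [h5|h5] := leP 1 f5; first by rewrite (le_trans p1 h5) !orbT.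
have [h6|h6] := leP 1 f6; first by rewrite (le_trans p1 h6) !orbT.
suff -> : p t.+1 k w <= f7 + f8 by rewrite !orbT.
have Ngt0 i : 0 < N t i w by exact: (power_sum_gt0 K2 bandit wts).
suff : p t.+1 k w <= f7 + f8 by lra.
have S0' i : 0 < S t.+1.-1 i w by exact: S0.
have am := argmax_power wts t4 S0'.
(* Round [t + 1] uses the statistics of [t] rounds, so the exponent is [(t + 1) - 2 = t - 1]. *)
rewrite subSS subn1 in am.
have al0 i : 0 < N t i w / S t i w by exact: divr_gt0.
apply: le_trans (argmax_probability_le n1 al0 am k ks (enorm (mu ks) - delta)) _.
apply: lerD.
  rewrite /f7 -[leRHS]mulrA; apply: ler_wpM2l; first by rewrite exprn_ge0 ?mulr_ge0 ?pi_ge0.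
  rewrite (_ : enorm (mu ks) - delta = enorm (mu k) + gap - delta); last by ring.
  apply: (arm_tail (s := sigma2 k) (xi := xi)) => //.
  - by rewrite ln_ge0// ler1n.
  - exact: scatter_le.
  - by apply: le_trans dev _; rewrite mulrC divfK.
have M1E := wmean1E (fun l => X l ks w) (mu ks) (Ngt0 ks).
have M2E := wmean2E (fun l => X l ks w) (mu ks) (Ngt0 ks).
have h := odds (mean p X t ks w) t5 (power_sum_ge bandit wts ks w t1)
  (power_sum_le bandit t ks w) (low_scatter_ge eta0 t1 h6) (scatter_le eta0 t1 h5).
apply: le_trans (ler_wpM2l (p0 ks) h) _.
rewrite /f8 /odds_tilts mulrCA -mulr_sumr -mulrDr ler_wpM2l ?(ltW C10)//.
rewrite ler_wpM2l//; apply: lerD.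
  by rewrite /tilt expr0n /= !mul0r addr0 !mul0r !add0r.
apply: ler_sum => i _; rewrite M1E M2E.
by rewrite ![N t ks w * (_ / _)]mulrCA divff ?mulr1 ?gt_eqF.
Qed.

End pointwise.

Lemma arm_bound k ks (xi : R) : enorm (mu k) < enorm (mu ks) -> 0 < xi ->
  exists C, forall T, (1 <= T)%N ->
  bounded_sum P T
    ((1 + xi) * (sigma2 k / (enorm (mu ks) - enorm (mu k)) ^+ 2) * ln T%:R + C)
    (fun t => p t.+1 k).
Proof.
move=> gap0 xi0; rewrite -subr_gt0 in gap0.
have sk0 := sigma2_gt0 k; have ss0 := sigma2_gt0 ks.
(* Large enough for [u = 1 / j] to meet the condition of [slack_poly]; it depends on [xi] only, so
   the constant [C] is chosen before [T]. *)
pose j := maxn 2 (Num.truncn ((7 + 4 * xi) / xi)).+1.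
have j2 : (2 <= j)%N by exact: leq_maxl.
have jR : 2 <= j%:R :> R by rewrite ler_nat.
have uxi : j%:R^-1 * (7 + 4 * xi) <= xi.
  rewrite [leLHS]mulrC ler_pdivrMr; last by lra.
  rewrite [leRHS]mulrC -ler_pdivrMr//; apply: ltW; apply: lt_le_trans (truncnS_gt _) _.
  by rewrite ler_nat leq_maxr.
set gap := _ - _ in gap0 *.
pose u : R := j%:R^-1; pose delta := gap * u / 2; pose eta := delta / (8 * enorm (mu ks)).
have u0 : 0 < u by rewrite invr_gt0; lra.
have u1 : u <= 2^-1 by rewrite lef_pV2 ?posrE//; lra.
have gap_le : gap <= enorm (mu ks) by rewrite gerBl enorm_ge0.
have ell0 : 0 < enorm (mu ks) by exact: lt_le_trans gap_le.
have delta0 : 0 < delta by rewrite divr_gt0 ?mulr_gt0.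
have delta_le : delta <= enorm (mu ks).
  apply: le_trans gap_le; rewrite /delta -mulrA ler_piMr ?(ltW gap0)//; lra.
have eta0 : 0 < eta by rewrite divr_gt0 ?mulr_gt0.
have v0 : 0 < K%:R^-1 :> R by rewrite invr_gt0 ltr0n; exact: leq_trans K2.
have [cA [cB [C1 [n [l1 [l2 [cA0 cB0 C10 odds]]]]]]] :=
  odds_bound ss0 v0 delta0 delta_le.
have [c3 b3] := bounded_sum_deviation K2 sigma2_gt0 bandit wts k (divr_gt0 delta0 (ltr0n R 2)).
have [c4 b4] := bounded_sum_energy K2 sigma2_gt0 bandit wts k u0.
have [c5 b5] := bounded_sum_energy K2 sigma2_gt0 bandit wts ks eta0.
have [c6 b6] := bounded_sum_scatter K2 sigma2_gt0 bandit wts ks eta0.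
have ga0 : 0 < (1 - u) / (j%:R + 1) by rewrite divr_gt0//; lra.
pose c7 := 1 + expR ((1 - u) / (j%:R + 1)) * (1 - expR (- ((1 - u) / (j%:R + 1))))^-1.
pose A : R := (2 * pi) ^+ K * (4 * pi * j%:R).
have A0 : 0 <= A by rewrite mulr_ge0 ?exprn_ge0 ?mulr_ge0 ?pi_ge0.
pose c8 : R := C1 * ((1 + cA) / cA + \sum_(i < n) ((1 + cB) / cB)).
exists ((j.*2 + 5)%:R + 1 + c3 + c4 + c5 + c6 + A * c7 + c8) => T T1.
have L0 : 0 <= (1 + xi) * (sigma2 k / gap ^+ 2) * ln T%:R.
  rewrite mulr_ge0 ?ln_ge0 ?ler1n// mulr_ge0 ?divr_ge0 ?sqr_ge0 ?(ltW sk0)//; lra.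
have b7 := bounded_sumZ A0 (bounded_sum_tail P T1 ga0).
have b8 := bounded_sumZ (ltW C10) (bounded_sumD
  (bounded_sum_tilt K2 sigma2_gt0 bandit wts T 0 0 ks cA0)
  (bounded_sum_sum (fun i => bounded_sum_tilt K2 sigma2_gt0 bandit wts T (l1 i) (l2 i) ks cB0))).
have b := bounded_sumD (bounded_sumD (bounded_sumD (bounded_sumD (bounded_sumD (bounded_sumD
  (bounded_sumD (bounded_sum_initial P T (j.*2 + 5)) (bounded_sum_below K2 bandit T k L0))
  (b3 T)) (b4 T)) (b5 T)) (b6 T)) b7) b8.
rewrite [X in bounded_sum _ _ X _](_ : _ = (j.*2 + 5)%:R +
  ((1 + xi) * (sigma2 k / gap ^+ 2) * ln T%:R + 1) + c3 + c4 + c5 + c6 + A * c7 + c8); last by ring.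
apply: bounded_sum_ae_le b => [t|t w|].
- exact: (measurable_power bandit).
- exact: (power_ge0 bandit).
apply: filterS (scatter_gt0_ae K2 bandit wts) => w Sw t.
exact: (power_le_terms j2 (ltW xi0) uxi gap0 T1 C10 odds).
Qed.

End arm.

(** * The regret *)

Lemma limn_esup_le (R : realType) (f : nat -> \bar R) (a : \bar R) n0 :
  (forall n, (n0 <= n)%N -> (f n <= a)%E) -> (limn_esup f <= a)%E.
Proof.
move=> fa; apply: (@le_trans _ _ (ereal_sup [set f n | n in [set n | (n0 <= n)%N]])).
  apply: ereal_inf_lbound; exists [set n | (n0 <= n)%N] => //.
  exact: nbhs_infty_ge.
by apply: ge_ereal_sup => _ [n /= n0n <-]; exact: fa.
Qed.

Section regret.
Context {R : realType} {K : nat} {d : measure_display}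
  {Omega : measurableType d} (P : probability Omega R).
Variables (p : nat -> 'I_K -> Omega -> R)
  (X : nat -> 'I_K -> {RV P >-> (R * R)%type})
  (mu : 'I_K -> (R * R)%type) (sigma2 : 'I_K -> R) (ks : 'I_K).
Hypothesis K2 : (2 <= K)%N.
Hypothesis sigma2_gt0 : forall k, 0 < sigma2 k.
Hypothesis bandit : bandit_under_weighted_information p X mu sigma2.
Hypothesis wts : weighted_thompson_sampling p X.

Lemma expected_powerE t k : ('E_P[p t.+1 k])%E = (fine ('E_P[p t.+1 k])%E)%:E.
Proof.
rewrite fineK// ge0_fin_numE unlock; last first.
  by apply: integral_ge0 => w _; rewrite lee_fin (power_ge0 bandit).
apply: (@le_lt_trans _ _ (\int[P]_w (cst 1 w))%E).
  apply: ge0_le_integral => //.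
  - by move=> w _; rewrite lee_fin (power_ge0 bandit).
  - by apply/measurable_EFinP; exact: (measurable_power bandit).
  - by move=> w _; rewrite lee_fin (power_le1 bandit).
by rewrite integral_cst//= mul1e probability_setT ltry.
Qed.

Lemma sum_expected_power t : \sum_k fine ('E_P[p t.+1 k])%E = 1.
Proof.
apply: EFin_inj; rewrite -sumEFin.
under eq_bigr do rewrite -expected_powerE unlock.
rewrite -ge0_integral_sum//; last 2 first.
- by move=> k; apply/measurable_EFinP; exact: (measurable_power bandit).
- by move=> k w _; rewrite lee_fin (power_ge0 bandit).
under eq_integral do rewrite sumEFin (sum_power bandit)//.
by rewrite integral_cst//= mul1e probability_setT.
Qed.

Lemma expected_regretE T : expected_regret P p mu ks T =
  (\sum_(k < K | k != ks) (enorm (mu ks) - enorm (mu k)) *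
    \sum_(t < T) fine ('E_P[p t.+1 k])%E)%:E.
Proof.
rewrite /expected_regret big_add1 big_mkord.
under eq_bigr => t _.
  under eq_bigr do rewrite expected_powerE -EFinB -EFinM.
  rewrite sumEFin.
  rewrite (_ : \sum_k _ = \sum_(k < K | k != ks)
      (enorm (mu ks) - enorm (mu k)) * fine ('E_P[p t.+1 k])%E); last first.
    transitivity (\sum_k (enorm (mu ks) - enorm (mu k)) * fine ('E_P[p t.+1 k])%E).
      under eq_bigr do rewrite mulrBr.
      under [RHS]eq_bigr do rewrite mulrBl.
      rewrite !sumrB -mulr_sumr sum_expected_power mulr1; congr (_ - _).
      rewrite (bigD1 ks)//= eqxx mulr1 big1 ?addr0// => k /negbTE ->.
      by rewrite mulr0.
    by rewrite (bigD1 ks)//= subrr mul0r add0r.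
  over.
rewrite sumEFin exchange_big /=; congr EFin.
by apply: eq_bigr => k _; rewrite mulr_sumr.
Qed.

Lemma sum_expected_power_le k (xi : R) : enorm (mu k) < enorm (mu ks) -> 0 < xi ->
  exists C, forall T, (1 <= T)%N -> \sum_(t < T) fine ('E_P[p t.+1 k])%E <=
    (1 + xi) * (sigma2 k / (enorm (mu ks) - enorm (mu k)) ^+ 2) * ln T%:R + C.
Proof.
move=> gap0 xi0.
have [C h] := arm_bound K2 sigma2_gt0 bandit wts gap0 xi0.
exists C => T /h[_ _]; rewrite -lee_fin; apply: le_trans.
rewrite -sumEFin; apply: lee_sum => t _.
by rewrite -expected_powerE unlock.
Qed.

End regret.

Theorem theorem2 (R : realType) (K : nat) (mu : 'I_K -> R * R)
    (sigma2 : 'I_K -> R) (kstar : 'I_K) (d : measure_display)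
    (Omega : measurableType d) (P : probability Omega R)
    (p : nat -> 'I_K -> Omega -> R)
    (X : nat -> 'I_K -> {RV P >-> (R * R)%type}) :
  (2 <= K)%N ->
  (forall k, 0 < sigma2 k) ->
  (forall k, k != kstar -> enorm (mu k) < enorm (mu kstar)) ->
  bandit_under_weighted_information p X mu sigma2 ->
  weighted_thompson_sampling p X ->
  (limn_esup (fun T : nat =>
     expected_regret P p mu kstar T * ((ln T%:R)^-1)%:E) <=
   (\sum_(k < K | k != kstar)
      sigma2 k / (enorm (mu kstar) - enorm (mu k)))%:E)%E.
Proof.
move=> K2 sigma2_gt0 best bandit wts.
pose gap k := enorm (mu kstar) - enorm (mu k).
set b := \sum_(k < K | _) _.
have gap0 k : k != kstar -> 0 < gap k by move=> /best; rewrite subr_gt0.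
have b0 : 0 <= b.
  by apply: sumr_ge0 => k /gap0 g0; rewrite divr_ge0// ltW.
apply/lee_addgt0Pr => e e0; rewrite -EFinD.
(* Half of [e] is for the relative slack, since [xi b <= e / 2]; the other half is for the additive
   constants. The [+ 1] covers [b = 0]. *)
pose xi := e / (2 * (b + 1)).
have xi0 : 0 < xi by rewrite divr_gt0// mulr_gt0//; lra.
have : forall k, exists C, k != kstar -> forall T, (1 <= T)%N ->
    \sum_(t < T) fine ('E_P[p t.+1 k])%E <= (1 + xi) * (sigma2 k / gap k ^+ 2) * ln T%:R + C.
  move=> k; have [kk|kk] := eqVneq k kstar; first by exists 0.
  by have [C h] := sum_expected_power_le K2 sigma2_gt0 bandit wts (best k kk) xi0; exists C.
move=> /choice[C hC].
pose D := \sum_(k < K | k != kstar) gap k * C k.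
(* From here on [(e / 2) ln T] exceeds [D]; the offset 2 also ensures [ln T > 0]. *)
pose n0 := (Num.truncn (expR (`|D| / (e / 2)))).+2.
apply: (@limn_esup_le _ _ _ n0) => T n0T.
have T2 : (2 <= T)%N by exact: leq_trans n0T.
have T1 : (1 <= T)%N by exact: ltnW.
have lT0 : 0 < ln T%:R :> R by rewrite ln_gt0// ltr1n.
have DT : D <= e / 2 * ln T%:R.
  apply: le_trans (ler_norm _) _; rewrite mulrC -ler_pdivrMr ?divr_gt0//.
  rewrite -ler_expR lnK ?posrE ?ltr0n//.
  apply: ltW; apply: lt_le_trans (truncnS_gt _) _.
  by rewrite ler_nat ltnW.
rewrite (expected_regretE _ bandit) -EFinM lee_fin ler_pdivrMr//.
apply: (@le_trans _ _ (\sum_(k < K | k != kstar)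
    gap k * ((1 + xi) * (sigma2 k / gap k ^+ 2) * ln T%:R + C k))).
  apply: ler_sum => k kk; rewrite ler_wpM2l ?(ltW (gap0 k kk))//.
  exact: hC.
have -> : \sum_(k < K | k != kstar)
    gap k * ((1 + xi) * (sigma2 k / gap k ^+ 2) * ln T%:R + C k) =
    (1 + xi) * ln T%:R * b + D.
  rewrite /b mulr_sumr -big_split /=; apply: eq_bigr => k kk.
  by rewrite -/(gap k); field; rewrite gt_eqF// gap0.
have xib : xi * b <= e / 2.
  rewrite /xi [leLHS](_ : _ = e / 2 * (b / (b + 1))); last by field; lra.
  rewrite ler_piMr ?divr_ge0 ?(ltW e0)// ler_pdivrMr ?mul1r; lra.
have := ler_wpM2r (ltW lT0) xib.
rewrite (_ : (1 + xi) * ln T%:R * b = b * ln T%:R + xi * b * ln T%:R); last by ring.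
by rewrite mulrDl; lra.
Qed.
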